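(* For every language $L$ in the class $NP$ there exists a finite set $\mathcal{F}^<$ of finite ordered graphs with connected underlying graphs such that: (1) $L$ has a polynomial-time reduction to the $\mathcal{F}^<$-free ordering problem; and (2) for every graph ${\bf G}$ one can compute, in time polynomial in $|G|$, polynomially many inputs $I_1,\dots,I_k$ of $L$ such that ${\bf G}$ belongs to the language of the $\mathcal{F}^<$-free ordering problem if and only if $I_\ell\in L$ for every $1\le\ell\le k$.
   Context: An ordered graph ${\bf G}^<$ is a finite undirected graph ${\bf G}$ together with a fixed linear ordering $<$ of its vertices. For a fixed set $\mathcal{F}^<$ of ordered graphs, the $\mathcal{F}^<$-free ordering problem is: given a finite graph ${\bf G}$, does there exist a linear ordering $<$ of its vertices such that ${\bf G}^<$ contains no ordered subgraph (not necessarily induced) isomorphic as an ordered graph to a member of $\mathcal{F}^<$? *)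

(* Defs.v *)
From mathcomp Require Import all_boot fingroup perm.
Set Implicit Arguments. Unset Strict Implicit. Unset Printing Implicit Defensive.

Definition lang := seq bool -> Prop.

Inductive dir := DLeft | DRight | DStay.

(* Tape alphabet 'I_(k.+3): 0 = blank, 1 = bit false, 2 = bit true,
   further symbols are auxiliary.  States form an arbitrary finite type. *)
Record TM := mkTM {
  tm_Q : finType;
  tm_k : nat;
  tm_start : tm_Q;
  tm_halt : pred tm_Q;
  tm_acc : pred tm_Q;
  tm_delta : tm_Q -> 'I_(tm_k.+3) -> tm_Q * 'I_(tm_k.+3) * dir }.

Section TMSem.
Variable M : TM.
Notation sym := 'I_(tm_k M).+3.

Definition blank : sym := inord 0.
Definition bitsym (b : bool) : sym := if b then inord 2 else inord 1.

(* configuration: state, cells left of the head (nearest first),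
   cells from the head rightwards (missing cells are blank) *)
Definition config := (tm_Q M * seq sym * seq sym)%type.

Definition init (x : seq bool) : config := (@tm_start M, [::], map bitsym x).

Definition step (c : config) : config :=
  let: (q, l, r) := c in
  if @tm_halt M q then c else
  let: (q', b, d) := @tm_delta M q (head blank r) in
  let r' := b :: behead r in
  match d with
  | DLeft => match l with
             | a :: l' => (q', l', a :: r')
             | [::] => (q', [::], r')
             end
  | DRight => (q', b :: l, behead r)
  | DStay => (q', l, r')
  end.

Definition run (t : nat) (c : config) : config := iter t step c.

Fixpoint read_bits (r : seq sym) : seq bool :=
  match r with
  | s :: r' => if s == bitsym false then false :: read_bits r'
               else if s == bitsym true then true :: read_bits r'
               else [::]
  | [::] => [::]
  end.

Definition cfg_state (c : config) : tm_Q M := c.1.1.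
Definition cfg_output (c : config) : seq bool := read_bits c.2.

End TMSem.

Definition pbound (c k n : nat) : nat := c * n ^ k + c.

Definition poly_time_decides (M : TM) (V : lang) : Prop :=
  exists c k, forall x : seq bool,
    let cf := run (pbound c k (size x)) (init M x) in
    @tm_halt M (cfg_state cf) /\ (@tm_acc M (cfg_state cf) <-> V x).

Definition poly_time_computes (M : TM) (f : seq bool -> seq bool) : Prop :=
  exists c k, forall x : seq bool,
    let cf := run (pbound c k (size x)) (init M x) in
    @tm_halt M (cfg_state cf) /\ cfg_output cf = f x.

Definition poly_computable (f : seq bool -> seq bool) : Prop :=
  exists M : TM, poly_time_computes M f.

Definition in_P (V : lang) : Prop := exists M : TM, poly_time_decides M V.

Definition dbl (x : seq bool) : seq bool := flatten (map (fun b => [:: b; b]) x).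
Definition enc_pair (x y : seq bool) : seq bool := dbl x ++ [:: false; true] ++ y.
Definition enc_list (ls : seq (seq bool)) : seq bool :=
  flatten (map (fun s => dbl s ++ [:: false; true]) ls).

Definition in_NP (L : lang) : Prop :=
  exists (V : lang) (c k : nat), in_P V /\
    forall x, L x <-> exists y, size y <= pbound c k (size x) /\ V (enc_pair x y).

Definition poly_reduces (L1 L2 : lang) : Prop :=
  exists f, poly_computable f /\ forall x, L1 x <-> L2 (f x).

(* A graph on vertex set 'I_n is given by its n*n adjacency bit matrix bs
   (row-major); it is well formed if symmetric and irreflexive. *)
Definition gadj (n : nat) (bs : seq bool) (i j : 'I_n) : bool :=
  nth false bs (i * n + j).

Definition wf_graph (n : nat) (bs : seq bool) : Prop :=
  size bs = n * n /\
  (forall i j : 'I_n, gadj bs i j = gadj bs j i) /\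
  (forall i : 'I_n, gadj bs i i = false).

Definition graph_code (x : seq bool) (n : nat) (bs : seq bool) : Prop :=
  wf_graph n bs /\ x = nseq n true ++ false :: bs.

(* An ordered graph (m, bs): graph on 'I_m ordered by the natural order. *)
Definition ograph := (nat * seq bool)%type.

Definition wf_ograph (F : ograph) : Prop := wf_graph F.1 F.2.

(* underlying graph connected (connected graphs are nonempty) *)
Definition connected_ograph (F : ograph) : Prop :=
  0 < F.1 /\ forall i j : 'I_F.1, connect (gadj F.2) i j.

(* The ordered graph G^< (vertex u before v iff pos u < pos v) contains an
   ordered subgraph (not necessarily induced) isomorphic to F. *)
Definition contains_ordered (n : nat) (bs : seq bool) (pos : {perm 'I_n})
    (F : ograph) : Prop :=
  exists phi : 'I_F.1 -> 'I_n,
    (forall i j : 'I_F.1, i < j -> pos (phi i) < pos (phi j)) /\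
    (forall i j : 'I_F.1, gadj F.2 i j -> gadj bs (phi i) (phi j)).

Definition FFO (Fs : seq ograph) : lang := fun x =>
  exists n bs, graph_code x n bs /\
    exists pos : {perm 'I_n}, forall F, F \in Fs -> ~ contains_ordered bs pos F.

(* Main.v *)
Require Import Defs.
From mathcomp Require Import all_boot fingroup perm.
From mathcomp Require Import zify.
From Stdlib Require Import FunctionalExtensionality ClassicalEpsilon.
Set Implicit Arguments. Unset Strict Implicit. Unset Printing Implicit Defensive.

(** A computation is drawn in a graph as a grid of cells. A cell is a copy of a rigid graph
    (the complement of a lollipop), whose shape gives one of eight labels and which has
    private pairs of vertices; the relative order of these pairs under a vertex ordering
    encodes a state of the cell. Edges between prescribed vertices link a cell to its left
    and upper neighbours. The forbidden family consists of all connected ordered graphs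
    made of at most five cells in which overlapping cells differ, links are not functional,
    squares do not commute, or the states violate a local rule.

    The local rules make the states of a full grid the slanted space-time diagram of two
    machines: the verifier of [L], run on the input written in the labels of the top row
    followed by a certificate left free to the ordering, and a clock, which fixes the length of
    the certificate and runs long enough for the verifier to halt. The final corner cell rejects
    if the clock has finished and the verifier has not accepted. Cells with missing
    ancestors may take a joker state, so that the only constraints of an arbitrary
    graph come from complete grids: either a structural violation is present, which no
    ordering repairs, or the graph is orderable exactly when each input written on
    a complete grid with a final cell is in [L]. The clock part of the states is forced
    by the labels, so that these inputs can be computed by dynamic programming. If there is
    no [n0] outside [L] to output for structural violations, the empty family does.

    Machines are obtained from functions on bit strings defined by bounded recursion on
    notation, compiled to programs on stacks and then to a multi-track tape. *)

(** Subgraphs are not induced, so a pattern can demand edges but never their absence. A cell is thus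
    recognized only by edges that it has, and a missing neighbour cannot be forbidden: this is why
    incomplete grids must be made harmless by a joker. The clock answers another obstacle. An
    arbitrary graph may contain a grid too small for the verifier to halt, or with a guessed region
    of the wrong length. Too short a region could make a positive instance unorderable, too long a
    region could admit certificates beyond the bound. The final cell therefore stays silent unless
    the clock confirms both the length and the size. The gadgets are dense so that any two of their
    vertices have a common neighbour. Every gadget edge then lies in a triangle, whereas the link
    edges of the graph built by the reduction lie in none; hence no unintended copy of a gadget
    straddles two cells. Five cells are what a commuting square takes: a corner, its left and upper
    neighbours, and the two candidates for the opposite corner. *)

Local Notation "o .[ a ]" := (nth 0 o.2 a).
Notation obj := (nat * seq nat)%type.

(** * Stack programs and Turing machines *)

Section AbstractRun.
Variable M : TM.
Notation sym := 'I_(tm_k M).+3.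

(** The zipper of [config] shifts with every move; a total tape with an absolute head position lets
    invariants speak about fixed cells. *)
Definition aconf := (tm_Q M * nat * (nat -> sym))%type.

Definition updt (f : nat -> sym) p b := fun j => if j == p then b else f j.

(** The truncated predecessor [0.-1 = 0] is the left end of the tape, where [step] leaves the head
    in place as well. *)
Definition mv d p := match d with DLeft => p.-1 | DRight => p.+1 | DStay => p end.

Definition astep (c : aconf) : aconf :=
  let: (q, p, f) := c in
  if @tm_halt M q then c else
  let: (q', b, d) := @tm_delta M q (f p) in (q', mv d p, updt f p b).

Definition abs (c : config M) : aconf :=
  (c.1.1, size c.1.2, nth (blank M) (catrev c.1.2 c.2)).

Lemma nth_catrev (l r : seq sym) j :
  nth (blank M) (catrev l r) j =
  if j < size l then nth (blank M) l (size l - j.+1) else nth (blank M) r (j - size l).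
Proof. by rewrite catrevE nth_cat size_rev; case: ltnP => // h; rewrite nth_rev. Qed.

Lemma abs_step c : abs (step c) = astep (abs c).
Proof.
case: c => [[q l] r]; rewrite /step /astep /abs /=.
case: ifP => // hq.
rewrite nth_catrev ltnn subnn nth0.
case: tm_delta => [[q' b] d].
have E : updt (nth (blank M) (catrev l r)) (size l) b =
         nth (blank M) (catrev l (b :: behead r)).
  apply: functional_extensionality => j; rewrite /updt !nth_catrev.
  case: eqP => [->|/eqP hj]; first by rewrite ltnn subnn.
  case: ltnP => // h.
  have -> : j - size l = (j - size l).-1.+1 by lia.
  by rewrite /= nth_behead.
by rewrite E; case: d => //=; case: l {E}.
Qed.

Lemma abs_run t c : abs (run t c) = iter t astep (abs c).
Proof. by elim: t => //= t IH; rewrite abs_step IH. Qed.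

Lemma updt_id f p : updt f p (f p) = f.
Proof. by apply: functional_extensionality => j; rewrite /updt; case: eqP => [->|]. Qed.

Lemma bitsym_neq b : bitsym M b != blank M.
Proof. by case: b; rewrite -val_eqE /= !inordK. Qed.

Lemma bitsym_tf : (bitsym M true == bitsym M false) = false.
Proof. by rewrite -val_eqE /= !inordK. Qed.

Lemma read_bitsE (y : seq bool) r :
  (forall j, j < size y -> nth (blank M) r j = bitsym M (nth false y j)) ->
  nth (blank M) r (size y) = blank M -> read_bits r = y.
Proof.
elim: y r => [|b y IH] [|a r] //= h1 h2.
- rewrite h2; have := bitsym_neq false; have := bitsym_neq true.
  by rewrite !(eq_sym (blank M)) => /negbTE -> /negbTE ->.
- by have /eqP := h1 0 isT; rewrite /= eq_sym (negbTE (bitsym_neq _)).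
have /= -> := h1 0 isT.
have -> : read_bits r = y by apply: IH => // j hj; apply: (h1 j.+1).
by case: b {h1}; rewrite ?eqxx ?bitsym_tf.
Qed.

Lemma run_halted t t' c : @tm_halt M (cfg_state (run t c)) -> t <= t' ->
  run t' c = run t c.
Proof.
move=> h /subnK <-; rewrite /run iterD -/(run t c).
elim: (t' - t) => //= n ->; case: (run t c) h => [[q l] r] /=.
by rewrite /cfg_state /= => ->.
Qed.

End AbstractRun.

(** * Programs on stacks and their flow graphs *)

Inductive prog :=
| Skip
| Push (r : nat) (b : bool)
| Pop (r : nat)
| Seq (p q : prog)
| Case (r : nat) (p0 pf pt : prog)
| While (r : nat) (p : prog).

Definition store := nat -> seq bool.

Definition upd (s : store) r v : store := fun i => if i == r then v else s i.

(** The number counts executed instructions of the flow graph, with sequencing free and each test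
    costing one, so that compilation preserves it exactly. *)
Inductive exec : prog -> store -> nat -> store -> Prop :=
| XSkip s : exec Skip s 0 s
| XPush r b s : exec (Push r b) s 1 (upd s r (b :: s r))
| XPop r s : exec (Pop r) s 1 (upd s r (behead (s r)))
| XSeq p q s t1 s1 t2 s2 :
    exec p s t1 s1 -> exec q s1 t2 s2 -> exec (Seq p q) s (t1 + t2) s2
| XCase r p0 pf pt s t s' :
    exec (match s r with [::] => p0 | b :: _ => if b then pt else pf end) s t s' ->
    exec (Case r p0 pf pt) s t.+1 s'
| XWhile0 r p s : s r = [::] -> exec (While r p) s 1 s
| XWhileS r p s t1 s1 t2 s2 : s r <> [::] ->
    exec p s t1 s1 -> exec (While r p) s1 t2 s2 -> exec (While r p) s (t1 + t2).+1 s2.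

Inductive instr (Q : Type) :=
| IPush (r : nat) (b : bool) (q : Q)
| IPop (r : nat) (q : Q)
| ICase (r : nat) (q0 qf qt : Q).

Definition imap Q Q' (e : Q -> Q') (i : instr Q) : instr Q' :=
  match i with
  | IPush r b q => IPush r b (e q)
  | IPop r q => IPop r (e q)
  | ICase r q0 qf qt => ICase r (e q0) (e qf) (e qt)
  end.

Definition ireg Q (i : instr Q) :=
  match i with IPush r _ _ | IPop r _ | ICase r _ _ _ => r end.

(* The control point None is the exit. *)
Record flow := Flow {
  fS : finType;
  fcode : fS -> instr (option fS);
  fstart : option fS }.

Definition fapply Q (i : instr Q) (s : store) : Q * store :=
  match i with
  | IPush r b q => (q, upd s r (b :: s r))
  | IPop r q => (q, upd s r (behead (s r)))
  | ICase r q0 qf qt =>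
      (match s r with [::] => q0 | b :: _ => if b then qt else qf end, s)
  end.

Inductive freach (F : flow) : nat -> option (fS F) * store -> option (fS F) * store -> Prop :=
| FR0 c : freach 0 c c
| FRS x s n c : freach n (fapply (fcode x) s) c -> freach n.+1 (Some x, s) c.

Lemma freach_trans F n1 n2 c1 c2 c3 :
  @freach F n1 c1 c2 -> freach n2 c2 c3 -> freach (n1 + n2) c1 c3.
Proof. by elim=> // x s n c _ IH /IH h; apply: FRS. Qed.

(** Only the points [Some x] are constrained, so [e] may send the exit [None] anywhere: this is how
    the end of a subprogram is redirected to its continuation. *)
Lemma freach_lift F F' (i : fS F -> fS F') e :
  (forall x, e (Some x) = Some (i x)) ->
  (forall x, fcode (i x) = imap e (fcode x)) ->
  forall n c c', @freach F n c c' -> @freach F' n (e c.1, c.2) (e c'.1, c'.2).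
Proof.
move=> he hc n c c'; elim=> {n c c'} [c|x s n c _ IH]; first exact: FR0.
rewrite /= he; apply: FRS; rewrite hc.
by move: IH; case: (fcode x) => //= r q0 qf qt; case: (s r) => [|[] ?].
Qed.

Fixpoint compile (p : prog) : flow :=
  match p with
  | Skip => @Flow void (fun x => match x with end) None
  | Push r b => @Flow unit (fun _ => IPush r b None) (Some tt)
  | Pop r => @Flow unit (fun _ => IPop r None) (Some tt)
  | Seq p q =>
      let P := compile p in let Q := compile q in
      let e := fun o => if o is Some x then Some (inl x) else omap inr (fstart Q) in
      @Flow (fS P + fS Q)%type
        (fun x => match x with
                  | inl x => imap e (fcode x)
                  | inr x => imap (omap inr) (fcode x)
                  end) (e (fstart P))
  | Case r p0 pf pt =>
      let P0 := compile p0 in let Pf := compile pf in let Pt := compile pt in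
      @Flow (option (fS P0 + (fS Pf + fS Pt)))%type
        (fun x => match x with
                  | None => ICase r (omap (fun x => Some (inl x)) (fstart P0))
                              (omap (fun x => Some (inr (inl x))) (fstart Pf))
                              (omap (fun x => Some (inr (inr x))) (fstart Pt))
                  | Some (inl x) => imap (omap (fun x => Some (inl x))) (fcode x)
                  | Some (inr (inl x)) => imap (omap (fun x => Some (inr (inl x)))) (fcode x)
                  | Some (inr (inr x)) => imap (omap (fun x => Some (inr (inr x)))) (fcode x)
                  end) (Some None)
  | While r p =>
      let P := compile p in
      let e := fun o => if o is Some x then Some (Some x) else Some None in
      @Flow (option (fS P))
        (fun x => match x with
                  | None => ICase r None (e (fstart P)) (e (fstart P))
                  | Some x => imap e (fcode x)
                  end) (Some None)
  end.

Lemma compile_exec p s t s' : exec p s t s' ->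
  freach t (fstart (compile p), s) (None, s').
Proof.
elim=> {p s t s'}.
- by move=> s; apply: FR0.
- by move=> r b s; apply: FRS; apply: FR0.
- by move=> r s; apply: FRS; apply: FR0.
- move=> p q s t1 s1 t2 s2 _ IH1 _ IH2.
  set F := compile (Seq p q).
  pose e (o : option (fS (compile p))) : option (fS F) :=
    if o is Some x then Some (inl x) else omap inr (fstart (compile q)).
  have h1 := @freach_lift _ F inl e (fun=> erefl) (fun=> erefl) _ _ _ IH1.
  have h2 := @freach_lift _ F inr (omap inr) (fun=> erefl) (fun=> erefl) _ _ _ IH2.
  exact: freach_trans h1 h2.
- move=> r p0 pf pt s t s' _ IH.
  set F := compile (Case r p0 pf pt).
  apply: (@FRS F None); rewrite /=.
  case: (s r) IH => [|[] u] IH.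
  + exact: (@freach_lift _ F (fun x => Some (inl x)) (omap _) (fun=> erefl) (fun=> erefl) _ _ _ IH).
  + exact: (@freach_lift _ F (fun x => Some (inr (inr x))) (omap _) (fun=> erefl) (fun=> erefl) _ _ _ IH).
  + exact: (@freach_lift _ F (fun x => Some (inr (inl x))) (omap _) (fun=> erefl) (fun=> erefl) _ _ _ IH).
- move=> r p s h; apply: (@FRS (compile (While r p)) None); rewrite /= h; exact: FR0.
- move=> r p s t1 s1 t2 s2 h _ IH1 _ IH2.
  set F := compile (While r p).
  apply: (@FRS F None); rewrite /=.
  have h1 := @freach_lift _ F Some (fun o => if o is Some x then Some (Some x) else Some None)
     (fun=> erefl) (fun=> erefl) _ _ _ IH1.
  by case: (s r) h => // b u _; rewrite if_same; apply: freach_trans h1 IH2.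
Qed.

(** * Simulation of a flow graph on a multi-track tape *)

Section FlowTM.
Variable F : flow.

(* Each register is a stack on its own track, with its top in cell 0; the boolean of a tape
   symbol marks cell 0, where the head returns after every instruction. *)
Definition nreg := \max_(x : fS F) ireg (fcode x).
Notation tracks := {ffun 'I_nreg.+1 -> option bool}.
Notation cellT := (bool * tracks)%type.
Definition ksym := #|{: cellT}|.
Notation sym := 'I_ksym.+3.

(** Symbols 0 to 2 keep their meaning for input and output, so multi-track cells start at 3. *)
Definition enc (c : cellT) : sym := inord (3 + enum_rank c).

(** A raw symbol counts as a cell with its bit on track 0 and nothing elsewhere: the untouched input
    already represents register 0, and unvisited blanks are empty cells. *)
Definition raw (o : option bool) : cellT := (false, [ffun i => if i == ord0 then o else None]).

Definition dec (s : sym) : cellT :=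
  match nat_of_ord s with
  | 0 => raw None
  | 1 => raw (Some false)
  | 2 => raw (Some true)
  | k.+3 => if insub k : option 'I_#|{: cellT}| is Some i then enum_val i else raw None
  end.

Lemma encK c : dec (enc c) = c.
Proof.
rewrite /dec /enc inordK; last by exact: (ltn_ord (enum_rank c)).
by rewrite /= valK enum_rankK.
Qed.

Definition rawsym (o : option bool) : sym :=
  match o with None => inord 0 | Some b => if b then inord 2 else inord 1 end.

Lemma rawsymK o : dec (rawsym o) = raw o.
Proof. by case: o => [[]|]; rewrite /dec /rawsym inordK. Qed.

(** Mode, control point to continue at, register being worked on, bit carried by the head. *)
Definition stT := ('I_9 * option (fS F) * 'I_nreg.+1 * option bool)%type.

Definition mkst (m : 'I_9) o (r : nat) c : stT := (m, o, inord r, c).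
Definition qInit := mkst (@Ordinal 9 0 isT) None 0 None.
Definition qMain o := mkst (@Ordinal 9 1 isT) o 0 None.
Definition qPush r c o := mkst (@Ordinal 9 2 isT) o r c.
Definition qRet o := mkst (@Ordinal 9 3 isT) o 0 None.
Definition qPopR r o := mkst (@Ordinal 9 4 isT) o r None.
Definition qPopL r c o := mkst (@Ordinal 9 5 isT) o r c.
Definition qOut1 := mkst (@Ordinal 9 6 isT) None 0 None.
Definition qOut2 := mkst (@Ordinal 9 7 isT) None 0 None.
Definition qHalt := mkst (@Ordinal 9 8 isT) None 0 None.

Definition settr (c : cellT) (r : 'I_nreg.+1) (v : option bool) : cellT :=
  (c.1, [ffun i => if i == r then v else c.2 i]).

(** Mode 0 marks cell 0; 1 dispatches an instruction; 2 pushes while walking right and 3 walks back;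
    4 walks to the end of a track and 5 pops by shifting on the way back; 6 turns track 0 into raw
    symbols; 7 walks back and converts cell 0, whose mark has to survive until then; 8 is the
    halting mode. *)
Definition fdelta (q : stT) (s : sym) : stT * sym * dir :=
  let: (m, o, r, c) := q in
  let tr := dec s in
  match nat_of_ord m with
  | 0 => (qMain (fstart F), enc (true, tr.2), DStay)
  | 1 => match o with
         | None => (qOut1, s, DStay)
         | Some x => match fcode x with
           | IPush r b q' => (qPush r (Some b) q', s, DStay)
           | IPop r q' => (qPopR r q', s, DStay)
           | ICase r q0 qf qt =>
             (qMain (match tr.2 (inord r) with
                     | None => q0 | Some b => if b then qt else qf end), s, DStay)
           end
         end
  | 2 => match tr.2 r with
         | None => (qRet o, enc (settr tr r c), DStay)
         | Some b => (qPush r (Some b) o, enc (settr tr r c), DRight)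
         end
  | 3 => if tr.1 then (qMain o, s, DStay) else (qRet o, s, DLeft)
  | 4 => match tr.2 r with
         | None => (qPopL r None o, s, DStay)
         | Some _ => (qPopR r o, s, DRight)
         end
  | 5 => if tr.1 then (qMain o, enc (settr tr r c), DStay)
         else (qPopL r (tr.2 r) o, enc (settr tr r c), DLeft)
  | 6 => let s' := if tr.1 then s else rawsym (tr.2 ord0) in
         match tr.2 ord0 with
         | None => (qOut2, s', DStay)
         | Some b => (qOut1, s', DRight)
         end
  | 7 => if tr.1 then (qHalt, rawsym (tr.2 ord0), DStay) else (qOut2, s, DLeft)
  | _ => (q, s, DStay)
  end.

Definition flowTM : TM :=
  @mkTM stT ksym qInit (fun q => nat_of_ord q.1.1.1 == 8) xpred0 fdelta.

Notation astep := (@astep flowTM).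
Notation updt := (@updt flowTM).

Implicit Types (f : nat -> sym) (s : store).

Definition marked f := forall j, (dec (f j)).1 = (j == 0).

(** Each cell takes the carried bit and hands its own to the next, so the track moves one cell to
    the right until the first empty cell absorbs the last bit. *)
Lemma push_walk (r : nat) o v c p f :
  (forall i, (dec (f (p + i))).2 (inord r) = onth v i) ->
  exists f', iter (size v).+1 astep (qPush r c o, p, f) = (qRet o, p + size v, f') /\
   forall j, dec (f' j) = if j < p then dec (f j) else if j <= p + size v then
      settr (dec (f j)) (inord r) (if j == p then c else onth v (j - p).-1)
      else dec (f j).
Proof.
elim: v c p f => [|b v IH] c p f h.
  have h0 := h 0; rewrite addn0 /= in h0.
  eexists; split.
    by rewrite /= /fdelta /qPush /mkst h0 addn0.
  move=> j; rewrite /updt addn0; case: eqP => [->|/eqP hj].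
    by rewrite ltnn leqnn encK.
  by case: ltnP => // h1; case: leqP => // h2; exfalso; lia.
have h0 := h 0; rewrite addn0 /= in h0.
pose f1 := updt f p (enc (settr (dec (f p)) (inord r) c)).
have [|f' [E1 E2]] := IH (Some b) p.+1 f1.
  move=> i; rewrite addSnnS -[onth v i]/(onth (b :: v) i.+1) -h /f1 /updt.
  by case: eqP => //; lia.
exists f'; split.
  rewrite iterSr [X in iter _ _ X](_ : _ = (qPush r (Some b) o, p.+1, f1)) ?E1 ?addSnnS //.
  by rewrite /= /fdelta /qPush /mkst h0 /= inord_val.
move=> j; rewrite E2 /f1 /updt.
case: (ltngtP j p) => hj; last 1 first.
- by subst j; rewrite ltnS leqnn leq_addr encK.
- by rewrite ltnS (ltnW hj).
rewrite ltnS leqNgt hj /= addSnnS /=; case: ifP => // _.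
by case: (j =P p.+1) => [->|hj2]; rewrite ?subSnn //; congr settr; have -> : (j - p).-1 = (j - p.+1).-1.+1 by lia.
Qed.

Lemma ret_walk o p f : marked f ->
  iter p.+1 astep (qRet o, p, f) = (qMain o, 0, f).
Proof.
move=> h; elim: p => [|p IH].
  by rewrite /= /fdelta /qRet /mkst h /= updt_id.
rewrite iterSr [X in iter _ _ X](_ : _ = (qRet o, p, f)) //.
by rewrite /= /fdelta /qRet /mkst h /= updt_id.
Qed.

Lemma popR_walk (r : nat) o v p f :
  (forall i, (dec (f (p + i))).2 (inord r) = onth v i) ->
  iter (size v).+1 astep (qPopR r o, p, f) = (qPopL r None o, p + size v, f).
Proof.
elim: v p => [|b v IH] p h; have h0 := h 0; rewrite addn0 /= in h0.
  by rewrite /= /fdelta /qPopR /qPopL /mkst h0 /= inord_val updt_id addn0.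
rewrite iterSr [X in iter _ _ X](_ : _ = (qPopR r o, p.+1, f)); last first.
  by rewrite /= /fdelta /qPopR /mkst h0 /= inord_val updt_id.
by rewrite IH ?addSnnS // => i; rewrite addSnnS h.
Qed.

(** Walking back from the end of the track, every cell takes over the bit of its right neighbour,
    and the bit of cell 0 is lost. *)
Lemma popL_walk (r : nat) o c p f : marked f ->
  exists f', iter p.+1 astep (qPopL r c o, p, f) = (qMain o, 0, f') /\
  forall j, dec (f' j) = if j <= p then
      settr (dec (f j)) (inord r) (if j == p then c else (dec (f j.+1)).2 (inord r))
    else dec (f j).
Proof.
elim: p c f => [|p IH] c f h.
  eexists; split; first by rewrite /= /fdelta /qPopL /mkst h /=.
  by move=> j; rewrite /updt leqn0; case: eqP => [->|] //; rewrite encK.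
pose f1 := updt f p.+1 (enc (settr (dec (f p.+1)) (inord r) c)).
have [|f' [E1 E2]] := IH ((dec (f p.+1)).2 (inord r)) f1.
  by move=> j; rewrite /f1 /updt; case: eqP => [->|] //; rewrite encK /= h.
exists f'; split.
  rewrite iterSr [X in iter _ _ X](_ : _ = (qPopL r ((dec (f p.+1)).2 (inord r)) o, p, f1)) //.
  by rewrite /= /fdelta /qPopL /mkst h /= inord_val.
move=> j; rewrite E2 /f1 /updt.
case: (ltngtP j p.+1) => hj; first rewrite -ltnS hj.
- congr settr; case: (j =P p) => [->|hj2] //; rewrite ?ifF //; apply/negbTE; lia.
- by rewrite leqNgt (ltnW hj).
- by subst j; rewrite ltnn encK.
Qed.

Definition rep s f := forall j, dec (f j) = (j == 0, [ffun r : 'I_nreg.+1 => onth (s r) j]).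

Lemma rep_marked s f : rep s f -> marked f.
Proof. by move=> h j; rewrite h. Qed.

Lemma onth_behead T (v : seq T) j : onth (behead v) j = onth v j.+1.
Proof. by case: v => //; case: j. Qed.

Lemma onth_over T (v : seq T) j : size v <= j -> onth v j = None.
Proof. by elim: v j => [|x v IH] [|j] //= h; apply: IH. Qed.

Lemma sim_instr x s f : rep s f ->
  exists n f', [/\ n <= 2 * size (s (ireg (fcode x))) + 4,
    iter n astep (qMain (Some x), 0, f) =
      (qMain (fapply (fcode x) s).1, 0, f') & rep (fapply (fcode x) s).2 f'].
Proof.
move=> h.
have hr : ireg (fcode x) < nreg.+1 by rewrite ltnS /nreg (leq_bigmax x).
have hT j r : r < nreg.+1 -> (dec (f j)).2 (inord r) = onth (s r) j.
  by move=> h'; rewrite h ffunE inordK.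
have updE (s' : store) r v j : r < nreg.+1 ->
    [ffun r0 : 'I_nreg.+1 => onth (upd s' r v r0) j] =
    [ffun r0 : 'I_nreg.+1 => if r0 == inord r then onth v j else onth (s' r0) j].
  move=> h'; apply/ffunP => i; rewrite !ffunE /upd -val_eqE /= inordK //.
  by case: ifP.
case E : (fcode x) hr => [r b q|r q|r q0 qf qt] /= hr.
- have [|f' [E1 E2]] := @push_walk r q (s r) (Some b) 0 f.
    by move=> i; rewrite hT.
  exists ((size (s r)).+1 + ((size (s r)).+1 + 1)), f'; split; first lia.
    rewrite iterD [X in iter _ _ X](_ : _ = (qRet q, 0 + size (s r), f')).
      by rewrite ret_walk // => j; rewrite E2 /= h; case: ifP.
    rewrite iterD -E1; congr (iter _ _ _).
    by rewrite /= /fdelta /qMain /mkst E /= updt_id.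
  move=> j; rewrite E2 ltn0 add0n h /settr /= updE //.
  case: leqP => hj; congr (_, _); apply/ffunP => i; rewrite !ffunE.
    rewrite subn0; case: eqP => // _; case: (j) => [|j0] //=.
  case: eqP => [->|] //; rewrite inordK // !onth_over //; exact: ltnW.
- exists ((size (s r)).+1 + ((size (s r)).+1 + 1)).
  have [f' [E1 E2]] := @popL_walk r q None (size (s r)) f (rep_marked h).
  exists f'; split; first lia.
    rewrite iterD [X in iter _ _ X](_ : _ = (qPopL r None q, 0 + size (s r), f)) //.
    rewrite iterD -(@popR_walk r q (s r) 0 f); last by move=> i; rewrite hT.
    by congr (iter _ _ _); rewrite /= /fdelta /qMain /mkst E /= updt_id.
  move=> j; rewrite E2 h /settr /= updE // hT //.
  case: leqP => hj; congr (_, _); apply/ffunP => i; rewrite !ffunE onth_behead.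
    by case: eqP => // _; case: eqP => // ->; rewrite onth_over.
  case: eqP => [->|] //; rewrite inordK // !onth_over //; lia.
- exists 1, f; split; [lia| |by []].
  rewrite /= /fdelta /qMain /mkst E hT //= updt_id.
  by case: (s r) => [|[] ?].
Qed.

(** An instruction lengthens a stack by at most one, so the bound [B] on stack size plus remaining
    instructions is invariant, and each instruction costs at most [2 * B + 4] steps. *)
Lemma sim_flow n c c' : @freach F n c c' -> c'.1 = None -> forall f B, rep c.2 f ->
  (forall r, size (c.2 r) + n <= B) ->
  exists k f', [/\ k <= n * (2 * B + 4),
     iter k astep (qMain c.1, 0, f) = (qMain None, 0, f') & rep c'.2 f'].
Proof.
elim=> {n c c'} [c|x s n c _ IH] hc f B h hB.
  by exists 0, f; rewrite -hc.
have [k1 [f1 [hk1 E1 h1]]] := sim_instr x h.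
have [|k2 [f2 [hk2 E2 h2]]] := IH hc _ B h1.
  move=> r; have := hB r; case: (fcode x) => [r' b q|r' q|r' q0 qf qt] /=; last lia.
    by rewrite /upd; case: eqP => [->|] /=; lia.
  by rewrite /upd; case: eqP => [->|] /=; rewrite ?size_behead; lia.
exists (k2 + k1), f2; split=> //; last by rewrite iterD E1.
rewrite mulSn addnC; apply: leq_add => //; apply: leq_trans hk1 _.
by have := hB (ireg (fcode x)); rewrite /=; lia.
Qed.

Lemma out1_walk v p f :
  (forall i, (dec (f (p + i))).2 ord0 = onth v i) -> 
  exists f', iter (size v).+1 astep (qOut1, p, f) = (qOut2, p + size v, f') /\
   forall j, f' j = if (p <= j <= p + size v) && ~~ (dec (f j)).1
                    then rawsym (onth v (j - p)) else f j.
Proof.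
elim: v p f => [|b v IH] p f h; have h0 := h 0; rewrite addn0 /= in h0.
  eexists; split; first by rewrite /= /fdelta /qOut1 /mkst h0 addn0 /=.
  move=> j; rewrite /updt addn0 -eqn_leq eq_sym; case: eqP => [->|] //=.
  by rewrite subnn; case: (dec _).1.
pose f1 := updt f p (if (dec (f p)).1 then f p else rawsym (Some b)).
have [|f' [E1 E2]] := IH p.+1 f1.
  move=> i; rewrite /f1 /updt addSnnS; case: eqP => [|_]; [lia|exact: h].
exists f'; split.
  rewrite iterSr [X in iter _ _ X](_ : _ = (qOut1, p.+1, f1)) ?E1 ?addSnnS //.
  by rewrite /= /fdelta /qOut1 /mkst h0 /=.
move=> j; rewrite E2 /f1 /updt.
case: (ltngtP j p) => hj //=; last first.
  by subst j; rewrite subnn leq_addr /=; case: (dec (f p)).1.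
rewrite addSnnS /=; case: ifP => // _; congr rawsym.
by have -> : j - p = (j - p.+1).+1 by lia.
Qed.

Lemma out2_walk p f : marked f ->
  iter p.+1 astep (qOut2, p, f) = (qHalt, 0, updt f 0 (rawsym ((dec (f 0)).2 ord0))).
Proof.
move=> h; elim: p => [|p IH].
  by rewrite /= /fdelta /qOut2 /mkst h /=.
rewrite iterSr [X in iter _ _ X](_ : _ = (qOut2, p, f)) //.
by rewrite /= /fdelta /qOut2 /mkst h /= updt_id.
Qed.

Lemma sim_total x (s0 := fun r => if r == 0 then x else [::]) n s :
  freach n (fstart F, s0) (None, s) ->
  exists2 t, t <= n * (2 * (size x + n) + 4) + 2 * (size x + n) + 4 &
    let cf := run t (init flowTM x) in
    @tm_halt flowTM (cfg_state cf) /\ cfg_output cf = s 0.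
Proof.
move=> hn.
have Hsz m c c' : @freach F m c c' -> forall B, (forall r, size (c.2 r) + m <= B) ->
    forall r, size (c'.2 r) <= B.
  elim=> {m c c'} [c|y z m c _ IH] B hB; first by move=> r; have := hB r; lia.
  apply: IH => r; have := hB r; case: (fcode y) => [r' b q|r' q|r' q0 qf qt] /=; last lia.
    by rewrite /upd; case: eqP => [->|] /=; lia.
  by rewrite /upd; case: eqP => [->|] /=; rewrite ?size_behead; lia.
have hB0 r : size (s0 r) + n <= size x + n by rewrite /s0; case: eqP => //= _; lia.
have hs := Hsz _ _ _ hn _ hB0.
have E0 : abs (init flowTM x) = (qInit, 0, fun j => rawsym (onth x j)).
  rewrite /abs /=; congr pair; apply: functional_extensionality => j.
  by elim: x j {s0 hn hB0 hs} => [|b x IH] [|j] //=.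
pose f0 : nat -> sym := fun j => rawsym (onth x j).
pose f1 := updt f0 0 (enc (true, (dec (f0 0)).2)).
have h1 : rep s0 f1.
  move=> j; rewrite /f1 /updt; case: eqP => [->|hj].
    rewrite encK rawsymK /raw /=; congr (_, _); apply/ffunP => r; rewrite !ffunE /s0 -val_eqE /=.
    by case: (nat_of_ord r == 0).
  rewrite rawsymK /raw /=; congr (_, _); apply/ffunP => r; rewrite !ffunE /s0 -val_eqE /=.
  by case: (nat_of_ord r == 0) => //; rewrite onth_over.
have [k [f2 [hk E2 h2]]] := sim_flow hn erefl h1 hB0.
have [|f3 [E3 h3]] := @out1_walk (s 0) 0 f2.
  by move=> i; rewrite h2 ffunE.
have m3 : marked f3.
  move=> j; rewrite h3 add0n leq0n h2 /=; case: ifP => [/andP[_ /negbTE ->]|]; last by rewrite h2.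
  by rewrite rawsymK.
(* From right to left: marking cell 0, the simulation, entering output mode, the walk that writes
   raw symbols, and the walk back. *)
set t := ((size (s 0)).+1 + ((size (s 0)).+1 + (1 + (k + 1))))%N.
exists t.
  have := hs 0; rewrite /t /=; lia.
have ET : iter t astep (abs (init flowTM x)) =
    (qHalt, 0, updt f3 0 (rawsym ((dec (f3 0)).2 ord0))).
  rewrite E0 /t iterD.
  rewrite [X in iter _ _ X](_ : _ = (qOut2, 0 + size (s 0), f3)).
    by rewrite add0n out2_walk.
  rewrite iterD -E3; congr (iter _ _ _).
  rewrite iterD [X in iter _ _ X](_ : _ = (qMain None, 0, f2)).
    by rewrite /= /fdelta /qMain /mkst /= updt_id.
  by rewrite iterD -E2; congr (iter _ _ _).
have := abs_run t (init flowTM x); rewrite ET /cfg_state /cfg_output.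
case: (run t _) => [[q l] r] [-> hl hr] /=; split=> //.
move: hr; case: l hl => // _ /= hr.
apply: read_bitsE => [j hj|]; rewrite hr /updt.
  case: eqP => [->|/eqP hj0]; rewrite h3 add0n leq0n h2 /=.
    by rewrite /= h2 ffunE /=; case: (s 0) hj.
  rewrite (ltnW hj) hj0 /= subn0.
  by elim: (s 0) j hj {hj0} => [|b v IH] [|j] //= hj; apply: IH.
case: eqP => [e0|/eqP hj0]; rewrite h3 add0n leq0n h2 /=.
  by rewrite h2 ffunE /=; case: (s 0) e0.
by rewrite leqnn hj0 /= subn0 onth_over.
Qed.

End FlowTM.

(** * Polynomial-time functions *)

(** Monotonicity is included so that bounds can be composed and their arguments enlarged. *)
Definition poly (B : nat -> nat) :=
  (forall m n, m <= n -> B m <= B n) /\ exists c k, forall n, B n <= pbound c k n.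

(* The factor 2 absorbs 0 ^ 0 = 1. *)
Lemma pbound_le c k c' k' n : 2 * c <= c' -> k <= k' -> pbound c k n <= pbound c' k' n.
Proof.
move=> h1 h2; rewrite /pbound; case: n => [|n].
  apply: leq_trans (leq_addl _ _); case: k h2 => [|k] h2; [rewrite expn0|rewrite exp0n //]; lia.
have : n.+1 ^ k <= n.+1 ^ k' by rewrite leq_pexp2l.
nia.
Qed.

Lemma poly_id : poly id.
Proof. by split=> //; exists 1, 1 => n; rewrite /pbound expn1; lia. Qed.

Lemma poly_const a : poly (fun _ => a).
Proof. by split=> //; exists a, 0 => n; rewrite /pbound; lia. Qed.

Lemma poly_add A B : poly A -> poly B -> poly (fun n => A n + B n).
Proof.
move=> [hA [c [k h]]] [hB [c' [k' h']]]; split=> [m n mn|]; first by rewrite leq_add ?hA ?hB.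
exists (2 * (c + c')), (k + k') => n.
have := @pbound_le c k (2 * c) (k + k') n (leqnn _) (leq_addr _ _).
have := @pbound_le c' k' (2 * c') (k + k') n (leqnn _) (leq_addl _ _).
have := h n; have := h' n; rewrite /pbound; nia.
Qed.

Lemma poly_mul A B : poly A -> poly B -> poly (fun n => A n * B n).
Proof.
move=> [hA [c [k h]]] [hB [c' [k' h']]]; split=> [m n mn|]; first by rewrite leq_mul ?hA ?hB.
exists (4 * c * c'), (k + k') => n.
apply: leq_trans (leq_mul (h n) (h' n)) _; rewrite /pbound expnD.
case: n => [|n].
  have : 0 ^ k <= 1 by case: (k) => // j; rewrite exp0n.
  have : 0 ^ k' <= 1 by case: (k') => // j; rewrite exp0n.
  move: (0 ^ k) (0 ^ k') => a b; case: a => [|[|a]] //; case: b => [|[|b]] //; nia.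
have : 0 < n.+1 ^ k by rewrite expn_gt0.
have : 0 < n.+1 ^ k' by rewrite expn_gt0.
move: (_ ^ k) (_ ^ k') => a b ha hb; nia.
Qed.

Lemma poly_exp A k : poly A -> poly (fun n => A n ^ k).
Proof.
move=> hA; elim: k => [|k IH]; first exact: poly_const.
by have := poly_mul hA IH; under [X in _ -> poly X]functional_extensionality do rewrite expnS.
Qed.

Lemma poly_pbound c k : poly (pbound c k).
Proof.
rewrite /pbound; apply: poly_add (poly_const c).
by apply: poly_mul (poly_const c) _; apply: poly_exp poly_id.
Qed.

Lemma poly_comp A B : poly A -> poly B -> poly (fun n => A (B n)).
Proof.
move=> [hA [c [k h]]] hB; split=> [m n mn|]; first by apply: hA; apply: hB.1.
have [_ [c' [k' h']]] : poly (fun n => pbound c k (B n)).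
  apply: poly_add (poly_const c).
  by apply: poly_mul (poly_const c) _; apply: poly_exp.
by exists c', k' => n; apply: leq_trans (h _) (h' n).
Qed.

Ltac pol := repeat first [assumption | exact: poly_const | exact: poly_id
  | apply: poly_add | apply: poly_mul].

Definition runs p s B s' := exists2 t, t <= B & exec p s t s'.

Lemma runs_seq p q s B1 s1 B2 s2 B :
  runs p s B1 s1 -> runs q s1 B2 s2 -> B1 + B2 <= B -> runs (Seq p q) s B s2.
Proof.
move=> [t1 h1 x1] [t2 h2 x2] h; exists (t1 + t2); last exact: XSeq x1 x2.
by apply: leq_trans h; apply: leq_add.
Qed.

Lemma runs_le p s B B' s' : runs p s B s' -> B <= B' -> runs p s B' s'.
Proof. by move=> [t h x] h'; exists t => //; apply: leq_trans h h'. Qed.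

Lemma upd_id s r : upd s r (s r) = s.
Proof. by apply: functional_extensionality => i; rewrite /upd; case: eqP => [->|]. Qed.

Lemma upd_upd s r v w : upd (upd s r v) r w = upd s r w.
Proof. by apply: functional_extensionality => i; rewrite /upd; case: eqP. Qed.

Lemma upd_same s r v : upd s r v r = v.
Proof. by rewrite /upd eqxx. Qed.

Definition Clear r := While r (Pop r).

Lemma runs_clear r s : runs (Clear r) s (2 * size (s r) + 1) (upd s r [::]).
Proof.
move E : (s r) => v; elim: v s E => [|b v IH] s E.
  by exists 1 => //; rewrite -E upd_id; apply: XWhile0.
have [|t ht x] := IH (upd s r v); first by rewrite /upd eqxx.
rewrite upd_upd in x; exists (1 + t).+1; first by rewrite /=; lia.
apply: XWhileS x; first by rewrite E.
by have := XPop r s; rewrite E.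
Qed.

Definition Move r d :=
  While r (Case r Skip (Seq (Pop r) (Push d false)) (Seq (Pop r) (Push d true))).

Lemma runs_move r d s : r != d ->
  runs (Move r d) s (4 * size (s r) + 1) (upd (upd s r [::]) d (catrev (s r) (s d))).
Proof.
move=> hrd; move E : (s r) => v; elim: v s E => [|b v IH] s E.
  exists 1 => //=; rewrite -E upd_id upd_id; exact: XWhile0.
have [|t ht x] := IH (upd (upd s r v) d (b :: s d)).
  by rewrite /upd (negbTE hrd) eqxx.
exists (3 + t).+1; first by rewrite /=; lia.
apply: XWhileS; first by rewrite E.
  apply: XCase; rewrite E.
  have -> : (if b then Seq (Pop r) (Push d true) else Seq (Pop r) (Push d false)) =
    Seq (Pop r) (Push d b) by case: (b).
  exact: (XSeq (XPop r s) (XPush d b _)).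
set s1 := upd _ d _; have <- : upd (upd s r v) d (b :: s d) = s1.
  by rewrite /s1 E /= /upd eq_sym (negbTE hrd).
rewrite [upd (upd s r [::]) d _](_ : _ = upd (upd (upd (upd s r v) d (b :: s d)) r [::]) d
   (catrev v (upd (upd s r v) d (b :: s d) d))) //.
apply: functional_extensionality => i; rewrite /upd eqxx.
by case: eqP => //= _; case: eqP.
Qed.

(** A move reverses a stack; a copy is a move to scratch followed by this double move, which
    restores the source and fills the target. *)
Definition Move2 r d e :=
  While r (Case r Skip (Seq (Pop r) (Seq (Push d false) (Push e false)))
                       (Seq (Pop r) (Seq (Push d true) (Push e true)))).

Lemma runs_move2 r d e s : r != d -> r != e -> d != e ->
  runs (Move2 r d e) s (5 * size (s r) + 1)
    (upd (upd (upd s r [::]) d (catrev (s r) (s d))) e (catrev (s r) (s e))).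
Proof.
move=> hrd hre hde; move E : (s r) => v; elim: v s E => [|b v IH] s E.
  exists 1 => //=; rewrite -E upd_id upd_id upd_id; exact: XWhile0.
pose s1 := upd (upd (upd s r v) d (b :: s d)) e (b :: s e).
have [|t ht x] := IH s1; first by rewrite /s1 /upd (negbTE hrd) (negbTE hre) eqxx.
exists (4 + t).+1; first by rewrite /=; lia.
apply: (@XWhileS _ _ _ _ s1); first by rewrite E.
  apply: XCase; rewrite E.
  have -> : (if b then Seq (Pop r) (Seq (Push d true) (Push e true))
     else Seq (Pop r) (Seq (Push d false) (Push e false))) =
    Seq (Pop r) (Seq (Push d b) (Push e b)) by case: (b).
  have := XSeq (XPop r s) (XSeq (XPush d b _) (XPush e b _)).
  rewrite E /= /s1; congr exec; rewrite /upd.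
  apply: functional_extensionality => i.
  by rewrite ![d == r]eq_sym (negbTE hrd) ![e == r]eq_sym (negbTE hre) ![e == d]eq_sym (negbTE hde).
move: x; congr exec; apply: functional_extensionality => i; rewrite /s1 /upd eqxx eqxx (negbTE hde).
by do 3 (case: eqP => //= _).
Qed.

Lemma runs_eq p s B s1 B' s2 : runs p s B s1 -> B <= B' -> s1 = s2 -> runs p s B' s2.
Proof. by move=> h1 h2 <-; apply: runs_le h1 h2. Qed.

Lemma catrevK (v : seq bool) : catrev (catrev v [::]) [::] = v.
Proof. exact: revK. Qed.

Lemma size_catrev T (v w : seq T) : size (catrev v w) = size v + size w.
Proof. by rewrite catrevE size_cat size_rev. Qed.

Ltac deq := repeat match goal with |- context [@eq_op ?T ?a ?b] =>
  first [have -> : (@eq_op T a b) = true by lia | have -> : (@eq_op T a b) = false by lia] end.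

Ltac sto hs := rewrite /upd; repeat match goal with |- context [@eq_op ?T ?a ?b] =>
  first [have -> : (@eq_op T a b) = true by lia | have -> : (@eq_op T a b) = false by lia
        | case: (@eqP T a b) => ?] end;
  subst; first [by [] | exact: catrevK | by apply: hs; lia | by symmetry; apply: hs; lia | idtac].

Notation env := (seq (seq bool)).

Definition tot (e : env) := sumn (map size e).

(** Registers from [base] on are scratch, empty before and after ([d] lies below), and only [d]
    changes. As [base] is arbitrary, nested programs get disjoint scratch. The separate size bound
    converts a running time in the sizes of intermediate results into one in the sizes of the
    arguments. *)
Definition ptime (F : env -> seq bool) :=
  (exists2 B, poly B & forall e, size (F e) <= B (tot e)) /\
  forall rs d base, all (fun r => r < base) rs -> d < base -> d \notin rs ->
  exists p, exists2 B, poly B &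
    forall s, s d = [::] -> (forall r, base <= r -> s r = [::]) ->
    runs p s (B (tot [seq s r | r <- rs])) (upd s d (F [seq s r | r <- rs])).

Lemma ptime_ext F G : ptime F -> F =1 G -> ptime G.
Proof. by move=> h /functional_extensionality <-. Qed.

Lemma size_nth_tot e i : size (nth [::] e i) <= tot e.
Proof.
elim: e i => [|v e IH] [|i] //=; rewrite /tot /=; first lia.
by have := IH i; rewrite /tot; lia.
Qed.

Lemma ptime_nil : ptime (fun _ => [::]).
Proof.
split; first by exists (fun _ => 0) => //; apply: poly_const.
move=> rs d base _ _ _; exists Skip, (fun _ => 0); first exact: poly_const.
by move=> s hd _; rewrite -hd upd_id; exists 0 => //; apply: XSkip.
Qed.

Lemma ptime_var i : ptime (fun e => nth [::] e i).
Proof.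
split; first by exists id; [exact: poly_id|move=> e; apply: size_nth_tot].
move=> rs d base hrs hd hdrs; case: (ltnP i (size rs)) => hi; last first.
  exists Skip, (fun _ => 0); first exact: poly_const.
  move=> s h0 _; rewrite nth_default ?size_map // -h0 upd_id.
  by exists 0 => //; apply: XSkip.
set r := nth 0 rs i; have hr : r < base by apply: (allP hrs); apply: mem_nth.
have hrd : r != d by apply: contra hdrs => /eqP <-; apply: mem_nth.
exists (Seq (Move r base) (Move2 base r d)), (fun n => 9 * n + 2).
  apply: poly_add (poly_const _); apply: poly_mul (poly_const _) poly_id.
move=> s h0 hs.
rewrite [nth _ _ _](_ : _ = s r); last by rewrite (nth_map 0).
have hsz : size (s r) <= tot [seq s r | r <- rs].
  by rewrite /r -(nth_map 0 [::] s) // size_nth_tot.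
have hrb : r != base by lia.
have hbr : base != r by lia.
have hbd : base != d by lia.
apply: runs_eq (runs_seq (runs_move s hrb) (runs_move2 _ hbr hbd hrd) (leqnn _)) _ _.
  by rewrite /upd eqxx (hs base) // size_catrev /=; lia.
rewrite /upd; deq; rewrite (hs base) // h0 catrevK.
apply: functional_extensionality => j; case: eqP => // _; case: (j =P r) => [->|_] //.
by case: eqP => // ->; rewrite hs.
Qed.

Lemma ptime_cons b F : ptime F -> ptime (fun e => b :: F e).
Proof.
move=> [[B hB h] hF]; split.
  exists (fun n => B n + 1); first exact: poly_add hB (poly_const _).
  by move=> e /=; have := h e; lia.
move=> rs d base hrs hd hdrs; have [p [B' hB' h']] := hF rs d base hrs hd hdrs.
exists (Seq p (Push d b)), (fun n => B' n + 1); first exact: poly_add hB' (poly_const _).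
move=> s h0 hs; apply: runs_seq (h' s h0 hs) _ (leqnn _).
exists 1 => //; have := XPush d b (upd s d (F [seq s r | r <- rs])).
by rewrite upd_same upd_upd.
Qed.

Lemma ptime_behead F : ptime F -> ptime (fun e => behead (F e)).
Proof.
move=> [[B hB h] hF]; split.
  by exists B => // e /=; have := h e; rewrite size_behead; lia.
move=> rs d base hrs hd hdrs; have [p [B' hB' h']] := hF rs d base hrs hd hdrs.
exists (Seq p (Pop d)), (fun n => B' n + 1); first exact: poly_add hB' (poly_const _).
move=> s h0 hs; apply: runs_seq (h' s h0 hs) _ (leqnn _).
exists 1 => //; have := XPop d (upd s d (F [seq s r | r <- rs])).
by rewrite upd_same upd_upd.
Qed.

Lemma ptime_shift F : ptime F -> ptime (fun e => F (behead e)).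
Proof.
have ht e : tot (behead e) <= tot e by case: e => // v e; rewrite /tot /=; lia.
move=> [[B hB h] hF]; split.
  by exists B => // e; apply: leq_trans (h _) (hB.1 _ _ (ht e)).
move=> rs d base hrs hd hdrs.
have [|//||p [B' hB' h']] := hF (behead rs) d base.
- by case: (rs) hrs => //= r l /andP[].
- by case: (rs) hdrs => //= r l; rewrite inE negb_or => /andP[].
exists p, B' => // s h0 hs; rewrite behead_map.
by apply: runs_le (h' s h0 hs) _; rewrite -behead_map; apply: hB'.1.
Qed.

Lemma map_upd s d v (rs : seq nat) : d \notin rs -> [seq upd s d v r | r <- rs] = [seq s r | r <- rs].
Proof.
move=> h; apply/eq_in_map => r hr; rewrite /upd; case: eqP => // e.
by move: h; rewrite -e hr.
Qed.

Lemma fresh_notin (rs : seq nat) base d : all (fun r => r < base) rs -> base <= d -> d \notin rs.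
Proof. by move=> /allP h hd; apply/negP => /h; lia. Qed.

Lemma all_fresh (rs : seq nat) base k : all (fun r => r < base) rs -> base <= k ->
  all (fun r => r < k) rs.
Proof. by move=> /allP h hk; apply/allP => r /h; lia. Qed.

Lemma ptime_case E F0 Ff Ft : ptime E -> ptime F0 -> ptime Ff -> ptime Ft ->
  ptime (fun e => match E e with [::] => F0 e | b :: _ => if b then Ft e else Ff e end).
Proof.
move=> [[BE hBE hE] cE] [[B0 hB0 h0] c0] [[Bf hBf hf] cf] [[Bt hBt ht] ct]; split.
  exists (fun n => B0 n + (Bf n + Bt n)); first by do 2 apply: poly_add => //.
  move=> e; have := h0 e; have := hf e; have := ht e; case: (E e) => [|[] _]; lia.
move=> rs d base hrs hd hdrs.
have [|||pE [B1 hB1 h1]] := cE rs base base.+1; rewrite ?(fresh_notin hrs) ?(all_fresh hrs) //.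
have [p0 [B2 hB2 h2]] := c0 rs d base hrs hd hdrs.
have [pf [B3 hB3 h3]] := cf rs d base hrs hd hdrs.
have [pt [B4 hB4 h4]] := ct rs d base hrs hd hdrs.
exists (Seq pE (Case base (Seq (Clear base) p0) (Seq (Clear base) pf) (Seq (Clear base) pt))),
  (fun n => B1 n + ((2 * BE n + 2) + (B2 n + (B3 n + B4 n)))).
  pol.
move=> s hd0 hs; set e := [seq s r | r <- rs].
have r1 := h1 s (hs _ (leqnn _)) (fun r hr => hs r (ltnW hr)); rewrite -/e in r1.
apply: runs_seq r1 _ (leqnn _).
have hcl : runs (Clear base) (upd s base (E e)) (2 * BE (tot e) + 1) s.
  apply: runs_eq (runs_clear _ _) _ _.
    by rewrite /upd eqxx; have := hE e; lia.
  by rewrite upd_upd -(hs base) // upd_id.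
have K p G B : runs p s B (upd s d (G e)) -> B <= B2 (tot e) + (B3 (tot e) + B4 (tot e)) ->
    (match E e with [::] => Seq (Clear base) p0 |
       b :: _ => if b then Seq (Clear base) pt else Seq (Clear base) pf end) = Seq (Clear base) p ->
    runs (Case base (Seq (Clear base) p0) (Seq (Clear base) pf) (Seq (Clear base) pt))
      (upd s base (E e)) (2 * BE (tot e) + 2 + (B2 (tot e) + (B3 (tot e) + B4 (tot e))))
      (upd s d (G e)).
  move=> r2 hB hp; have [t htt x] := runs_seq hcl r2 (leqnn _).
  exists t.+1; first by lia.
  by apply: XCase; rewrite {1}/upd eqxx hp.
case EE : (E e) K => [|[] u] K.
- by apply: K (h2 s hd0 hs) _ _ => //; apply: leq_addr.
- by apply: K (h4 s hd0 hs) _ _ => //; rewrite -/e; lia.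
- by apply: K (h3 s hd0 hs) _ _ => //; rewrite -/e; lia.
Qed.

Fixpoint brec (F0 Ff Ft : env -> seq bool) (e : env) (u : seq bool) : seq bool :=
  match u with
  | [::] => F0 e
  | b :: u' => (if b then Ft else Ff) (brec F0 Ff Ft e u' :: u' :: e)
  end.

(** As in Cobham's bounded recursion on notation, the assumed bound on all values of [brec] keeps
    each round polynomial; unrestricted recursion could double a value at every bit. *)
Lemma ptime_rec E F0 Ff Ft : ptime E -> ptime F0 -> ptime Ff -> ptime Ft ->
  (exists2 B, poly B & forall e u, size (brec F0 Ff Ft e u) <= B (tot e + size u)) ->
  ptime (fun e => brec F0 Ff Ft e (E e)).
Proof.
move=> [[BE hBE hE] cE] [_ c0] [_ cf] [_ ct] [BR hBR hR]; split.
  exists (fun n => BR (n + BE n)); first by apply: poly_comp hBR _; apply: poly_add poly_id hBE.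
  by move=> e; apply: leq_trans (hR _ _) _; apply: hBR.1; rewrite leq_add2l hE.
move=> rs d base hrs hd hdrs.
have [|||pE [B1 hB1 h1]] := cE rs base base.+1; rewrite ?(fresh_notin hrs) ?(all_fresh hrs) //.
pose b1 := base.+1; pose b2 := base.+2; pose b3 := base.+3; pose b4 := base.+4.
have hle k : all (fun r => r < base + k) rs by apply: all_fresh hrs _; lia.
have hni k : base + k \notin rs by apply: fresh_notin hrs _; lia.
have [||p0 [B2 hB2 h2]] := c0 rs b2 (base + 5) (hle _).
- by rewrite /b2; lia.
- by apply: fresh_notin hrs _; rewrite /b2; lia.
have hS : forall b, exists p, exists2 B, poly B &
    forall s, s b3 = [::] -> (forall r, base + 5 <= r -> s r = [::]) ->
    runs p s (B (tot [seq s r | r <- b2 :: base :: rs]))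
      (upd s b3 ((if b then Ft else Ff) [seq s r | r <- b2 :: base :: rs])).
  move=> b; case: b; [apply: ct|apply: cf].
  - by rewrite /= hle andbT; apply/andP; split; rewrite /b2; lia.
  - by rewrite /b3; lia.
  - by rewrite !inE !negb_or (fresh_notin hrs) // ?/b2 ?/b3 ?andbT; lia.
  - by rewrite /= hle andbT; apply/andP; split; rewrite /b2; lia.
  - by rewrite /b3; lia.
  - by rewrite !inE !negb_or (fresh_notin hrs) // ?/b2 ?/b3 ?andbT; lia.
have [pt [Bt hBt ht]] := hS true; have [pf [Bf hBf hf]] := hS false.
pose bd b := Seq (Pop b1) (Seq (if b then pt else pf)
   (Seq (Clear b2) (Seq (Move b3 b4) (Seq (Move b4 b2) (Push base b))))).
pose loop := While b1 (Case b1 Skip (bd false) (bd true)).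
pose SZ n := BR (n + BE n).
have hSZ : poly SZ by apply: poly_comp hBR _; apply: poly_add poly_id hBE.
pose ST n := n + (BE n + SZ n).
have hST : poly ST by rewrite /ST; pol.
pose CB n := (Bt (ST n) + Bf (ST n)) + (10 * SZ n + 8).
have hCB : poly CB.
  by rewrite /CB; pol; apply: poly_comp.
exists (Seq pE (Seq (Move base b1) (Seq p0 (Seq loop (Seq (Clear base) (Seq (Move b2 b4) (Move b4 d))))))).
exists (fun n => B1 n + ((4 * BE n + 1) + (B2 n + ((BE n * CB n + 1) + ((2 * BE n + 1) + (8 * SZ n + 2)))))).
  pol.
move=> s hd0 hs; set e := [seq s r | r <- rs].
pose R := brec F0 Ff Ft e.
(* Loop state: the suffix [u] already treated in [base], the rest [w] in [b1], the value at [u] in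
   [b2]. The recursion starts at the end of the word, hence the initial reversing move and the
   invariant [catrev w u = E e]. *)
pose stt w u acc := upd (upd (upd s base u) b1 w) b2 acc.
have stt_e w u acc : [seq stt w u acc r | r <- rs] = e.
  by rewrite /stt !map_upd // ?(fresh_notin hrs) // ?/b1 ?/b2; lia.
have rE : runs pE s (B1 (tot e)) (stt [::] (E e) [::]).
  apply: runs_eq (h1 s (hs _ (leqnn _)) (fun r hr => hs r (ltnW hr))) _ _ => //.
  by apply: functional_extensionality => i; rewrite /stt /b1 /b2; sto hs.
have rM : runs (Move base b1) (stt [::] (E e) [::]) (4 * BE (tot e) + 1)
    (stt (rev (E e)) [::] [::]).
  have hb : base != b1 by rewrite /b1; lia.
  apply: runs_eq (runs_move _ hb) _ _.
    by rewrite /stt /upd /b1 /b2; deq; have := hE e; lia.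
  by apply: functional_extensionality => i; rewrite /stt /b1 /b2; sto hs.
have r0 : runs p0 (stt (rev (E e)) [::] [::]) (B2 (tot e)) (stt (rev (E e)) [::] (R [::])).
  have := h2 (stt (rev (E e)) [::] [::]); rewrite stt_e => h; apply: runs_eq (h _ _) _ _ => //.
  - by rewrite /stt /upd eqxx.
  - by move=> r hr; rewrite /stt /upd /b1 /b2; deq; apply: hs; lia.
  - by rewrite /stt upd_upd.
have hRsz w u : catrev w u = E e -> size (R u) <= SZ (tot e).
  move=> hw; apply: leq_trans (hR _ _) _; apply: hBR.1; rewrite leq_add2l.
  by have := hE e; rewrite -hw size_catrev; lia.
have rB b w u : catrev (b :: w) u = E e ->
    runs (Case b1 Skip (bd false) (bd true)) (stt (b :: w) u (R u)) ((CB (tot e)).-1)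
      (stt w (b :: u) (R (b :: u))).
  move=> hw; pose X := R (b :: u).
  have szX : size X <= SZ (tot e) by apply: (hRsz w).
  have szR : size (R u) <= SZ (tot e) by apply: (hRsz (b :: w)).
  pose s1 := stt w u (R u); pose s2 := upd s1 b3 X; pose s3 := upd s2 b2 [::].
  pose s4 := upd (upd s3 b3 [::]) b4 (rev X).
  pose s5 := stt w u X.
  have x1 : runs (Pop b1) (stt (b :: w) u (R u)) 1 s1.
    exists 1 => //; have := XPop b1 (stt (b :: w) u (R u)); congr exec.
    by apply: functional_extensionality => i; rewrite /s1 /stt /b1 /b2; sto hs.
  have x2 : runs (if b then pt else pf) s1 (Bt (ST (tot e)) + Bf (ST (tot e))) s2.
    have e1 : [seq s1 r | r <- b2 :: base :: rs] = R u :: u :: e.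
      by rewrite /= stt_e /s1 /stt /upd /b1 /b2; deq.
    have s1b3 : s1 b3 = [::] by rewrite /s1 /stt /upd /b1 /b2 /b3; deq; apply: hs; lia.
    have s1hi r : base + 5 <= r -> s1 r = [::].
      by move=> hr; rewrite /s1 /stt /upd /b1 /b2; deq; apply: hs; lia.
    have hT : tot (R u :: u :: e) <= ST (tot e).
      rewrite /tot /= /ST -/(tot e); have := hE e; rewrite -hw size_catrev; lia.
    rewrite /s2 /X /R /= -/R -e1; case: (b).
      apply: runs_le (ht s1 s1b3 s1hi) _; rewrite e1.
      by apply: leq_trans (leq_addr _ _); apply: hBt.1.
    apply: runs_le (hf s1 s1b3 s1hi) _; rewrite e1.
    by apply: leq_trans (leq_addl _ _); apply: hBf.1.
  have x3 : runs (Clear b2) s2 (2 * SZ (tot e) + 1) s3.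
    apply: runs_le (runs_clear _ _) _.
    by rewrite /s2 /s1 /stt /upd /b1 /b2 /b3; deq; lia.
  have x4 : runs (Move b3 b4) s3 (4 * SZ (tot e) + 1) s4.
    have hb : b3 != b4 by rewrite /b3 /b4; lia.
    apply: runs_eq (runs_move _ hb) _ _.
      by rewrite /s3 /s2 /upd /b1 /b2 /b3; deq; lia.
    rewrite /s4 /s3 /s2 /s1 /stt /upd /b1 /b2 /b3 /b4; deq; rewrite (hs base.+4) //; lia.
  have x5 : runs (Move b4 b2) s4 (4 * SZ (tot e) + 1) s5.
    have hb : b4 != b2 by rewrite /b2 /b4; lia.
    apply: runs_eq (runs_move _ hb) _ _.
      by rewrite /s4 /upd eqxx size_rev; lia.
    by apply: functional_extensionality => i;
      rewrite /s5 /s4 /s3 /s2 /s1 /stt /b1 /b2 /b3 /b4; sto hs.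
  have x6 : runs (Push base b) s5 1 (stt w (b :: u) X).
    exists 1 => //; have := XPush base b s5; congr exec.
    by apply: functional_extensionality => i; rewrite /s5 /stt /b1 /b2; sto hs.
  have [t htt x] : runs (bd b) (stt (b :: w) u (R u)) (CB (tot e)).-2 (stt w (b :: u) X).
    apply: runs_eq (runs_seq x1 (runs_seq x2 (runs_seq x3 (runs_seq x4 (runs_seq x5 x6
      (leqnn _)) (leqnn _)) (leqnn _)) (leqnn _)) (leqnn _)) _ _ => //.
    by rewrite /CB; lia.
  exists t.+1; first by rewrite /CB in htt *; lia.
  have sb1 : stt (b :: w) u (R u) b1 = b :: w by rewrite /stt /upd /b1 /b2; deq.
  apply: XCase; rewrite sb1.
  by have -> : (if b then bd true else bd false) = bd b by case: (b).
have rL w u : catrev w u = E e ->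
    runs loop (stt w u (R u)) (size w * CB (tot e) + 1) (stt [::] (E e) (R (E e))).
  elim: w u => [|b w IH] u hw.
    exists 1 => //; rewrite -hw; apply: XWhile0.
    by rewrite /stt /upd /b1 /b2; deq.
  have [t1 ht1 x1] := rB b w u hw; have [t2 ht2 x2] := IH (b :: u) hw.
  exists (t1 + t2).+1; first by rewrite /= mulSn /CB in ht1 ht2 *; lia.
  by apply: XWhileS x1 x2; rewrite /stt /upd /b1 /b2; deq.
have rC : runs (Clear base) (stt [::] (E e) (R (E e))) (2 * BE (tot e) + 1) (stt [::] [::] (R (E e))).
  apply: runs_eq (runs_clear _ _) _ _.
    by rewrite /stt /upd /b1 /b2; deq; have := hE e; lia.
  by apply: functional_extensionality => i; rewrite /stt /b1 /b2; sto hs.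
have szF : size (R (E e)) <= SZ (tot e) by apply: (hRsz [::]).
pose sF := upd (stt [::] [::] [::]) b4 (rev (R (E e))).
have rF : runs (Move b2 b4) (stt [::] [::] (R (E e))) (4 * SZ (tot e) + 1) sF.
  have hb : b2 != b4 by rewrite /b2 /b4; lia.
  apply: runs_eq (runs_move _ hb) _ _.
    by rewrite /stt /upd /b1 /b2; deq; lia.
  apply: functional_extensionality => i; rewrite /sF /stt /b1 /b2 /b4; sto hs.
  by rewrite (hs base.+4) //; lia.
have rG : runs (Move b4 d) sF (4 * SZ (tot e) + 1) (upd s d (R (E e))).
  have hb : b4 != d by rewrite /b4; lia.
  apply: runs_eq (runs_move _ hb) _ _.
    by rewrite /sF /stt /upd eqxx size_rev; lia.
  apply: functional_extensionality => i; rewrite /sF /stt /b1 /b2 /b4; sto hs.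
  by rewrite hd0 catrevK.
have hRev : catrev (rev (E e)) [::] = E e by exact: catrevK.
apply: runs_eq (runs_seq rE (runs_seq rM (runs_seq r0 (runs_seq (rL _ _ hRev) (runs_seq rC
   (runs_seq rF rG (leqnn _)) (leqnn _)) (leqnn _)) (leqnn _)) (leqnn _)) (leqnn _)) _ _ => //.
rewrite size_rev; have : size (E e) * CB (tot e) <= BE (tot e) * CB (tot e) by rewrite leq_mul2r hE orbT.
lia.
Qed.

Lemma ptime_computable F : ptime F -> poly_computable (fun x => F [:: x]).
Proof.
move=> [[BF hBF hF] c]; have [//|//|//|p [B hB h]] := c [:: 0] 1 2.
(* Two moves, since a single one would reverse the result. *)
pose P := Seq p (Seq (Clear 0) (Seq (Move 1 2) (Move 2 0))).
pose T n := B n + ((2 * n + 1) + (8 * BF n + 2)).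
have hT : poly T by rewrite /T; pol.
pose TT n := T n * (2 * (n + T n) + 4) + 2 * (n + T n) + 4.
have [_ [c' [k hck]]] : poly TT by rewrite /TT; pol.
exists (flowTM (compile P)), c', k => x.
pose s0 r := if r == 0 then x else [::] : seq bool.
have [||t1 ht1 x1] := h s0 => //; first by case.
have [t2 ht2 x2] := runs_clear 0 (upd s0 1 (F [:: x])).
have [//|t3 ht3 x3] := @runs_move 1 2 (upd (upd s0 1 (F [:: x])) 0 [::]).
set s3 := upd _ 2 _ in x3.
have [//|t4 ht4 x4] := @runs_move 2 0 s3.
have := compile_exec (XSeq x1 (XSeq x2 (XSeq x3 x4))).
rewrite -/P => /sim_total [t ht [hh1 hh2]].
have hn : t1 + (t2 + (t3 + t4)) <= T (size x).
  have hF' := hF [:: x]; move: ht1 ht2 ht3 ht4 hF'.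
  by rewrite /s3 /T /tot /upd /s0 /= size_catrev /= !addn0; lia.
have htT : t <= pbound c' k (size x).
  apply: leq_trans (hck _); apply: leq_trans ht _; rewrite /TT.
  rewrite leq_add2r; apply: leq_add; [apply: leq_mul => //|].
    by rewrite leq_add2r leq_mul2l leq_add2l.
  by rewrite leq_mul2l leq_add2l.
cbv zeta; rewrite (run_halted hh1 htT); split; first exact: hh1.
rewrite hh2 /s3 /upd /s0 /=; exact: catrevK.
Qed.

(* Natural numbers are represented in unary and truth values by 0 and 1. *)
Definition PN (h : env -> nat) := ptime (fun e => nseq (h e) true).
Definition PB (P : env -> bool) := PN (fun e => P e : nat).

Lemma ptime_size F : ptime F -> exists2 B, poly B & forall e, size (F e) <= B (tot e).
Proof. by case. Qed.

Lemma PN_le h : PN h -> exists2 B, poly B & forall e, h e <= B (tot e).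
Proof. by move=> /ptime_size[B hB h']; exists B => // e; have := h' e; rewrite size_nseq. Qed.

(** Renaming, duplicating and dropping variables needs no code, because the programs of [ptime]
    accept any list of argument registers. *)
Lemma ptime_sel idx k F : ptime F ->
  ptime (fun e => F ([seq nth [::] e i | i <- idx] ++ drop k e)).
Proof.
move=> [[B hB h] c].
have ht (e : env) : tot ([seq nth [::] e i | i <- idx] ++ drop k e) <= (size idx).+1 * tot e.
  rewrite /tot map_cat sumn_cat mulSn addnC; apply: leq_add.
    by rewrite -{2}(cat_take_drop k e) map_cat sumn_cat leq_addl.
  by elim: idx => //= i l IH; rewrite mulSn; apply: leq_add => //; apply: size_nth_tot.
have hM : poly (fun n => (size idx).+1 * n) by pol.
split.
  exists (fun n => B ((size idx).+1 * n)); first exact: poly_comp hB hM.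
  by move=> e; apply: leq_trans (h _) _; apply: hB.1; apply: ht.
move=> rs d base hrs hd hdrs.
(* A variable out of range is read from register [base], which is empty; the scratch of the inner
   program therefore starts at [base.+1]. *)
pose sel i := nth base rs i.
have hsel i : sel i < base.+1.
  rewrite /sel; case: (ltnP i (size rs)) => hi; last by rewrite nth_default.
  by have /= := allP hrs _ (mem_nth base hi); lia.
have hseld i : sel i != d.
  rewrite /sel; case: (ltnP i (size rs)) => hi; last by rewrite nth_default //; lia.
  by apply: contra hdrs => /eqP <-; apply: mem_nth.
have [|||p [B' hB' h']] := c ([seq sel i | i <- idx] ++ drop k rs) d base.+1.
- rewrite all_cat; apply/andP; split; apply/allP => r; first by move=> /mapP[i _ ->].
  by move=> /mem_drop /(allP hrs) /=; lia.
- lia.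
- rewrite mem_cat negb_or; apply/andP; split; last by apply: contra hdrs => /mem_drop.
  by apply/negP => /mapP[i _ e]; have := hseld i; rewrite e eqxx.
exists p, (fun n => B' ((size idx).+1 * n)); first exact: poly_comp hB' hM.
move=> s h0 hs.
have E : [seq s r | r <- [seq sel i | i <- idx] ++ drop k rs] =
   [seq nth [::] [seq s r | r <- rs] i | i <- idx] ++ drop k [seq s r | r <- rs].
  rewrite map_cat map_drop -map_comp; congr cat; apply: eq_map => i /=.
  rewrite /sel; case: (ltnP i (size rs)) => hi; first by rewrite (nth_map base).
  by rewrite !nth_default ?size_map // hs.
rewrite -E; apply: runs_le (h' s h0 _) _; first by move=> r hr; apply: hs; lia.
by apply: hB'.1; rewrite E.
Qed.

Lemma ptime_const v : ptime (fun _ => v).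
Proof. by elim: v => [|b v IH]; [apply: ptime_nil|apply: ptime_cons]. Qed.

Lemma ptime_cat E F : ptime E -> ptime F -> ptime (fun e => E e ++ F e).
Proof.
move=> hE hF.
pose G b (e : env) := b :: nth [::] e 0.
have hG b : ptime (G b) by apply: ptime_cons (ptime_var 0).
have EG e u : brec F (G false) (G true) e u = u ++ F e.
  by elim: u => //= -[] u IH; rewrite /G /= IH.
have [B hB hB'] := ptime_size hF.
apply: ptime_ext (ptime_rec hE hF (hG false) (hG true) _) _ => [|e]; last exact: EG.
exists (fun n => n + B n); first by pol.
move=> e u; rewrite EG size_cat; have := hB' e; have := hB.1 (tot e) (tot e + size u).
lia.
Qed.

Lemma ptime_if P F G : PB P -> ptime F -> ptime G -> ptime (fun e => if P e then F e else G e).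
Proof.
by move=> hP hF hG; apply: ptime_ext (ptime_case hP hG hG hF) _ => e; case: (P e).
Qed.

Lemma PN_size E : ptime E -> PN (fun e => size (E e)).
Proof.
move=> hE; pose G (e : env) := true :: nth [::] e 0.
have hG : ptime G by apply: ptime_cons (ptime_var 0).
have EG e u : brec (fun _ => [::]) G G e u = nseq (size u) true.
  by elim: u => //= -[] u IH; rewrite /G /= IH.
apply: ptime_ext (ptime_rec hE ptime_nil hG hG _) _ => [|e]; last exact: EG.
by exists id; [exact: poly_id|move=> e u; rewrite EG size_nseq; lia].
Qed.

Lemma PN_const a : PN (fun _ => a).
Proof. exact: ptime_const. Qed.

Lemma PN_add h1 h2 : PN h1 -> PN h2 -> PN (fun e => h1 e + h2 e).
Proof.
move=> H1 H2; apply: ptime_ext (ptime_cat H1 H2) _ => e.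
by elim: (h1 e) => //= n ->.
Qed.

Lemma PN_if P h1 h2 : PB P -> PN h1 -> PN h2 -> PN (fun e => if P e then h1 e else h2 e).
Proof. by move=> HP H1 H2; apply: ptime_ext (ptime_if HP H1 H2) _ => e; case: (P e). Qed.

Lemma PB_const b : PB (fun _ => b).
Proof. exact: PN_const. Qed.

Lemma PB_if P Q R : PB P -> PB Q -> PB R -> PB (fun e => if P e then Q e else R e).
Proof. by move=> HP H1 H2; apply: ptime_ext (ptime_if HP H1 H2) _ => e; case: (P e). Qed.

Lemma PB_and P Q : PB P -> PB Q -> PB (fun e => P e && Q e).
Proof. by move=> HP HQ; apply: PB_if (PB_const false). Qed.

Lemma PB_or P Q : PB P -> PB Q -> PB (fun e => P e || Q e).
Proof. by move=> HP HQ; apply: PB_if (PB_const true) HQ. Qed.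

Lemma PB_neg P : PB P -> PB (fun e => ~~ P e).
Proof. by move=> HP; apply: PB_if HP (PB_const false) (PB_const true). Qed.

Lemma PB_ext P Q : PB P -> P =1 Q -> PB Q.
Proof. by move=> h /functional_extensionality <-. Qed.

Lemma PN_ext h k : PN h -> h =1 k -> PN k.
Proof. by move=> H /functional_extensionality <-. Qed.

Definition nrec (F0 : env -> seq bool) (S : seq bool -> nat -> env -> seq bool) (e : env) n :=
  iteri n (fun i acc => S acc i e) (F0 e).

Lemma ptime_nrec h F0 S : PN h -> ptime F0 ->
  ptime (fun e => S (nth [::] e 0) (size (nth [::] e 1)) (behead (behead e))) ->
  (exists2 B, poly B & forall e n, size (nrec F0 S e n) <= B (tot e + n)) ->
  ptime (fun e => nrec F0 S e (h e)).
Proof.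
move=> hh h0 hS [B hB hB'].
set G := fun e => _ in hS.
have EG e u : brec F0 G G e u = nrec F0 S e (size u).
  by elim: u => //= b u IH; rewrite if_same IH.
apply: ptime_ext (ptime_rec hh h0 hS hS _) _ => [|e].
  by exists B => // e u; rewrite EG.
by rewrite EG size_nseq.
Qed.

Lemma ptime_drop h E : PN h -> ptime E -> ptime (fun e => drop (h e) (E e)).
Proof.
move=> hh hE; pose S (acc : seq bool) (n : nat) (e : env) := behead acc.
have ES e n : nrec E S e n = drop n (E e).
  by rewrite /nrec; elim: n => [|n IH]; rewrite ?drop0 //= IH /S -drop1 drop_drop add1n.
have [B hB hB'] := ptime_size hE.
apply: ptime_ext (@ptime_nrec h E S hh hE _ _) _ => [|| e]; last exact: ES.
  exact: ptime_behead (ptime_var 0).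
exists B => // e n; rewrite ES size_drop.
have := hB' e; have := hB.1 (tot e) (tot e + n); lia.
Qed.

Lemma PN_sub h k : PN h -> PN k -> PN (fun e => h e - k e).
Proof.
by move=> H K; apply: ptime_ext (ptime_drop K H) _ => e; rewrite drop_nseq.
Qed.

Lemma PB_leq h k : PN h -> PN k -> PB (fun e => h e <= k e).
Proof.
move=> H K; apply: ptime_ext (ptime_case (PN_sub H K) (PB_const true) (PB_const false) (PB_const false)) _.
by move=> e; rewrite -subn_eq0; case: (h e - k e).
Qed.

Lemma PB_ltn h k : PN h -> PN k -> PB (fun e => h e < k e).
Proof. by move=> H K; apply: PB_leq K; apply: ptime_cons. Qed.

Lemma PB_eqn h k : PN h -> PN k -> PB (fun e => h e == k e).
Proof.
move=> H K; apply: PB_ext (PB_and (PB_leq H K) (PB_leq K H)) _ => e.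
by rewrite eqn_leq.
Qed.

Lemma PB_nth h E : PN h -> ptime E -> PB (fun e => nth false (E e) (h e)).
Proof.
move=> H HE.
apply: ptime_ext (ptime_case (ptime_drop H HE) (PB_const false) (PB_const false) (PB_const true)) _.
move=> e; case: (ltnP (h e) (size (E e))) => hs.
  by rewrite (drop_nth false) //; case: (nth _ _ _).
by rewrite drop_oversize // nth_default.
Qed.

Lemma ptime_flatten h G : PN h -> ptime (fun e => G (size (nth [::] e 0)) (behead e)) ->
  ptime (fun e => flatten (mkseq (fun i => G i e) (h e))).
Proof.
move=> H HG; pose S (acc : seq bool) n e := acc ++ G n e.
have ES e n : nrec (fun _ => [::]) S e n = flatten (mkseq (fun i => G i e) n).
  by elim: n => // n IH; rewrite mkseqS flatten_rcons -IH.
have [B hB hB'] := ptime_size HG.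
apply: ptime_ext (@ptime_nrec h _ S H ptime_nil _ _) _ => [|| e]; last exact: ES.
  by apply: ptime_cat (ptime_var 0) _; apply: ptime_ext (ptime_shift HG) _ => e; rewrite nth_behead.
exists (fun n => n * B n); first by pol.
move=> e n; rewrite ES.
have : size (flatten (mkseq (fun i => G i e) n)) <= n * B (tot e + n).
  have : forall i, i < n -> size (G i e) <= B (tot e + n).
    move=> i hi; have := hB' (nseq i true :: e); rewrite /= size_nseq => h'.
    by apply: leq_trans h' _; apply: hB.1; rewrite /tot /= size_nseq; lia.
  move: (B _) => b; elim: n => // n IH h'; rewrite mkseqS flatten_rcons size_cat mulSn addnC.
  by apply: leq_add; [apply: h'|apply: IH => i hi; apply: h'; lia].
by move/leq_trans; apply; rewrite leq_mul2r leq_addl orbT.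
Qed.

Lemma ptime_mkseq h Q : PN h -> PB (fun e => Q (size (nth [::] e 0)) (behead e)) ->
  ptime (fun e => mkseq (fun i => Q i e) (h e)).
Proof.
move=> H HQ.
have HG := ptime_if HQ (ptime_const [:: true]) (ptime_const [:: false]).
apply: ptime_ext (@ptime_flatten h (fun i e => if Q i e then [:: true] else [:: false]) H HG) _.
move=> e; elim: (h e) => // n IH; rewrite !mkseqS flatten_rcons IH -cats1; by case: (Q n e).
Qed.

Lemma PN_sum h k : PN h -> PN (fun e => k (size (nth [::] e 0)) (behead e)) ->
  PN (fun e => \sum_(i < h e) k i e).
Proof.
move=> H K; apply: ptime_ext (ptime_flatten H K) _ => e.
elim: (h e) => [|n IH]; first by rewrite big_ord0.
rewrite mkseqS flatten_rcons IH big_ord_recr /=.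
by elim: (\sum_(i < n) _) => //= m ->.
Qed.

Lemma PN_mul h k : PN h -> PN k -> PN (fun e => h e * k e).
Proof.
move=> H K; apply: PN_ext (@PN_sum h (fun _ e => k e) H (ptime_shift K)) _ => e.
by rewrite sum_nat_const card_ord.
Qed.

Lemma PB_ex h Q : PN h -> PB (fun e => Q (size (nth [::] e 0)) (behead e)) ->
  PB (fun e => has (fun i => Q i e) (iota 0 (h e))).
Proof.
move=> H HQ; have K := @PN_sum h (fun i e => Q i e) H HQ.
apply: PB_ext (PB_ltn (PN_const 0) K) _ => e.
elim: (h e) => [|n IH]; first by rewrite big_ord0.
have Ei : iota 0 n.+1 = iota 0 n ++ [:: n] by rewrite -addn1 iotaD.
rewrite big_ord_recr addn_gt0 IH Ei has_cat has_seq1.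
by case: (Q n e).
Qed.

(** The position of the first witness is the number of [i] such that no witness occurs up to and
    including [i]. *)
Lemma PN_find h Q : PN h -> PB (fun e => Q (size (nth [::] e 0)) (behead e)) ->
  PN (fun e => find (fun i => Q i e) (iota 0 (h e))).
Proof.
move=> H HQ.
have K : PB (fun e => ~~ has (fun i => Q i (behead e)) (iota 0 (size (nth [::] e 0)).+1)).
  apply: PB_neg; apply: (@PB_ex (fun e => (size (nth [::] e 0)).+1) (fun i e => Q i (behead e))).
    exact: ptime_cons (PN_size (ptime_var 0)).
  apply: ptime_ext (ptime_sel [:: 0] 2 HQ) _ => e.
  by case: e => [|? [|? ?]] //=; rewrite drop0.
apply: PN_ext (@PN_sum h (fun i e => ~~ has (fun i => Q i e) (iota 0 i.+1)) H K) _ => e.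
elim: (h e) => [|n IH]; first by rewrite big_ord0.
have Ei : iota 0 n.+1 = iota 0 n ++ [:: n] by rewrite -addn1 iotaD.
rewrite big_ord_recr [LHS](_ : _ = find (fun i => Q i e) (iota 0 n) +
    ~~ has (fun i => Q i e) (iota 0 n.+1)); last by rewrite -IH.
rewrite Ei find_cat has_cat has_seq1 size_iota.
case: ifP => [_|/negbT h']; first by rewrite addn0.
by rewrite (hasNfind h') size_iota /=; case: (Q n e).
Qed.

Lemma PN_iter h v0 S : PN h -> PN v0 -> PN (fun e => S (size (nth [::] e 0)) (behead e)) ->
  (exists2 B, poly B & forall e n, iter n (fun v => S v e) (v0 e) <= B (tot e + n)) ->
  PN (fun e => iter (h e) (fun v => S v e) (v0 e)).
Proof.
move=> H V HS [B hB hB'].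
pose T (acc : seq bool) (n : nat) e := nseq (S (size acc) e) true.
have ET e n : nrec (fun e => nseq (v0 e) true) T e n = nseq (iter n (fun v => S v e) (v0 e)) true.
  by rewrite /nrec; elim: n => //= n ->; rewrite /T size_nseq.
apply: ptime_ext (@ptime_nrec h _ T H V _ _) _ => [|| e]; last exact: ET.
  apply: ptime_ext (ptime_sel [:: 0] 2 HS) _ => e.
  by case: e => [|? [|? ?]] //=; rewrite drop0.
by exists B => // e n; rewrite ET size_nseq.
Qed.

(** The quotient counts the positive multiples of the divisor that do not exceed the dividend. *)
Lemma PN_div h k : PN h -> PN k -> PN (fun e => h e %/ k e).
Proof.
move=> H K.
apply: PN_ext (@PN_sum h (fun i e => (0 < k e) && (i.+1 * k e <= h e)) H _) _ => [|e].
  apply: PB_and; first by apply: PB_ltn (PN_const 0) (ptime_shift K).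
  apply: PB_leq (ptime_shift H); apply: PN_mul (ptime_shift K).
  exact: ptime_cons (PN_size (ptime_var 0)).
case: (posnP (k e)) => [->|hk]; first by rewrite divn0 big1.
have E n m : \sum_(i < n) (i.+1 * k e <= m) = minn n (m %/ k e).
  elim: n => [|n IH]; first by rewrite big_ord0 min0n.
  rewrite big_ord_recr /= IH -leq_divRL //; case: leqP => h'; lia.
by apply: etrans (E _ _) _; apply/minn_idPr/leq_div.
Qed.

Lemma PN_mod h k : PN h -> PN k -> PN (fun e => h e %% k e).
Proof.
move=> H K; apply: PN_ext (PN_sub H (PN_mul (PN_div H K) K)) _ => e.
by rewrite {1}(divn_eq (h e) (k e)) addKn.
Qed.

Lemma PB_has_const (T : Type) (l : seq T) Q : (forall a, PB (Q a)) ->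
  PB (fun e => has (fun a => Q a e) l).
Proof. by move=> h; elim: l => [|a l IH]; [apply: PB_const|apply: PB_or]. Qed.

Lemma PB_all_const (T : Type) (l : seq T) Q : (forall a, PB (Q a)) ->
  PB (fun e => all (fun a => Q a e) l).
Proof. by move=> h; elim: l => [|a l IH]; [apply: PB_const|apply: PB_and]. Qed.

Lemma ptime_varb k i : ptime (fun e => nth [::] (iter k behead e) i).
Proof.
apply: ptime_ext (ptime_var (k + i)) _ => e; elim: k e => // k IH e.
by rewrite addSn -nth_behead IH -iterSr.
Qed.

Lemma PN_varb k i : PN (fun e => size (nth [::] (iter k behead e) i)).
Proof. exact: PN_size (ptime_varb k i). Qed.

Lemma PN_S h : PN h -> PN (fun e => (h e).+1).
Proof. exact: ptime_cons. Qed.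

(** * Slanted space-time diagrams *)

Section CA.
Variable M : TM.
Notation sym := 'I_(tm_k M).+3.

(* Contents of a space-time cell: None is the wall to the left of the tape. *)
Definition Gam := option (sym * option (tm_Q M)).

Definition cont (c : aconf M) p : sym * option (tm_Q M) :=
  (c.2 p, if p == c.1.2 then Some c.1.1 else None).

(** The state is stored in the scanned cell, so a head is detected by looking at a cell and its two
    neighbours: [hm], [hl] and [hr] are heads that stay, arrive from the left and arrive from the
    right. A left move next to the wall stays. *)
Definition Phi (l m r : Gam) : Gam :=
  match m with
  | None => None
  | Some (s, oq) =>
    let act q s := if @tm_halt M q then (q, s, DStay) else @tm_delta M q s in
    let s' := if oq is Some q then (act q s).1.2 else s in
    let hm := if oq is Some q then
                match (act q s).2 with
                | DStay => Some (act q s).1.1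
                | DLeft => if l is None then Some (act q s).1.1 else None
                | DRight => None
                end else None in
    let hl := if l is Some (sl, Some q) then
                if (act q sl).2 is DRight then Some (act q sl).1.1 else None else None in
    let hr := if r is Some (sr, Some q) then
                if (act q sr).2 is DLeft then Some (act q sr).1.1 else None else None in
    Some (s', if hm is Some q then Some q else if hl is Some q then Some q else hr)
  end.

Lemma Phi_cont c p :
  Phi (if p is p'.+1 then Some (cont c p') else None) (Some (cont c p)) (Some (cont c p.+1)) =
  Some (cont (astep c) p).
Proof.
case: c => [[q h] f]; rewrite /cont /=; case hq : (tm_halt q).
  case: p => [|p]; rewrite /=; repeat (case: eqP => ? //=; rewrite ?hq //=; try lia).
case E : (tm_delta q (f h)) => [[q' b] d]; rewrite /= /updt.
case: d E => E; case: p => [|p]; rewrite /=;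
  repeat (case: eqP => ? //=; try (exfalso; lia)); subst; rewrite ?hq ?E //=.
Qed.

(* Column j shows tape position j - 1 - t at time t: with this slant, a cell depends only
   on its left and upper neighbours and on what these remember. *)
Definition ct (c0 : aconf M) t j : Gam :=
  if j <= t then None else Some (cont (iter t (@astep M) c0) (j.-1 - t)).

(** The new cell shows position [p = j - 2 - t]; its parents [p - 1], [p], [p + 1] stand in columns
    [j - 2], [j - 1], [j] of the row above, so nothing is needed from the right. *)
Lemma ct_step c0 t j : 0 < j ->
  ct c0 t.+1 j = Phi (ct c0 t (j - 2)) (ct c0 t j.-1) (ct c0 t j).
Proof.
move=> hj; rewrite /ct; case: (leqP j t.+1) => h1.
  by have -> : j.-1 <= t by lia.
have -> : (j.-1 <= t) = false by lia.
have -> : (j <= t) = false by lia.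
rewrite iterS -Phi_cont.
have -> : j.-1 - t = (j.-1.-1 - t).+1 by lia.
have -> : j.-1 - t.+1 = j.-1.-1 - t by lia.
case: (leqP (j - 2) t) => h2; first by have -> : j.-1.-1 - t = 0 by lia.
have -> : j.-1.-1 - t = ((j - 2).-1 - t).+1 by lia.
by [].
Qed.

Variable hal : Gam -> bool.
Hypothesis halN : hal None = false.

(** Own content, content one up, content one up and one left, and whether [hal] has held anywhere in
    the rectangle that ends here. The left neighbour thus supplies two of the three parents of a
    cell and the upper neighbour the third. *)
Definition cw := (Gam * Gam * Gam * bool)%type.
Definition own (w : cw) := w.1.1.1.
Definition upper (w : cw) := w.1.1.2.
Definition upleft (w : cw) := w.1.2.
Definition fl (w : cw) := w.2.

Definition wall : cw := (None, None, None, false).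
Definition cw_top (g : Gam) (l : cw) : cw := (g, None, None, fl l || hal g).
Definition cw_step (l u : cw) : cw :=
  let g := Phi (upleft l) (upper l) (own u) in
  (g, own u, upper l, [|| fl l, fl u | hal g]).

Definition topc (first : bool) (s : sym) : Gam :=
  Some (s, if first then Some (@tm_start M) else None).

(* Words are listed with the rightmost column first. *)
Fixpoint cw0 (u : seq sym) : cw :=
  match u with
  | [::] => wall
  | a :: u' => cw_top (topc (nilp u') a) (cw0 u')
  end.

Fixpoint cwv t (u : seq sym) : cw :=
  match t with
  | 0 => cw0 u
  | t'.+1 => (fix row u := match u with
              | [::] => wall
              | a :: u' => cw_step (row u') (cwv t' u)
              end) u
  end.

Lemma cwvS t a u : cwv t.+1 (a :: u) = cw_step (cwv t.+1 u) (cwv t (a :: u)).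
Proof. by []. Qed.

Definition ainit (u : seq sym) : aconf M := (@tm_start M, 0, nth (blank M) (rev u)).

(** Columns to the right have no influence: a cell computed from the first [size u] columns has the
    content that it has in the run on any longer word [U]. *)
Lemma cwv_spec U w u t : U = w ++ u ->
  own (cwv t u) = ct (ainit U) t (size u) /\
  (0 < t -> upper (cwv t u) = ct (ainit U) t.-1 (size u) /\
            upleft (cwv t u) = ct (ainit U) t.-1 (size u).-1).
Proof.
elim: t w u => [|t IHt] w u.
  case: u => [|a u] -> //=; split=> //; rewrite /ct /= subn0 /cont /=.
  rewrite rev_cat rev_cons nth_cat size_rcons size_rev ltnSn nth_rcons size_rev ltnn eqxx.
  by rewrite /own /= /topc; case: u.
elim: u w => [|a u IHu] w hU; first by rewrite /ct leq0n.
have [|h1 h2] := IHu (rcons w a); first by rewrite cat_rcons.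
have [h3 h4] := h2 isT; have [k1 _] := IHt w (a :: u) hU.
rewrite cwvS; split; last by rewrite /upper /upleft /= h3 k1.
rewrite /own /= -/(own _) k1 h3 h4 [RHS]ct_step //= /ct.
by congr Phi; rewrite subn2.
Qed.

Lemma cwv_fl U w u t : U = w ++ u ->
  (fl (cwv t u) <-> exists t' j', [/\ t' <= t, j' <= size u & hal (ct (ainit U) t' j')]).
Proof.
elim: t w u => [|t IHt] w u.
  elim: u w => [|a u IH] w hU.
    split=> // -[t' [j' [_]]]; rewrite leqn0 => /eqP ->.
    by rewrite /ct leq0n halN.
  have ho : hal (topc (nilp u) a) = hal (ct (ainit U) 0 (size u).+1).
    by have [<- _] := cwv_spec 0 hU.
  have {}IH := IH (rcons w a) (etrans hU (esym (cat_rcons _ _ _))).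
  rewrite [cwv _ _]/= /fl /= -/(fl _) ho; split.
    case/orP=> [/IH [t' [j' [h1 h2 h3]]]|h]; first by exists t', j'; split=> //; apply: leqW.
    by exists 0, (size u).+1.
  move=> [t' [j' [h1]]]; rewrite /= leq_eqVlt => /orP[/eqP ->|h2] h3.
    by move: h1 h3; rewrite leqn0 => /eqP -> ->; rewrite orbT.
  by apply/orP; left; apply/IH; exists t', j'.
elim: u w => [|a u IHu] w hU.
  split=> // -[t' [j' [_]]]; rewrite leqn0 => /eqP ->.
  by rewrite /ct leq0n halN.
have ho : hal (own (cwv t.+1 (a :: u))) = hal (ct (ainit U) t.+1 (size u).+1).
  by have [<- _] := cwv_spec t.+1 hU.
have {}IHu := IHu (rcons w a) (etrans hU (esym (cat_rcons _ _ _))).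
have {}IHt := IHt w (a :: u) hU.
rewrite cwvS [fl _]/= -/(fl _).
rewrite -[hal _]/(hal (own (cwv t.+1 (a :: u)))) ho; split.
  case/or3P=> [/IHu [t' [j' [h1 h2 h3]]]|/IHt [t' [j' [h1 h2 h3]]]|h].
  - by exists t', j'; split=> //; apply: leqW.
  - by exists t', j'; split=> //; apply: leqW.
  - by exists t.+1, (size u).+1.
move=> [t' [j' [h1 /= h2 h3]]].
case: (ltngtP t' t.+1) h1 => // h1 _; last first.
  case: (ltngtP j' (size u).+1) h2 => // h2 _.
    by apply/or3P/Or31/IHu; exists t', j'; split=> //; rewrite h1.
  by apply/or3P/Or33; rewrite -h1 -h2.
by apply/or3P/Or32/IHt; exists t', j'.
Qed.

End CA.

(* Labels: 0 root, 1 / 2 input bit false / true, 3 guessed bit, 4 blank,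
   5 left border, 6 inner cell, 7 final cell. Label words are listed with the
   rightmost column first. *)
Definition pstep (p : 'I_5) (tau : nat) : option 'I_5 :=
  match nat_of_ord p, tau with
  | 0, 1 => Some (@Ordinal 5 1 isT)
  | 0, 2 => Some (@Ordinal 5 2 isT)
  | 1, 1 => Some (@Ordinal 5 0 isT)
  | 1, 2 => Some (@Ordinal 5 3 isT)
  | 2, 2 => Some (@Ordinal 5 0 isT)
  | 3, 3 => Some (@Ordinal 5 3 isT)
  | 3, 4 => Some (@Ordinal 5 4 isT)
  | 4, 4 => Some (@Ordinal 5 4 isT)
  | _, _ => None
  end.

(** State 0 is between doubled bits, 1 and 2 follow the first half of a doubled false or true, 3
    follows the delimiter and stays through the guessed region, 4 is the blank region. A state of at
    least 3 thus says that the word is some [tword x g h]. *)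
Definition pst (s : seq nat) : option 'I_5 :=
  foldr (fun tau o => obind (pstep^~ tau) o) (Some (@Ordinal 5 0 isT)) s.

Definition lb (z : seq bool) : seq nat := [seq (nat_of_bool b).+1 | b <- z].

Definition zof (s : seq nat) : seq bool :=
  [seq tau == 2 | tau <- rev s & (tau == 1) || (tau == 2)].

(** The common part of [enc_pair] and [enc_list]: a word read off a grid becomes an input of the
    verifier when a certificate is appended, and an entry of the output list by mere
    concatenation. *)
Definition zx (x : seq bool) := dbl x ++ [:: false; true].

Definition tword x g h : seq nat := nseq h 4 ++ nseq g 3 ++ rev (lb (zx x)).

Lemma rcons_nseq T n (a : T) : rcons (nseq n a) a = nseq n.+1 a.
Proof. by elim: n => //= n ->. Qed.

Lemma dbl_rcons x b : dbl (rcons x b) = dbl x ++ [:: b; b].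
Proof. by rewrite /dbl map_rcons flatten_rcons. Qed.

Lemma size_dbl x : size (dbl x) = 2 * size x.
Proof. by elim: x => //= b x IH; rewrite IH; lia. Qed.

Lemma pst_shape s p : pst s = Some p ->
  match nat_of_ord p with
  | 0 => exists x, s = rev (lb (dbl x))
  | 1 => exists x, s = 1 :: rev (lb (dbl x))
  | 2 => exists x, s = 2 :: rev (lb (dbl x))
  | 3 => exists x g, s = nseq g 3 ++ rev (lb (zx x))
  | _ => exists x g h, s = tword x g h
  end.
Proof.
have lbE x l : rev (lb (dbl x ++ l)) = rev (lb l) ++ rev (lb (dbl x)).
  by rewrite /lb map_cat rev_cat.
elim: s p => [|tau s IH] p /=; first by move=> [<-]; exists [::].
case: (pst s) IH => //= p' /(_ p' erefl).
case: p' => -[|[|[|[|[|]]]]] // hp' /= IH; case: tau => [|[|[|[|[|]]]]] //= [<-] /=.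
- by case: IH => x ->; exists x.
- by case: IH => x ->; exists x.
- by case: IH => x ->; exists (rcons x false); rewrite dbl_rcons lbE.
- by case: IH => x ->; exists x, 0; rewrite /zx lbE.
- by case: IH => x ->; exists (rcons x true); rewrite dbl_rcons lbE.
- by case: IH => x [g ->]; exists x, g.+1.
- by case: IH => x [g ->]; exists x, g, 1.
- by case: IH => x [g [h ->]]; exists x, g, h.+1.
Qed.

Lemma pst_tword s p : pst s = Some p -> 3 <= p -> exists x g h, s = tword x g h.
Proof.
move=> /pst_shape; case: p => -[|[|[|[|[|]]]]] //= _.
by move=> [x [g ->]] _; exists x, g, 0.
Qed.

Lemma tword_pst x g h : exists2 p, pst (tword x g h) = Some p & 3 <= p.
Proof.
have E0 : pst (rev (lb (dbl x))) = Some (@Ordinal 5 0 isT).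
  elim/last_ind: x => [|x b IH] //.
  by rewrite dbl_rcons /lb map_cat rev_cat /= IH; case: b.
have E1 : pst (rev (lb (zx x))) = Some (@Ordinal 5 3 isT).
  by rewrite /zx /lb map_cat rev_cat /= E0.
have E2 : pst (nseq g 3 ++ rev (lb (zx x))) = Some (@Ordinal 5 3 isT).
  by elim: g => //= g ->.
elim: h => [|h [p hp h3]]; first by exists (@Ordinal 5 3 isT).
exists (@Ordinal 5 4 isT) => //=; rewrite hp /=.
by case: p h3 {hp} => -[|[|[|[|[|]]]]].
Qed.

Lemma zof_tword x g h : zof (tword x g h) = zx x.
Proof.
rewrite /zof /tword catA rev_cat revK filter_cat map_cat.
have -> : [seq tau <- rev (nseq h 4 ++ nseq g 3) | (tau == 1) || (tau == 2)] = [::].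
  rewrite rev_cat !rev_nseq filter_cat.
  by elim: g h => [|g IH] [|h] //=; rewrite ?(IH 0) //; elim: h.
rewrite cats0; elim: (zx x) => //= b z IH.
by case: b; rewrite /= IH.
Qed.

Lemma size_tword x g h : size (tword x g h) = h + (g + (2 * size x + 2)).
Proof. by rewrite /tword !size_cat !size_nseq size_rev size_map size_cat size_dbl. Qed.

Lemma dbl_inj : injective dbl.
Proof. by elim=> [|a x IH] [|b y] //= [-> _ /IH ->]. Qed.

Lemma zx_inj : injective zx.
Proof.
move=> x y e; have hs : size x = size y.
  by have := congr1 size e; rewrite !size_cat !size_dbl /=; lia.
by move/eqP: e; rewrite /zx eqseq_cat ?size_dbl ?hs // eqxx andbT => /eqP /dbl_inj.
Qed.

(** * States of the cells and their local rules *)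

Section Values.
Variables VM DM : TM.

(** Output is read from the head on, so halting on the bit true means a nonempty output that begins
    with true: the approval of the clock. *)
Definition halD (c : Gam DM) : bool :=
  if c is Some (s, Some q) then @tm_halt DM q && (s == bitsym DM true) else false.
Definition halV (c : Gam VM) : bool :=
  if c is Some (_, Some q) then @tm_halt VM q && @tm_acc VM q else false.

(* parser state, in column 0, in row 0, simulation of the clock *)
Definition Dt := ('I_5 * bool * bool * cw DM)%type.
(* None is the joker, allowed once some part of the grid is missing or malformed *)
Definition W := option (Dt * cw VM).

Definition prs (d : Dt) := d.1.1.1.
Definition atL (d : Dt) := d.1.1.2.
Definition atT (d : Dt) := d.1.2.
Definition cwD (d : Dt) := d.2.

Definition dsym (tau : nat) : 'I_(tm_k DM).+3 :=
  if tau <= 2 then bitsym DM true else if tau == 3 then bitsym DM false else blank DM.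

Definition rootD : Dt := (@Ordinal 5 0 isT, true, true, wall DM).
Definition topD tau (d : Dt) : option Dt :=
  if atT d then
    omap (fun p => (p, false, true, cw_top halD (topc (atL d) (dsym tau)) (cwD d)))
      (pstep (prs d) tau)
  else None.
Definition leftD (d : Dt) : option Dt :=
  if atL d then Some (@Ordinal 5 0 isT, true, false, wall DM) else None.
Definition innD (l u : Dt) : option Dt :=
  if ~~ atT l && ~~ atL u then Some (prs u, false, false, cw_step halD (cwD l) (cwD u)) else None.
Definition okF (d : Dt) := (3 <= prs d) && fl (cwD d).

(** The part of the state that is forced on the cell in row [t] over the top labels [s], whatever
    the ordering. *)
Definition DV t s : option Dt :=
  omap (fun p => (p, nilp s, t == 0, cwv halD t (map dsym s))) (pst s).

Lemma DV_top tau s : DV 0 (tau :: s) = obind (topD tau) (DV 0 s).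
Proof.
rewrite /DV /=; case: (pst s) => //= p; rewrite /topD /=.
by case: pstep => //= p'; case: s.
Qed.

Lemma DV_left t : DV t.+1 [::] = obind leftD (DV t [::]).
Proof. by []. Qed.

Lemma DV_inn t tau s :
  DV t.+1 (tau :: s) = obind (fun l => obind (innD l) (DV t (tau :: s))) (DV t.+1 s).
Proof. by rewrite /DV /=; case: (pst s) => //= p; case: pstep. Qed.

Lemma DV_fields t s d : DV t s = Some d -> atL d = nilp s /\ atT d = (t == 0).
Proof. by rewrite /DV; case: (pst s) => //= p [<-]. Qed.

Notation symV := 'I_(tm_k VM).+3.

(** [pre] is the symbol to the left. In the guessed region a blank is followed by blanks only, so
    that the region spells a certificate not longer than itself. *)
Definition okV (tau : nat) (pre : option symV) (a : symV) : bool :=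
  match tau with
  | 1 => a == bitsym VM false
  | 2 => a == bitsym VM true
  | 3 => [|| a == bitsym VM false, a == bitsym VM true | a == blank VM]
         && ((pre == Some (blank VM)) ==> (a == blank VM))
  | _ => a == blank VM
  end.

Definition presym (c : cw VM) : option symV := omap fst (own c).

(** A relation and not a function: the symbol of the verifier in the top row is the only freedom
    that the rules leave. The rules for the border and for inner cells are functions that propagate
    the joker. *)
Definition topOK tau (wl w : W) : bool :=
  match wl with
  | None => w == None
  | Some (d, c) =>
    match topD tau d with
    | None => w == None
    | Some d' => [exists a, okV tau (presym c) a
                   && (w == Some (d', cw_top halV (topc (atL d) a) c))]
    end
  end.
Definition leftW (wu : W) : W :=
  if wu is Some (d, c) then omap (fun d' => (d', wall VM)) (leftD d) else None.
Definition innW (wl wu : W) : W :=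
  if wl is Some (d, c) then if wu is Some (d', c') then
    omap (fun d'' => (d'', cw_step halV c c')) (innD d d') else None else None.
Definition rej (w : W) : bool :=
  if w is Some (d, c) then okF d && ~~ fl c else false.

Definition WV t s (v : seq symV) : W :=
  omap (fun d => (d, cwv halV t v)) (DV t s).

Fixpoint okvs (s : seq nat) (v : seq symV) : bool :=
  match s, v with
  | tau :: s', a :: v' => okV tau (ohead v') a && okvs s' v'
  | _, _ => true
  end.

Lemma presym_cw0 v : presym (cw0 halV v) = ohead v.
Proof. by case: v. Qed.

Lemma WV_top tau s v w : size s = size v -> topOK tau (WV 0 s v) w ->
  exists a, w = WV 0 (tau :: s) (a :: v) /\
   (WV 0 (tau :: s) (a :: v) != None -> okV tau (ohead v) a).
Proof.
move=> hsz; rewrite /WV DV_top /=.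
case E : (DV 0 s) => [d|] /=; last by move=> /eqP ->; exists (blank VM).
case E' : (topD tau d) => [d'|] /=; last by move=> /eqP ->; exists (blank VM).
move=> /existsP[a /andP[h1 /eqP ->]]; exists a; rewrite presym_cw0 in h1; split=> //.
have [-> _] := DV_fields E.
by move: hsz; case: (s) => [|? ?]; case: (v).
Qed.

Lemma WV_top_ok tau s v a : size s = size v ->
  (pst (tau :: s) -> okV tau (ohead v) a) ->
  topOK tau (WV 0 s v) (WV 0 (tau :: s) (a :: v)).
Proof.
move=> hsz hok; rewrite /topOK /WV DV_top /=.
case E : (DV 0 s) => [d|] //=; case E' : (topD tau d) => [d'|] //=.
apply/existsP; exists a; rewrite presym_cw0 hok /=; last first.
  move: E E'; rewrite /DV /topD /=; case: (pst s) => //= p [<-] /=.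
  by case: pstep.
have [-> _] := DV_fields E; move: hsz; case: (s) => [|? ?]; case: (v) => // *; exact: eqxx.
Qed.

Lemma WV_left t : WV t.+1 [::] [::] = leftW (WV t [::] [::]).
Proof. by rewrite /WV DV_left. Qed.

Lemma WV_inn t tau s a v :
  WV t.+1 (tau :: s) (a :: v) = innW (WV t.+1 s v) (WV t (tau :: s) (a :: v)).
Proof.
rewrite /WV DV_inn; case: (DV t.+1 s) => //= d; case: (DV t _) => //= d'.
Qed.

Lemma okvs_bits z v : size v = size (rev (lb z)) -> okvs (rev (lb z)) v ->
  rev v = [seq bitsym VM b | b <- z].
Proof.
elim/last_ind: z v => [|z b IH] v; first by case: v.
rewrite /lb map_rcons rev_rcons; case: v => //= a v [/IH{}IH] /andP[h /IH h'].
by rewrite rev_cons h' map_rcons; case: b h => /eqP ->.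
Qed.

Lemma okvs_shape x g h v : size v = size (tword x g h) -> okvs (tword x g h) v ->
  exists y, size y <= g /\
    rev v = [seq bitsym VM b | b <- zx x ++ y] ++ nseq (g - size y + h) (blank VM).
Proof.
rewrite /tword; elim: h v => [|h IH] v /=; last first.
  case: v => //= a v [/IH{}IH] /andP[/eqP -> /IH [y [h1 h2]]].
  by exists y; split=> //; rewrite rev_cons h2 rcons_cat rcons_nseq addnS.
elim: g v => [|g IH] v /=.
  move=> hs ho; exists [::]; rewrite cats0 /= cats0; split=> //; exact: okvs_bits ho.
case: v => //= a v [/IH{}IH] /andP[/andP[h1 h2] /IH [y [h3 h4]]].
rewrite addn0 in h4; rewrite rev_cons h4.
case: (ltngtP (size y) g) h3 => // hy _.
  (* The certificate has already ended inside the region, so persistence of blanks forces another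
     blank. *)
  have hb : a = blank VM.
    apply/eqP; apply: (implyP h2); rewrite -(revK v) h4.
    have -> : g - size y = (g - (size y).+1).+1 by lia.
    by rewrite -rcons_nseq -rcons_cat rev_rcons.
  exists y; split; first lia.
  by rewrite hb addn0 subSn 1?ltnW // rcons_cat rcons_nseq.
rewrite hy subnn cats0; case/or3P: h1 => /eqP ->.
- exists (rcons y false); rewrite size_rcons hy subnn addn0 cats0; split=> //.
  by rewrite -cats1 -[rcons y false]cats1 catA [in RHS]map_cat.
- exists (rcons y true); rewrite size_rcons hy subnn addn0 cats0; split=> //.
  by rewrite -cats1 -[rcons y true]cats1 catA [in RHS]map_cat.
- exists y; split; first lia.
  by rewrite -cats1 addn0 subSn ?hy // subnn.
Qed.

End Values.

Local Arguments bitsym : simpl never.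

Lemma run_size M t x (cf := run t (init M x)) :
  size cf.1.2 <= t /\ size cf.1.2 + size cf.2 <= size x + t.
Proof.
rewrite {}/cf; elim: t => [|t [h1 h2]]; first by rewrite /= size_map addn0.
rewrite /run iterS -/(run t _); case: (run t _) h1 h2 => [[q l] r] /= h1 h2.
case: ifP => _ /=; first by lia.
case: tm_delta => [[q' b] []] /=; rewrite ?size_behead; last by lia.
  by case: l h1 h2 => [|c l] /=; rewrite ?size_behead; lia.
by lia.
Qed.

Lemma halted_eq M t1 t2 (c : config M) :
  @tm_halt M (cfg_state (run t1 c)) -> @tm_halt M (cfg_state (run t2 c)) -> run t1 c = run t2 c.
Proof.
move=> h1 h2; case: (leqP t1 t2) => h; first by rewrite (run_halted h1 h).
by rewrite (run_halted h2 (ltnW h)).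
Qed.

Lemma size_read_bits M (r : seq 'I_(tm_k M).+3) : size (read_bits r) <= size r.
Proof. by elim: r => //= a r IH; case: ifP => _ //; case: ifP. Qed.

Lemma nth_pad T (b : T) s k i : nth b (s ++ nseq k b) i = nth b s i.
Proof.
rewrite nth_cat; case: ltnP => // h.
by rewrite nth_nseq if_same nth_default.
Qed.

Lemma ainitE M (u : seq 'I_(tm_k M).+3) x k :
  rev u = map (bitsym M) x ++ nseq k (blank M) -> ainit u = abs (init M x).
Proof.
move=> h; rewrite /ainit /abs h; congr pair.
by apply: functional_extensionality => i; rewrite nth_pad.
Qed.

Lemma cont_head M (cf : config M) : cont (abs cf) (size cf.1.2) =
  (head (blank M) cf.2, Some (cfg_state cf)).
Proof. by rewrite /cont /= eqxx nth_catrev ltnn subnn nth0. Qed.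

Lemma cont_state M (cf : config M) p s q : cont (abs cf) p = (s, Some q) ->
  [/\ p = size cf.1.2, s = head (blank M) cf.2 & q = cfg_state cf].
Proof.
move=> h; have hp : p = size cf.1.2 by move: h; rewrite /cont /=; case: eqP.
by move: h; rewrite hp cont_head => -[<- <-].
Qed.

(** * What the flags of the clock and the verifier certify *)

Section Semantics.
Variables (L V : lang) (cL kL cV kV cD kD : nat) (VM DM : TM).

(* Lengths in terms of the length a = 2 |x| + 2 of the self-delimiting code of x. *)
Definition qf a := pbound cL kL ((a - 2)./2).
Definition Tf a := pbound cV kV (a + qf a).
Definition Bf a := 2 * Tf a + a + qf a + 2.

(* The clock checks that the guessed region has the right length; writing its
   output forces it to run for at least 2 Tf a steps. *)
Definition hD (inp : seq bool) : seq bool :=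
  let a := find negb inp in
  if size inp - a == qf a then nseq (Bf a) true else [::].

Hypothesis hL : forall x, L x <->
  exists y, size y <= pbound cL kL (size x) /\ V (enc_pair x y).
Hypothesis hVM : forall x, let cf := run (pbound cV kV (size x)) (init VM x) in
  @tm_halt VM (cfg_state cf) /\ (@tm_acc VM (cfg_state cf) <-> V x).
Hypothesis hDM : forall x, let cf := run (pbound cD kD (size x)) (init DM x) in
  @tm_halt DM (cfg_state cf) /\ cfg_output cf = hD x.

Definition ax (x : seq bool) := 2 * size x + 2.

Lemma qf_ax x : qf (ax x) = pbound cL kL (size x).
Proof. by rewrite /qf /ax; congr pbound; lia. Qed.

(** The clock sees lengths only: [dsym] shows it every input bit as true and every guess as
    false. *)
Definition dinp x g := nseq (ax x) true ++ nseq g false.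

Lemma size_dinp x g : size (dinp x g) = ax x + g.
Proof. by rewrite size_cat !size_nseq. Qed.

Lemma find_dinp x g : find negb (dinp x g) = ax x.
Proof.
rewrite /dinp find_cat size_nseq has_nseq andbF.
by rewrite [X in _ + X](_ : _ = 0) ?addn0 //; case: g.
Qed.

Lemma rev_dsym x g h :
  rev (map (dsym DM) (tword x g h)) = map (bitsym DM) (dinp x g) ++ nseq h (blank DM).
Proof.
rewrite /tword /dinp !map_cat !rev_cat -map_rev revK !map_nseq !rev_nseq; congr ((_ ++ _) ++ _).
have -> : ax x = size (zx x) by rewrite /zx size_cat size_dbl.
by elim: (zx x) => //= b z ->; case: b.
Qed.

(** Besides the length of the guess, the flag certifies size: it was raised at some time [t'] to the
    right of the wall, so the row number and the number of columns both exceed [2 * Tf]. *)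
Lemma clock_flag x g h t : fl (cwv (@halD DM) t (map (dsym DM) (tword x g h))) ->
  g = qf (ax x) /\ exists t', [/\ t' <= t, 2 * Tf (ax x) + 2 <= t' & t' < size (tword x g h)].
Proof.
set U := map _ _; move=> /(@cwv_fl DM (@halD DM) erefl U [::] U t erefl) [t' [j' [h1 h2]]].
rewrite /ct; case: leqP => // h3.
rewrite (ainitE (rev_dsym x g h)) -abs_run /halD.
case E : (cont _ _) => [s [q|]] // /andP[hq /eqP hs].
have [_ e1 e2] := cont_state E; subst q.
have [k1 k2] := hDM (dinp x g).
rewrite -(halted_eq hq k1) in k2.
have hne : hD (dinp x g) != [::].
  rewrite -k2 /cfg_output; move: e1; rewrite hs.
  case: (run _ _).2 => [|c r] /= e1; last by rewrite -e1 bitsym_tf eqxx.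
  by have /eqP := e1; rewrite (negbTE (bitsym_neq _ _)).
move: k2 hne; rewrite /hD find_dinp size_dinp addKn; case: eqP => // hg k2 _.
split=> //; exists t'; rewrite size_map in h2; split=> //; last by apply: leq_trans h3 h2.
(* The tape has at most as many cells as input length plus steps, so an output of length [Bf] takes
   at least [2 * Tf + 2] steps. *)
have := run_size DM t' (dinp x g); have := size_read_bits (run t' (init DM (dinp x g))).2.
rewrite -/(cfg_output _) k2 size_nseq size_dinp hg /Bf; lia.
Qed.

Lemma clock_ok x h t (P := pbound cD kD (ax x + qf (ax x))) :
  P <= t -> 2 * P < size (tword x (qf (ax x)) h) ->
  fl (cwv (@halD DM) t (map (dsym DM) (tword x (qf (ax x)) h))).
Proof.
move=> h1 h2; set g := qf (ax x) in h2 *; set U := map _ _.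
apply/(@cwv_fl DM (@halD DM) erefl U [::] U t erefl).
have := hDM (dinp x g); rewrite size_dinp -/g -/P => -[k1 k2].
have [k3 _] := run_size DM P (dinp x g).
set cf := run P _ in k1 k2 k3.
(* The column of the head at time [P]: its position, shifted by one for the border and by [P] for
   the slant. *)
exists P, (size cf.1.2 + P).+1; split=> //.
  by rewrite size_map; lia.
rewrite /ct; have -> : ((size cf.1.2 + P).+1 <= P) = false by lia.
rewrite (ainitE (rev_dsym x g h)) -abs_run -/cf succnK addnK cont_head /= k1 /=.
move: k2; rewrite /hD find_dinp size_dinp addKn eqxx /Bf addnS /cfg_output.
case: cf.2 => [|c r] //=; case: ifP => // _; case: ifP => //.
Qed.

(** The verifier halts by time [P <= Tf] with its head at position at most [P], hence in column at
    most [2 * P + 1]; this is the width that the last premise provides. *)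
Lemma verify_flag x y (v : seq 'I_(tm_k VM).+3) k t :
  size y <= qf (ax x) ->
  rev v = map (bitsym VM) (zx x ++ y) ++ nseq k (blank VM) ->
  Tf (ax x) <= t -> 2 * Tf (ax x) < size v ->
  fl (cwv (@halV VM) t v) <-> V (enc_pair x y).
Proof.
move=> hy hv ht hs.
have -> : enc_pair x y = zx x ++ y by rewrite /enc_pair /zx -catA.
have [k1 k2] := hVM (zx x ++ y); set P := pbound _ _ _ in k1 k2.
have hP : P <= Tf (ax x).
  apply: (poly_pbound _ _).1; rewrite size_cat /zx size_cat size_dbl -/(ax x).
  by rewrite leq_add2l.
split.
  move=> /(@cwv_fl VM (@halV VM) erefl v [::] v t erefl) [t' [j' [h1 h2]]].
  rewrite /ct; case: leqP => // h3; rewrite (ainitE hv) -abs_run /halV.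
  case E : (cont _ _) => [s [q|]] // /andP[hq ha].
  have [_ _ e2] := cont_state E; subst q.
  by rewrite (halted_eq hq k1) in ha; apply/k2.
move=> /k2 ha; apply/(@cwv_fl VM (@halV VM) erefl v [::] v t erefl).
have [k3 _] := run_size VM P (zx x ++ y).
set cf := run P _ in k1 ha k3.
exists P, (size cf.1.2 + P).+1; split; [lia|lia|].
rewrite /ct; have -> : ((size cf.1.2 + P).+1 <= P) = false by lia.
by rewrite (ainitE hv) -abs_run -/cf succnK addnK cont_head /= k1 ha.
Qed.

Lemma sem_sound s p v t : pst s = Some p -> 3 <= p -> size v = size s -> okvs s v ->
  fl (cwv (@halD DM) t (map (dsym DM) s)) -> fl (cwv (@halV VM) t v) ->
  exists2 x, zof s = zx x & L x.
Proof.
move=> h1 h2 h3 h4 h5 h6; have [x [g [h E]]] := pst_tword h1 h2; subst s.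
have [hg [t' [k1 k2 k3]]] := clock_flag h5.
have [y [hy hv]] := okvs_shape h3 h4.
exists x; first exact: zof_tword.
apply/hL; exists y; rewrite -qf_ax -hg; split=> //.
have h7 : Tf (ax x) <= t by lia.
have h8 : 2 * Tf (ax x) < size v by rewrite h3; lia.
rewrite hg in hy; exact: (verify_flag hy hv h7 h8).1.
Qed.

(** The certificate depends on the code alone, and [vsym] picks its bit by counting the guessed
    columns to the left. So [vcan] of a longer word extends [vcan] of a shorter one, and grids that
    share cells agree on them. *)
Definition wit (z : seq bool) : seq bool :=
  epsilon (inhabits [::]) (fun y => size y <= qf (size z) /\ V (z ++ y)).

Definition vsym s tau : 'I_(tm_k VM).+3 :=
  match tau with
  | 1 => bitsym VM false
  | 2 => bitsym VM true
  | 3 => if count_mem 3 s < size (wit (zof s))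
         then bitsym VM (nth false (wit (zof s)) (count_mem 3 s)) else blank VM
  | _ => blank VM
  end.

Fixpoint vcan (s : seq nat) : seq 'I_(tm_k VM).+3 :=
  if s is tau :: s' then vsym s' tau :: vcan s' else [::].

Lemma size_vcan s : size (vcan s) = size s.
Proof. by elim: s => //= a s ->. Qed.

Lemma zof_cons3 s : zof (3 :: s) = zof s.
Proof. by rewrite /zof rev_cons filter_rcons. Qed.

Lemma vcan_ok tau s : pst (tau :: s) -> okV tau (ohead (vcan s)) (vsym s tau).
Proof.
case E : (pst (tau :: s)) => [p|] // _; move: E => /=.
case E' : (pst s) => [p'|] //=.
case: tau => [|[|[|[|tau]]]] //=; rewrite ?eqxx // => h3.
apply/andP; split.
  by case: ifP => _; [case: nth|]; rewrite !eqxx ?orbT.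
have {h3}hp : p' = 3 :> nat.
  by move: h3; rewrite /pstep; case: p' {E'} => -[|[|[|[|[|]]]]].
case: s E' => [|tau' s] /=; first by move=> [E]; move: hp; rewrite -E.
case: (pst s) => //= p2 E2; apply/implyP => /eqP [].
have : (tau' == 2) || (tau' == 3).
  move: E2; rewrite /pstep; case: p2 => -[|[|[|[|[|]]]]] //= _;
  by case: tau' => [|[|[|[|[|]]]]] //= [E2]; move: hp; rewrite -E2.
case/orP => /eqP -> /=; first by move=> /eqP; rewrite (negbTE (bitsym_neq _ true)).
case: ltnP => h; first by move=> /eqP; rewrite (negbTE (bitsym_neq _ _)).
by move=> _; rewrite zof_cons3 ltnNge (leq_trans h).
Qed.

Lemma vcan_tword x h (g := qf (ax x)) : size (wit (zx x)) <= g ->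
  rev (vcan (tword x g h)) =
    map (bitsym VM) (zx x ++ wit (zx x)) ++ nseq (g - size (wit (zx x)) + h) (blank VM).
Proof.
move=> hw; rewrite /tword; elim: h => [|h IH] /=; last first.
  by rewrite rev_cons IH rcons_cat rcons_nseq addnS.
have hz i : zof (nseq i 3 ++ rev (lb (zx x))) = zx x by exact: (zof_tword x i 0).
have hc i : count_mem 3 (nseq i 3 ++ rev (lb (zx x))) = i.
  rewrite count_cat count_nseq /= mul1n (eqP (_ : count_mem 3 _ == 0)) ?addn0 //.
  by rewrite -leqn0 leqNgt -has_count has_rev; elim: (zx x) => //= -[].
have h0 : rev (vcan (rev (lb (zx x)))) = map (bitsym VM) (zx x).
  elim/last_ind: (zx x) => [|z b IH] //=; rewrite /lb map_rcons rev_rcons /= rev_cons IH map_rcons.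
  by case: b.
have hg i : rev (vcan (nseq i 3 ++ rev (lb (zx x)))) = map (bitsym VM) (zx x) ++
    mkseq (fun i => if i < size (wit (zx x)) then bitsym VM (nth false (wit (zx x)) i) else blank VM) i.
  elim: i => [|i IH]; first by rewrite cats0.
  by rewrite [nseq _ _ ++ _]/= [vcan _]/= rev_cons IH hz hc mkseqS rcons_cat.
rewrite /= hg map_cat addn0 -catA; congr cat.
apply: (@eq_from_nth _ (blank VM)).
  by rewrite size_mkseq size_cat size_map size_nseq subnKC.
move=> i; rewrite size_mkseq => hi; rewrite nth_mkseq // nth_cat size_map.
by case: ltnP => hs; [rewrite (nth_map false)|rewrite nth_nseq if_same].
Qed.

Lemma sem_complete s p t x : pst s = Some p -> 3 <= p ->
  fl (cwv (@halD DM) t (map (dsym DM) s)) -> zof s = zx x -> L x ->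
  fl (cwv (@halV VM) t (vcan s)).
Proof.
move=> h1 h2 h3 hz hx; have [x' [g [h E]]] := pst_tword h1 h2; subst s.
move: hz; rewrite zof_tword => /zx_inj E; subst x'.
have [hg [t' [k1 k2 k3]]] := clock_flag h3.
have [hw1 hw2] : size (wit (zx x)) <= qf (size (zx x)) /\ V (zx x ++ wit (zx x)).
  apply: (epsilon_spec (inhabits [::]) (fun y => size y <= qf (size (zx x)) /\ V (zx x ++ y))).
  move/hL: hx => [y [hy hv]].
  by exists y; rewrite size_cat size_dbl -/(ax x) qf_ax /zx -catA.
have hsz : size (zx x) = ax x by rewrite size_cat size_dbl.
rewrite hsz in hw1; subst g.
have h7 : Tf (ax x) <= t by lia.
have h8 : 2 * Tf (ax x) < size (vcan (tword x (qf (ax x)) h)) by rewrite size_vcan; lia.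
apply: (verify_flag hw1 (vcan_tword h hw1) h7 h8).2.
by rewrite /enc_pair catA.
Qed.

End Semantics.

(** * Cells and forbidden patterns *)

(* The gadget of label tau is the complement of a lollipop: the path 0, ..., s - 1
   together with the chord {0, tau + 2}. *)
Definition NK (tau a b : nat) : bool :=
  [|| a.+1 == b, b.+1 == a, (a == 0) && (b == tau + 2) | (b == 0) && (a == tau + 2)].
Definition K (tau a b : nat) : bool := (a != b) && ~~ NK tau a b.

(** A vertex can fail to be adjacent to 10, 13 or 16 only from distance at most one, because the
    chord stays below 10. Hence each of [a] and [b] excludes at most one of the three candidates. *)
Lemma K_common tau a b s : tau < 8 -> 20 <= s ->
  exists c, [/\ c < s, K tau a c & K tau b c].
Proof.
move=> ht hs.
have : [|| K tau a 10 && K tau b 10, K tau a 13 && K tau b 13 | K tau a 16 && K tau b 16].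
  by rewrite /K /NK; lia.
by case/or3P => /andP[h1 h2]; [exists 10|exists 13|exists 16]; split=> //; lia.
Qed.

(* The inverse of f maps non-edges to non-edges. The only leaf s - 1 of the lollipop is fixed,
   hence so is the whole stick, and the only vertex of degree three is tau + 2. *)
Lemma K_rigid tau tau' s (f : nat -> nat) : tau < 8 -> tau' < 8 -> 20 <= s ->
  (forall a, a < s -> f a < s) ->
  (forall a b, a < s -> b < s -> f a = f b -> a = b) ->
  (forall a b, a < s -> b < s -> K tau a b -> K tau' (f a) (f b)) ->
  tau = tau' /\ forall p, 10 <= p < s -> f p = p.
Proof.
move=> ht ht' hs fs finj fK.
have surj b : b < s -> exists2 a, a < s & f a = b.
  move=> hb; have hu : uniq (map f (iota 0 s)).
    rewrite map_inj_in_uniq ?iota_uniq // => x y; rewrite !mem_iota !add0n => /andP[_ hx] /andP[_ hy].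
    exact: finj.
  have hsub : {subset map f (iota 0 s) <= iota 0 s}.
    by move=> x /mapP[y]; rewrite !mem_iota => /andP[_ hy] ->; rewrite add0n fs.
  have hle : size (iota 0 s) <= size (map f (iota 0 s)) by rewrite size_map.
  have [_ /(_ b)] := uniq_min_size hu hsub hle.
  by rewrite mem_iota hb => /mapP[a]; rewrite mem_iota => /andP[_ ha] ->; exists a.
have NN a b : a < s -> b < s -> a != b -> NK tau' (f a) (f b) -> NK tau a b.
  move=> ha hb hab h; apply/negPn/negP => h'.
  by have := fK a b ha hb; rewrite /K hab h' /= h andbF => /(_ isT).
have leaf : f s.-1 = s.-1.
  apply/eqP/negPn/negP => hv.
  have : exists v1 v2, [/\ v1 < s, v2 < s, v1 != v2, NK tau' v1 (f s.-1) & NK tau' v2 (f s.-1)].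
    have := fs s.-1; case E : (f s.-1) => [|v] h; rewrite /NK.
      by exists 1, (tau' + 2); split; lia.
    by exists v, v.+2; split; lia.
  move=> [v1 [v2 [h1 h2 h12]]]; have [a1 ha1 E1] := surj _ h1; have [a2 ha2 E2] := surj _ h2.
  rewrite -E1 -E2 => n1 n2.
  have k1 : a1 != s.-1 by apply/eqP => e; move: n1; rewrite e /NK; lia.
  have k2 : a2 != s.-1 by apply/eqP => e; move: n2; rewrite e /NK; lia.
  have := NN a1 s.-1 ha1 _ k1 n1; have := NN a2 s.-1 ha2 _ k2 n2.
  rewrite /NK => /(_ ltac:(lia)) m2 /(_ ltac:(lia)) m1.
  have e : a1 = a2 by lia.
  by move: h12; rewrite -E1 -E2 -e eqxx.
have stick k : k < s -> tau + 2 <= s.-1 - k -> f (s.-1 - k) = s.-1 - k.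
  elim: k {-2}k (leqnn k) => [|m IH] k; first by rewrite leqn0 => /eqP -> _ _; rewrite subn0.
  move=> hk hks hr; case: k hk hks hr => [|k] hk hks hr; first by rewrite subn0.
  move Ei : (s.-1 - k.+1) => i; have hi : i.+1 = s.-1 - k by lia.
  have hf1 : f i.+1 = i.+1 by rewrite hi; apply: IH; lia.
  have [a ha Ea] := surj i ltac:(lia).
  have hai : a != i.+1 by apply/eqP => e; move: Ea; rewrite e hf1; lia.
  have := NN a i.+1 ha ltac:(lia) hai; rewrite Ea hf1 /NK eqxx => /(_ isT) h.
  have : a = i \/ a = i.+2 by lia.
  case=> e; first by rewrite -{1}e.
  exfalso.
  have : f i.+2 = i.+2.
    have -> : i.+2 = s.-1 - k.-1 by lia.
    by apply: IH; lia.
  by rewrite -e Ea; lia.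
have st p : tau + 2 <= p -> p < s -> f p = p.
  by move=> h1 h2; have := stick (s.-1 - p); rewrite subKn; [apply; lia|lia].
split; last by move=> p /andP[h1 h2]; apply: st; lia.
have [r Er] : exists r, r = tau' + 2 by exists (tau' + 2).
have [a ha Ea] := surj r ltac:(lia).
have [a0 h0 E0] := surj 0 ltac:(lia).
have [a1 h1 E1] := surj r.-1 ltac:(lia).
have [a2 h2 E2] := surj r.+1 ltac:(lia).
have D x y : f x != f y -> x != y by apply: contra => /eqP ->.
have k0 : NK tau a0 a by apply: NN => //; [apply: D|]; rewrite E0 Ea /NK; lia.
have k1 : NK tau a1 a by apply: NN => //; [apply: D|]; rewrite E1 Ea /NK; lia.
have k2 : NK tau a2 a by apply: NN => //; [apply: D|]; rewrite E2 Ea /NK; lia.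
have d01 : a0 != a1 by apply: D; rewrite E0 E1; lia.
have d02 : a0 != a2 by apply: D; rewrite E0 E2; lia.
have d12 : a1 != a2 by apply: D; rewrite E1 E2; lia.
have ea : a = tau + 2 by move: k0 k1 k2; rewrite /NK; lia.
have := st a; rewrite Ea ea => /(_ ltac:(lia) ltac:(lia)); lia.
Qed.

(** The forbidden family only has to exist, so membership in it may be decided classically. *)
Definition asb (P : Prop) : bool := if excluded_middle_informative P then true else false.
Lemma asbP P : reflect P (asb P).
Proof. by rewrite /asb; case: excluded_middle_informative => h; constructor. Qed.

Section Patterns.
Variables (W : finType) (rootW : W) (topOK : nat -> W -> W -> bool) (leftW : W -> W)
  (innW : W -> W -> W) (rej : W -> bool).

Definition nW := #|W|.
(** The chord ends at [tau + 2 <= 9], so the positions from 10 on lie on the stick and are fixed by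
    rigidity: 10 to 13 carry the links, [14 + 2 * j] and [15 + 2 * j] form the private pair of state
    number [j]. *)
Definition gs := 20 + 2 * nW.

Section OneGraph.
Variables (n : nat) (adj : nat -> nat -> bool) (pos : nat -> nat).

Definition occ (o : obj) : bool :=
  [&& o.1 < 8, size o.2 == gs, all (fun v => v < n) o.2, uniq o.2
    & all (fun a => all (fun b => K o.1 a b ==> adj o.[a] o.[b]) (iota 0 gs)) (iota 0 gs)].

Definition touch (o o' : obj) := has (fun u => has (fun v => (u == v) || adj u v) o'.2) o.2.

(* Positions 10, 11 (12, 13) are the two ends of a link to the left (upper) neighbour. *)
Definition lft (o o' : obj) := adj o.[10] o'.[11].
Definition up (o o' : obj) := adj o.[12] o'.[13].

(** Positions below 10 are left out because the cycle of the lollipop can be reflected: one gadget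
    has several occurrences, which must count as the same cell. *)
Definition eqo (o o' : obj) :=
  (o.1 == o'.1) && all (fun p => o.[p] == o'.[p]) (iota 10 (gs - 10)).

(* The state is the index of the first pair of private vertices placed in decreasing
   order; if there is none, it is the default rootW. *)
Definition st (o : obj) : W :=
  nth rootW (enum W) (find (fun j => pos o.[15 + 2 * j] < pos o.[14 + 2 * j]) (iota 0 nW)).

(** Linked cells are compared by their anchor, position 10. In the last clause [o3] is the corner of
    the square: [o1] is above its left neighbour [o2], and [o5] is to the left of its upper
    neighbour [o4]. *)
Definition sviol (o1 o2 o3 o4 o5 : obj) : bool :=
  [|| has (fun u => u \in o2.2) o1.2 && ~~ eqo o1 o2,
      [&& lft o2 o1, lft o2 o3 & o1.[10] != o3.[10]],
      [&& up o2 o1, up o2 o3 & o1.[10] != o3.[10]]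
    | [&& up o2 o1, lft o3 o2, up o3 o4, lft o4 o5 & o1.[10] != o5.[10]]].

Definition oviol (d c e : obj) : bool :=
  match c.1 with
  | 0 => st c != rootW
  | 1 | 2 | 3 | 4 => lft c d && ~~ topOK c.1 (st d) (st c)
  | 5 => up c e && (st c != leftW (st e))
  | _ => [&& lft c d, up c e &
          (st c != innW (st d) (st e)) || ((c.1 == 7) && rej (st c))]
  end.

(** Consecutive cells touch, which makes their union connected; a clause on fewer cells is used with
    some of them repeated. *)
Definition occs o1 o2 o3 o4 o5 : bool :=
  [&& occ o1, occ o2, occ o3, occ o4 & occ o5] &&
  [&& touch o1 o2, touch o2 o3, touch o3 o4 & touch o4 o5].

Definition struct_ok := forall o1 o2 o3 o4 o5, occs o1 o2 o3 o4 o5 -> ~~ sviol o1 o2 o3 o4 o5.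

Definition viol := exists o1 o2 o3 o4 o5,
  occs o1 o2 o3 o4 o5 && (sviol o1 o2 o3 o4 o5 || oviol o1 o2 o3).

Lemma occ_lt o a : occ o -> a < gs -> o.[a] < n.
Proof. by case/and5P=> _ /eqP hs /allP h _ _ ha; apply: h; apply: mem_nth; rewrite hs. Qed.

Lemma occ_mem o a : occ o -> a < gs -> o.[a] \in o.2.
Proof. by case/and5P=> _ /eqP hs _ _ _ ha; apply: mem_nth; rewrite hs. Qed.

Lemma occ_inj o a b : occ o -> a < gs -> b < gs -> o.[a] = o.[b] -> a = b.
Proof.
case/and5P=> _ /eqP hs _ hu _ ha hb /eqP; rewrite nth_uniq ?hs //; exact: eqP.
Qed.

Lemma occ_K o a b : occ o -> a < gs -> b < gs -> K o.1 a b -> adj o.[a] o.[b].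
Proof.
case/and5P=> _ _ _ _ /allP h ha hb.
have /h /allP h' : a \in iota 0 gs by rewrite mem_iota.
by have /h' /implyP : b \in iota 0 gs by rewrite mem_iota.
Qed.

Lemma occ_index o v : occ o -> v \in o.2 -> exists2 a, a < gs & o.[a] = v.
Proof.
by case/and5P=> _ /eqP hs _ _ _ hv; exists (index v o.2); rewrite ?nth_index // -hs index_mem.
Qed.

Lemma gs_ge : 20 <= gs. Proof. by rewrite /gs; lia. Qed.

Lemma touch_mem o o' a b : occ o -> occ o' -> a < gs -> b < gs ->
  (o.[a] == o'.[b]) || adj o.[a] o'.[b] -> touch o o'.
Proof.
move=> h h' ha hb hab; apply/hasP; exists o.[a]; first exact: occ_mem.
by apply/hasP; exists o'.[b] => //; apply: occ_mem.
Qed.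

Lemma touch_refl o : occ o -> touch o o.
Proof. by move=> h; apply: (@touch_mem _ _ 0 0) => //; rewrite ?eqxx. Qed.

Lemma eqoE o o' p : eqo o o' -> 10 <= p < gs -> o.[p] = o'.[p].
Proof.
move=> /andP[_ /allP h] hp; apply/eqP; apply: h; rewrite mem_iota subnKC //.
Qed.

End OneGraph.

(** * Violations under order-preserving embeddings *)

Section Transport.
Variables (n1 n2 : nat) (adj1 adj2 : nat -> nat -> bool) (pos1 pos2 : nat -> nat)
  (X : seq nat) (h : nat -> nat).
Hypothesis h_lt : forall u, u \in X -> h u < n2.
Hypothesis h_inj : forall u v, u \in X -> v \in X -> h u = h v -> u = v.
Hypothesis h_adj : forall u v, u \in X -> v \in X -> adj1 u v -> adj2 (h u) (h v).
Hypothesis h_pos : forall u v, u \in X -> v \in X -> (pos1 u < pos1 v) = (pos2 (h u) < pos2 (h v)).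

Definition mapo (o : obj) : obj := (o.1, map h o.2).

Lemma mapoE o a : occ n1 adj1 o -> a < gs -> (mapo o).[a] = h o.[a].
Proof. by case/and5P=> _ /eqP hs _ _ _ ha; rewrite (nth_map 0) // hs. Qed.

Lemma mapo_occ o : occ n1 adj1 o -> {subset o.2 <= X} -> occ n2 adj2 (mapo o).
Proof.
move=> ho hX; case/and5P: (ho) => h1 /eqP h2 h3 h4 h5; apply/and5P; split=> //.
- by rewrite size_map h2.
- by apply/allP => v /mapP[u hu ->]; apply: h_lt; apply: hX.
- by rewrite map_inj_in_uniq // => u v hu hv; apply: h_inj; apply: hX.
- apply/allP => a; rewrite mem_iota => /andP[_ ha]; apply/allP => b; rewrite mem_iota => /andP[_ hb].
  apply/implyP => hK; rewrite !mapoE //; apply: h_adj; try (by apply: hX; apply: occ_mem ho _).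
  exact: occ_K ho ha hb hK.
Qed.

Lemma mapo_touch o o' : {subset o.2 <= X} -> {subset o'.2 <= X} -> touch adj1 o o' ->
  touch adj2 (mapo o) (mapo o').
Proof.
move=> hX hX' /hasP[u hu /hasP[v hv huv]]; apply/hasP; exists (h u); first exact: map_f.
apply/hasP; exists (h v); first exact: map_f.
case/orP: huv => [/eqP ->|huv]; rewrite ?eqxx //.
by rewrite h_adj ?orbT //; [apply: hX|apply: hX'].
Qed.

Lemma mapo_st o : occ n1 adj1 o -> {subset o.2 <= X} -> st pos2 (mapo o) = st pos1 o.
Proof.
move=> ho hX; rewrite /st; congr nth; apply: eq_in_find => i; rewrite mem_iota add0n => /andP[_ hi].
by rewrite !mapoE // -?h_pos //; try apply: hX; try apply: occ_mem ho _; rewrite /gs; lia.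
Qed.

(** Adjacency enters a violation only positively; inequalities survive by injectivity and states by
    preservation of the order. So violations are inherited along containment that is not induced. *)
Lemma mapo_viol o1 o2 o3 o4 o5 :
  {subset o1.2 <= X} -> {subset o2.2 <= X} -> {subset o3.2 <= X} -> {subset o4.2 <= X} ->
  {subset o5.2 <= X} ->
  occs n1 adj1 o1 o2 o3 o4 o5 && (sviol adj1 o1 o2 o3 o4 o5 || oviol adj1 pos1 o1 o2 o3) ->
  viol n2 adj2 pos2.
Proof.
move=> X1 X2 X3 X4 X5 /andP[/andP[/and5P[w1 w2 w3 w4 w5] /and4P[t1 t2 t3 t4]] hv].
exists (mapo o1), (mapo o2), (mapo o3), (mapo o4), (mapo o5).
have g20 := gs_ge.
have hne o o' : occ n1 adj1 o -> occ n1 adj1 o' -> {subset o.2 <= X} -> {subset o'.2 <= X} ->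
    forall a b, a < gs -> b < gs -> o.[a] != o'.[b] -> (mapo o).[a] != (mapo o').[b].
  move=> ho ho' hX hX' a b ha hb; apply: contra => /eqP; rewrite !mapoE // => e.
  by apply/eqP; apply: h_inj e; [apply: hX|apply: hX']; apply: occ_mem ho _ || apply: occ_mem ho' _.
have had o o' : occ n1 adj1 o -> occ n1 adj1 o' -> {subset o.2 <= X} -> {subset o'.2 <= X} ->
    forall a b, a < gs -> b < gs -> adj1 o.[a] o'.[b] -> adj2 (mapo o).[a] (mapo o').[b].
  move=> ho ho' hX hX' a b ha hb; rewrite !mapoE //.
  by apply: h_adj; [apply: hX|apply: hX']; apply: occ_mem ho _ || apply: occ_mem ho' _.
rewrite /occs !mapo_occ // !mapo_touch //=; apply/orP; case/orP: hv => hv; [left|right].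
  rewrite /sviol; case/or4P: hv.
  - case/andP=> /hasP[u hu hu'] hn; apply/or4P/Or41/andP; split.
      by apply/hasP; exists (h u); apply: map_f.
    apply: contra hn => /andP[hh1 /allP hh]; apply/andP; split=> //; apply/allP => p hp.
    have hp' : p < gs by move: hp; rewrite mem_iota; lia.
    by apply/negPn/negP => hne'; have /negP := hne _ _ w1 w2 X1 X2 _ _ hp' hp' hne'; apply; apply: hh.
  - case/and3P=> k1 k2 k3; apply/or4P/Or42/and3P; split; [apply: had|apply: had|apply: hne] => //; lia.
  - case/and3P=> k1 k2 k3; apply/or4P/Or43/and3P; split; [apply: had|apply: had|apply: hne] => //; lia.
  - case/and5P=> k1 k2 k3 k4 k5; apply/or4P/Or44/and5P; split;
      [apply: had|apply: had|apply: had|apply: had|apply: hne] => //; lia.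
have hl : lft adj1 o2 o1 -> lft adj2 (mapo o2) (mapo o1) by apply: had => //; lia.
have hu : up adj1 o2 o3 -> up adj2 (mapo o2) (mapo o3) by apply: had => //; lia.
move: hv; rewrite /oviol /= !mapo_st //.
by case: (o2.1) => [|[|[|[|[|[|m]]]]]] //; [..|case/and3P=> /hl -> /hu -> ->] => // /andP[];
  do ? [move=> /hl -> -> | move=> /hu -> ->].
Qed.

End Transport.
End Patterns.

Definition adjn (n : nat) (bs : seq bool) (u v : nat) : bool := nth false bs (u * n + v).

Definition posn n (pos : {perm 'I_n}) (u : nat) : nat :=
  if insub u is Some i then nat_of_ord (pos i) else 0.

Lemma posnE n (pos : {perm 'I_n}) (i : 'I_n) : posn pos i = pos i.
Proof. by rewrite /posn valK. Qed.

Lemma adjn_sym n bs u v : wf_graph n bs -> u < n -> v < n -> adjn n bs u v = adjn n bs v u.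
Proof. by move=> [_ [h _]] hu hv; apply: (h (Ordinal hu) (Ordinal hv)). Qed.

Lemma adjn_irr n bs u : wf_graph n bs -> u < n -> adjn n bs u u = false.
Proof. by move=> [_ [_ h]] hu; apply: (h (Ordinal hu)). Qed.

Lemma nth_mkseq2 (f : nat -> bool) m i j : i < m -> j < m ->
  nth false (mkseq f (m * m)) (i * m + j) = f (i * m + j).
Proof.
move=> hi hj; rewrite nth_mkseq //; apply: (@leq_trans (i.+1 * m)); first by rewrite mulSn; lia.
by rewrite leq_mul2r hi orbT.
Qed.

Lemma divn_pair m i j : j < m -> (i * m + j) %/ m = i.
Proof. by move=> hj; rewrite divnMDl ?(divn_small hj) ?addn0 //; lia. Qed.

Lemma modn_pair m i j : j < m -> (i * m + j) %% m = j.
Proof. by move=> hj; rewrite modnMDl modn_small. Qed.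

(** * The forbidden family *)

Section Family.
Variables (W : finType) (rootW : W) (topOK : nat -> W -> W -> bool) (leftW : W -> W)
  (innW : W -> W -> W) (rej : W -> bool).
Notation viol := (viol rootW topOK leftW innW rej).
Notation gs := (gs W).

Definition ffs : seq ograph :=
  [seq F <- flatten [seq [seq (m, tval t) | t <- enum {: (m * m).-tuple bool}]
                    | m <- iota 0 (5 * gs).+1]
  | asb (wf_ograph F /\ connected_ograph F /\ viol F.1 (adjn F.1 F.2) id)].

Lemma ffs_wf F : F \in ffs -> wf_ograph F /\ connected_ograph F.
Proof. by rewrite mem_filter => /andP[/asbP[h1 [h2 _]] _]. Qed.

Lemma mem_ffs m bs : m <= 5 * gs -> wf_graph m bs -> connected_ograph (m, bs) ->
  viol m (adjn m bs) id -> (m, bs) \in ffs.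
Proof.
move=> hm hw hc hv; rewrite mem_filter; apply/andP; split; first by apply/asbP.
apply/flattenP; exists [seq (m, tval t) | t <- enum {: (m * m).-tuple bool}].
  by apply/mapP; exists m => //; rewrite mem_iota; lia.
have hs : size bs == m * m by rewrite hw.1.
by apply/mapP; exists (Tuple hs); rewrite ?mem_enum.
Qed.

Lemma contains_viol n bs (pos : {perm 'I_n}) F : F \in ffs ->
  contains_ordered bs pos F -> viol n (adjn n bs) (posn pos).
Proof.
rewrite mem_filter => /andP[/asbP[_ [_ [o1 [o2 [o3 [o4 [o5 hv]]]]]]] _] [phi [h1 h2]].
pose h u := if insub u is Some i then nat_of_ord (phi i) else 0.
have hE (i : 'I_F.1) : h i = phi i by rewrite /h valK.
have hX u : u \in iota 0 F.1 -> exists i : 'I_F.1, u = i.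
  by rewrite mem_iota => /andP[_ hu]; exists (Ordinal hu).
case/andP: (hv) => /andP[/and5P[w1 w2 w3 w4 w5] _] _.
have hsub o : occ W F.1 (adjn F.1 F.2) o -> {subset o.2 <= iota 0 F.1}.
  by case/and5P=> _ _ /allP hh _ _ u /hh hu; rewrite mem_iota.
apply: (@mapo_viol W rootW topOK leftW innW rej F.1 n (adjn F.1 F.2) (adjn n bs) id (posn pos)
  (iota 0 F.1) h _ _ _ _ o1 o2 o3 o4 o5); try exact: hsub; last exact: hv.
- by move=> u /hX[i ->]; rewrite hE.
- move=> u v /hX[i ->] /hX[j ->]; rewrite !hE => e.
  have {e}e : pos (phi i) = pos (phi j) by congr (pos _); apply: val_inj.
  case: (ltngtP i j) => // /h1; rewrite e; lia.
- by move=> u v /hX[i ->] /hX[j ->]; rewrite !hE; apply: h2.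
- move=> u v /hX[i ->] /hX[j ->]; rewrite !hE !posnE /=.
  case: (ltngtP i j) => hij; first by rewrite h1.
    by apply/esym; apply/negbTE; rewrite -leqNgt ltnW // h1.
  by move/val_inj: hij => ->; rewrite ltnn.
Qed.

(** The subgraph induced on the vertices of the five cells, renumbered by position, is itself a
    member of the family. *)
Lemma viol_contains n bs (pos : {perm 'I_n}) : wf_graph n bs ->
  viol n (adjn n bs) (posn pos) -> exists2 F, F \in ffs & contains_ordered bs pos F.
Proof.
move=> hw [o1 [o2 [o3 [o4 [o5 hv]]]]].
case/andP: (hv) => /andP[/and5P[w1 w2 w3 w4 w5] /and4P[t1 t2 t3 t4]] _.
pose X := o1.2 ++ o2.2 ++ o3.2 ++ o4.2 ++ o5.2.
pose le u v := posn pos u <= posn pos v.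
have hsz o : occ W n (adjn n bs) o -> size o.2 = gs by case/and5P=> _ /eqP.
have hlt o : occ W n (adjn n bs) o -> forall u, u \in o.2 -> u < n.
  by case/and5P=> _ _ /allP.
have hXn u : u \in X -> u < n.
  by rewrite !mem_cat => /or4P[|||/orP[]]; apply: hlt.
have hXs : size X <= 5 * gs by rewrite !size_cat !hsz // !mulSn mul0n addn0.
have [S [uS hS hso hm]] : exists S, [/\ uniq S, S =i X, sorted le S & size S <= 5 * gs].
  exists (sort le (undup X)); split.
  - by rewrite sort_uniq undup_uniq.
  - by move=> u; rewrite mem_sort mem_undup.
  - by apply: sort_sorted => a b; apply: leq_total.
  - by rewrite size_sort; apply: leq_trans (size_undup _) hXs.
move Em : (size S) hm => m hm.
have Sn i : i < m -> nth 0 S i < n by move=> hi; apply: hXn; rewrite -hS mem_nth // Em.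
have posn_inj u v : u < n -> v < n -> posn pos u = posn pos v -> u = v.
  move=> hu hv'; rewrite -[u]/(val (Ordinal hu)) -[v]/(val (Ordinal hv')) !posnE.
  by move=> /val_inj /perm_inj ->.
have Slt i j : i < j -> j < m -> posn pos (nth 0 S i) < posn pos (nth 0 S j).
  move=> hij hj; rewrite ltn_neqAle; apply/andP; split.
    apply/eqP => /posn_inj e; have /eqP := e (Sn _ (ltn_trans hij hj)) (Sn _ hj).
    by rewrite nth_uniq ?Em //; [rewrite ltn_eqF|apply: ltn_trans hij hj].
  have htr : transitive le by move=> a b c; apply: leq_trans.
  by apply: (sorted_ltn_nth htr 0 hso); rewrite ?inE ?Em //; apply: ltn_trans hij hj.
pose bF := mkseq (fun i => adjn n bs (nth 0 S (i %/ m)) (nth 0 S (i %% m))) (m * m).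
have bFE i j : i < m -> j < m -> adjn m bF i j = adjn n bs (nth 0 S i) (nth 0 S j).
  by move=> hi hj; rewrite {1}/adjn /bF nth_mkseq2 // divn_pair // modn_pair.
have wF : wf_graph m bF.
  split; first by rewrite size_mkseq.
  split=> [i j|i]; rewrite /gadj -!/(adjn _ _ _ _) !bFE //.
    by apply: adjn_sym => //; apply: Sn.
  by apply: adjn_irr => //; apply: Sn.
have idx u : u \in X -> index u S < m by rewrite -hS -index_mem Em.
have nidx u : u \in X -> nth 0 S (index u S) = u by rewrite -hS; apply: nth_index.
exists (m, bF); last first.
  exists (fun i : 'I_m => Ordinal (Sn i (ltn_ord i))); split=> [i j hij|i j] /=.
    by rewrite -!posnE /=; apply: Slt.
  by rewrite /gadj -!/(adjn _ _ _ _) bFE.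
have sub1 : {subset o1.2 <= X} by move=> u hu; rewrite /X !mem_cat hu.
have sub2 : {subset o2.2 <= X} by move=> u hu; rewrite /X !mem_cat hu ?orbT.
have sub3 : {subset o3.2 <= X} by move=> u hu; rewrite /X !mem_cat hu ?orbT.
have sub4 : {subset o4.2 <= X} by move=> u hu; rewrite /X !mem_cat hu ?orbT.
have sub5 : {subset o5.2 <= X} by move=> u hu; rewrite /X !mem_cat hu ?orbT.
apply: mem_ffs => //; last first.
  apply: (@mapo_viol W rootW topOK leftW innW rej n m (adjn n bs) (adjn m bF) (posn pos) id
    X (index^~ S) _ _ _ _ o1 o2 o3 o4 o5) => //.
  - by move=> u v hu hv' e; rewrite -(nidx u) // e nidx.
  - by move=> u v hu hv'; rewrite bFE ?idx // !nidx.
  - move=> u v hu hv' /=; rewrite -{1}(nidx u) // -{1}(nidx v) //.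
    case: (ltngtP (index u S) (index v S)) => h; first by rewrite Slt // idx.
      by apply/negbTE; rewrite -leqNgt ltnW // Slt // idx.
    by rewrite h ltnn.
have g0 : 0 < gs by apply: leq_trans (gs_ge W).
pose a0 := o1.[0].
have ha0 : a0 \in X by apply: sub1; apply: occ_mem w1 g0.
split; first by apply: leq_ltn_trans (idx _ ha0).
(* Connectedness of the pattern: two vertices of one cell have a common neighbour by [K_common], and
   consecutive cells touch. *)
pose R u v := forall i j : 'I_m, nth 0 S i = u -> nth 0 S j = v -> connect (gadj bF) i j.
have Rtr u v w : v \in X -> R u v -> R v w -> R u w.
  move=> hvX h1 h2 i j hi hj; apply: (@connect_trans _ _ (Ordinal (idx _ hvX))).
    by apply: h1 => //; apply: nidx.
  by apply: h2 => //; apply: nidx.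
have Rid u : R u u.
  move=> i j hi hj; suff -> : i = j by apply: connect0.
  by apply: val_inj; apply/eqP; rewrite -(nth_uniq 0 _ _ uS) ?Em //= hi hj.
have Radj u v : adjn n bs u v -> R u v.
  move=> h i j hi hj; apply: connect1; rewrite /gadj -/(adjn _ _ _ _) bFE //.
  by rewrite hi hj.
have asym u v : u \in X -> v \in X -> adjn n bs u v -> adjn n bs v u.
  by move=> hu hv' h; rewrite adjn_sym //; apply: hXn.
have Robj o : occ W n (adjn n bs) o -> {subset o.2 <= X} ->
    forall u v, u \in o.2 -> v \in o.2 -> R u v.
  move=> ho hX u v hu hv'; have [a ha <-] := occ_index ho hu; have [b hb <-] := occ_index ho hv'.
  have [c [hc k1 k2]] : exists c, [/\ c < gs, K o.1 a c & K o.1 b c].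
    by apply: K_common => //; case/and5P: ho.
  have hcX : o.[c] \in X by apply: hX; apply: occ_mem ho hc.
  apply: (Rtr _ o.[c]) => //; apply: Radj; first exact: occ_K ho ha hc k1.
  apply: asym => //; first by apply: hX; apply: occ_mem ho hb.
  exact: occ_K ho hb hc k2.
pose linked (o : nat * seq nat) := forall u, u \in o.2 -> R u a0 /\ R a0 u.
have l1 : linked o1.
  by move=> u hu; split; apply: (Robj o1) => //; apply: occ_mem w1 g0.
have step o o' : linked o -> {subset o.2 <= X} -> occ W n (adjn n bs) o' -> {subset o'.2 <= X} ->
    touch (adjn n bs) o o' -> linked o'.
  move=> hl hX ho' hX' /hasP[u hu /hasP[v hv' huv]] x hx.
  have [k1 k2] := hl u hu.
  have [k3 k4] : R u v /\ R v u.
    case/orP: huv => [/eqP ->|huv]; first by split; apply: Rid.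
    by split; apply: Radj => //; apply: asym => //; [apply: hX|apply: hX'].
  have k5 := Robj _ ho' hX' _ _ hx hv'; have k6 := Robj _ ho' hX' _ _ hv' hx.
  have huX := hX _ hu; have hvX := hX' _ hv'.
  split; first by apply: (Rtr _ v) => //; apply: (Rtr _ u).
  by apply: (Rtr _ v) => //; apply: (Rtr _ u).
have l2 := step _ _ l1 sub1 w2 sub2 t1.
have l3 := step _ _ l2 sub2 w3 sub3 t2.
have l4 := step _ _ l3 sub3 w4 sub4 t3.
have l5 := step _ _ l4 sub4 w5 sub5 t4.
have lX u : u \in X -> R u a0 /\ R a0 u.
  by rewrite !mem_cat => /or4P[/l1|/l2|/l3|/orP[/l4|/l5]].
move=> i j; have hi : nth 0 S i \in X by rewrite -hS mem_nth ?Em.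
have hj : nth 0 S j \in X by rewrite -hS mem_nth ?Em.
by apply: (Rtr _ a0 _ ha0 (lX _ hi).1 (lX _ hj).2).
Qed.

Lemma code_inj n bs n' bs' :
  nseq n true ++ false :: bs = nseq n' true ++ false :: bs' -> n = n' /\ bs = bs'.
Proof.
by elim: n n' => [|n IH] [|n'] //= [] => [->|/IH[-> ->]].
Qed.

Lemma FFO_viol x n bs : graph_code x n bs ->
  (FFO ffs x <-> exists pos : {perm 'I_n}, ~ viol n (adjn n bs) (posn pos)).
Proof.
move=> [hw hx]; split.
  move=> [n' [bs' [[hw' hx'] [pos hpos]]]].
  have [en eb] : n = n' /\ bs = bs' by apply: code_inj; rewrite -hx.
  subst n' bs'; exists pos => /(viol_contains hw) [F hF hc]; exact: hpos hF hc.
move=> [pos hpos]; exists n, bs; split=> //; exists pos => F hF hc.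
by apply: hpos; apply: contains_viol hF hc.
Qed.

End Family.

(** * Complete grids and the uniqueness of coordinates *)

Section Grid.
Variables (W : finType) (n : nat) (adj : nat -> nat -> bool).
Notation occ := (occ W n adj).
Notation lft := (lft adj).
Notation up := (up adj).
Notation gs := (gs W).

(* grid o t s: the cell o lies in row t and column |s|, all its ancestors being present;
   s lists the labels and anchors of the top cells of the columns 1 .. |s|, the last first. *)
Inductive grid : obj -> nat -> seq (nat * nat) -> Prop :=
| GRoot o : occ o -> o.1 = 0 -> grid o 0 [::]
| GTop o d s : occ o -> 1 <= o.1 <= 4 -> grid d 0 s -> lft o d ->
    grid o 0 ((o.1, o.[10]) :: s)
| GLeft o e t : occ o -> o.1 = 5 -> grid e t [::] -> up o e -> grid o t.+1 [::]
| GInn o d e t x s : occ o -> 6 <= o.1 -> grid d t.+1 s -> grid e t (x :: s) ->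
    lft o d -> up o e -> grid o t.+1 (x :: s).

Lemma grid_occ o t s : grid o t s -> occ o.
Proof. by case. Qed.

Lemma grid_up o t s : grid o t.+1 s -> exists2 e, up o e & grid e t s.
Proof.
move E : t.+1 => t' h; case: h E => // [o' e t0 _ _ he hu [->]|o' d e t0 x s' _ _ _ he _ hu [->]];
  by exists e.
Qed.

Lemma grid_lft o t x s : grid o t (x :: s) -> exists2 d, lft o d & grid d t s.
Proof.
move E : (x :: s) => s' h; case: h E => // [o' d s0 _ _ hd hl [_ ->]|o' d e t0 x0 s0 _ _ hd _ hl _ [_ ->]];
  by exists d.
Qed.

Lemma grid_inv o t s : grid o t s ->
  [/\ o.1 = 0 -> t = 0 /\ s = [::],
      1 <= o.1 <= 4 -> t = 0 /\ exists s', s = (o.1, o.[10]) :: s',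
      o.1 = 5 -> s = [::] /\ exists t', t = t'.+1
    & 6 <= o.1 -> exists t' x s', t = t'.+1 /\ s = x :: s'].
Proof.
case=> {o t s} [o _ ->|o d s _ h _ _|o e t _ -> _ _|o d e t x s _ h _ _ _ _]; split=> //.
- by move=> e1; move: h; rewrite e1.
- by move=> _; split=> //; exists s.
- by move=> e1; move: h; rewrite e1.
- by move=> h'; case/andP: h => _ h; have := leq_trans h' h.
- by move=> _; split=> //; exists t.
- by move=> e1; move: h; rewrite e1.
- by case/andP=> _ h'; have := leq_trans h h'.
- by move=> e1; move: h; rewrite e1.
- by move=> _; exists t, x, s.
Qed.

Hypothesis ok : struct_ok W n adj.

Let g20 : 20 <= gs := gs_ge W.
Let g10 : 10 < gs := leq_trans (isT : 10 < 20) g20.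
Let g11 : 11 < gs := leq_trans (isT : 11 < 20) g20.
Let g12 : 12 < gs := leq_trans (isT : 12 < 20) g20.
Let g13 : 13 < gs := leq_trans (isT : 13 < 20) g20.

Lemma struct_share o o' v : occ o -> occ o' -> v \in o.2 -> v \in o'.2 -> eqo W o o'.
Proof.
move=> h h' hv hv'; have := ok (o1 := o) (o2 := o') (o3 := o') (o4 := o') (o5 := o').
rewrite /occs h h' !(touch_refl h') !andbT.
have -> : touch adj o o'.
  by apply/hasP; exists v => //; apply/hasP; exists v; rewrite // eqxx.
move=> /(_ isT); rewrite /sviol !negb_or => /andP[/negP h1 _].
by apply/negPn/negP => hn; apply: h1; rewrite hn andbT; apply/hasP; exists v.
Qed.

Lemma anchor_eqo o o' : occ o -> occ o' -> o.[10] = o'.[10] -> eqo W o o'.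
Proof.
move=> h h' e; apply: (struct_share h h' (v := o.[10])); first exact: occ_mem h g10.
by rewrite e; apply: occ_mem h' g10.
Qed.

Lemma touch_lft o d : occ o -> occ d -> lft o d -> touch adj o d.
Proof. by move=> h h' hl; apply: (touch_mem h h' g10 g11); rewrite [adj _ _]hl orbT. Qed.
Lemma touch_up o d : occ o -> occ d -> up o d -> touch adj o d.
Proof. by move=> h h' hl; apply: (touch_mem h h' g12 g13); rewrite [adj _ _]hl orbT. Qed.

Hypothesis adj_sym : forall u v, u < n -> v < n -> adj u v = adj v u.

Lemma touch_sym o o' : occ o -> occ o' -> touch adj o o' -> touch adj o' o.
Proof.
move=> h h' /hasP[u hu /hasP[v hv huv]]; apply/hasP; exists v => //; apply/hasP; exists u => //.
case/and5P: h => _ _ /allP h _ _; case/and5P: h' => _ _ /allP h' _ _.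
by rewrite eq_sym -adj_sym //; [apply: h|apply: h'].
Qed.

Lemma lft_fun o d d' : occ o -> occ d -> occ d' -> lft o d -> lft o d' -> d.[10] = d'.[10].
Proof.
move=> h h1 h2 l1 l2; have := ok (o1 := d) (o2 := o) (o3 := d') (o4 := d') (o5 := d').
rewrite /occs h h1 h2 !(touch_refl h2) (touch_lft h h2 l2) (touch_sym h h1 (touch_lft h h1 l1)).
by move=> /(_ isT); rewrite /sviol !negb_or l1 l2 /= negbK => /and4P[_ /eqP].
Qed.

Lemma up_fun o d d' : occ o -> occ d -> occ d' -> up o d -> up o d' -> d.[10] = d'.[10].
Proof.
move=> h h1 h2 l1 l2; have := ok (o1 := d) (o2 := o) (o3 := d') (o4 := d') (o5 := d').
rewrite /occs h h1 h2 !(touch_refl h2) (touch_up h h2 l2) (touch_sym h h1 (touch_up h h1 l1)).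
by move=> /(_ isT); rewrite /sviol !negb_or l1 l2 /= negbK => /and4P[_ _ /eqP].
Qed.

Lemma square c d e f f' : occ c -> occ d -> occ e -> occ f -> occ f' ->
  lft c d -> up c e -> up d f -> lft e f' -> f.[10] = f'.[10].
Proof.
move=> hc hd he hf hf' l1 u1 u2 l2; have := ok (o1 := f) (o2 := d) (o3 := c) (o4 := e) (o5 := f').
rewrite /occs hc hd he hf hf' (touch_up hc he u1) (touch_lft he hf' l2).
rewrite (touch_sym hd hf (touch_up hd hf u2)) (touch_sym hc hd (touch_lft hc hd l1)).
by move=> /(_ isT); rewrite /sviol !negb_or u2 l1 u1 l2 /= negbK => /and4P[_ _ _ /eqP].
Qed.

Lemma eqo_lft o o' d : eqo W o o' -> lft o d = lft o' d.
Proof. by move=> h; rewrite /lft (eqoE h (p := 10)). Qed.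
Lemma eqo_up o o' d : eqo W o o' -> up o d = up o' d.
Proof. by move=> h; rewrite /up (eqoE h (p := 12)). Qed.

(** The label of a cell tells which constructor built it, and links are functional, so both
    derivations run through the same neighbours. For an inner cell the upper neighbour alone
    determines the coordinates. *)
Lemma grid_fun o t s : grid o t s -> forall o' t' s', grid o' t' s' -> o.[10] = o'.[10] ->
  t = t' /\ s = s'.
Proof.
elim=> {o t s} [o ho e0|o d s ho hl hd IHd hld|o e t ho h5 he IHe hu|o d e t x s ho h6 hd IHd he IHe hld hu]
  o' t' s' h' ea; have ho' := grid_occ h'; have heq := anchor_eqo ho ho' ea;
  have el : o.1 = o'.1 by case/andP: heq => /eqP.
- have [h0 _ _ _] := grid_inv h'; by case: h0 => [|-> ->]; rewrite -?el.
- have [_ h0 _ _] := grid_inv h'; rewrite -el in h0.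
  have [-> [s1 e1]] := h0 hl; rewrite e1 in h' *; split=> //; rewrite ea.
  have [d' hd' hg'] := grid_lft h'; rewrite -(eqo_lft _ heq) in hd'.
  have [_ ->] := IHd _ _ _ hg' (lft_fun ho (grid_occ hd) (grid_occ hg') hld hd').
  by rewrite -ea.
- have [_ _ h0 _] := grid_inv h'; rewrite -el in h0.
  have [e1 [t1 e2]] := h0 h5; rewrite e1 e2 in h' *; split=> //.
  have [e' he' hg'] := grid_up h'; rewrite -(eqo_up _ heq) in he'.
  by have [-> _] := IHe _ _ _ hg' (up_fun ho (grid_occ he) (grid_occ hg') hu he').
- have [_ _ _ h0] := grid_inv h'; rewrite -el in h0.
  have [t1 [x1 [s1 [e1 e2]]]] := h0 h6; rewrite e1 e2 in h' *.
  have [e' he' hg'] := grid_up h'; rewrite -(eqo_up _ heq) in he'.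
  by have [-> ->] := IHe _ _ _ hg' (up_fun ho (grid_occ he) (grid_occ hg') hu he').
Qed.

(** The two neighbours lie in grids that need not be related a priori. The cell above the left one
    and the cell left of the upper one coincide by the square condition, and uniqueness of
    coordinates aligns the grids; [s2 <> [::]] provides the second of these cells. *)
Lemma grid_square c d e t1 s1 t2 s2 : occ c -> lft c d -> up c e ->
  grid d t1.+1 s1 -> grid e t2 s2 -> s2 <> [::] -> t1 = t2 /\ exists x, s2 = x :: s1.
Proof.
move=> hc hl hu hd he; case: s2 he => // x s2 he _.
have [f hf gf] := grid_up hd; have [f' hf' gf'] := grid_lft he.
have e0 := square hc (grid_occ hd) (grid_occ he) (grid_occ gf) (grid_occ gf') hl hu hf hf'.
by have [-> ->] := grid_fun gf gf' e0; split=> //; exists x.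
Qed.

End Grid.

(** * Orderings that realize prescribed states *)

Section Realize.
Variables (W : finType) (rootW : W) (n : nat) (adj : nat -> nat -> bool) (wa : nat -> W).
Hypothesis ok : struct_ok W n adj.
Notation occ := (occ W n adj).
Notation gs := (gs W).
Notation nW := (nW W).

Definition inverted (o : obj) j := j == index (wa o.[10]) (enum W).
(** Starting from the natural order of the vertices, the two members of a private pair are exchanged
    when their order is wrong for the wanted state. Cells that share a vertex agree on their pairs
    and anchor, so these exchanges are disjoint transpositions. *)
Definition swaps u v := exists o j, [/\ occ o, j < nW,
  (u = o.[14 + 2 * j] /\ v = o.[15 + 2 * j]) \/ (u = o.[15 + 2 * j] /\ v = o.[14 + 2 * j])
  & (o.[15 + 2 * j] < o.[14 + 2 * j]) != inverted o j].

Lemma pair_gs j b : j < nW -> b <= 1 -> 10 <= 14 + b + 2 * j < gs.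
Proof. rewrite /gs; lia. Qed.

Lemma pair_fun o o' j j' b b' : occ o -> occ o' -> j < nW -> j' < nW -> b <= 1 -> b' <= 1 ->
  o.[14 + b + 2 * j] = o'.[14 + b' + 2 * j'] -> [/\ j = j', b = b' & eqo W o o'].
Proof.
move=> ho ho' hj hj' hb hb' e.
have k1 := pair_gs hj hb; have k2 := pair_gs hj' hb'.
have heq : eqo W o o'.
  apply: (struct_share ok ho ho' (v := o.[14 + b + 2 * j])); first by apply: occ_mem ho _; lia.
  by rewrite e; apply: occ_mem ho' _; lia.
have e2 : 14 + b + 2 * j = 14 + b' + 2 * j'.
  by apply: (occ_inj ho'); [lia|lia|]; rewrite -e (eqoE heq).
by split=> //; lia.
Qed.

Lemma eqo_inverted o o' j : eqo W o o' -> inverted o j = inverted o' j.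
Proof. by move=> h; rewrite /inverted (eqoE h (p := 10)) //= /gs; lia. Qed.

Lemma swaps_pair o j b v : occ o -> j < nW -> b <= 1 -> swaps o.[14 + b + 2 * j] v ->
  v = o.[14 + (1 - b) + 2 * j] /\ ((o.[15 + 2 * j] < o.[14 + 2 * j]) != inverted o j).
Proof.
move=> ho hj hb [o' [j' [ho' hj' huv hne]]].
have K b' : b' <= 1 -> o.[14 + b + 2 * j] = o'.[14 + b' + 2 * j'] ->
    v = o'.[14 + (1 - b') + 2 * j'] ->
    v = o.[14 + (1 - b) + 2 * j] /\ ((o.[15 + 2 * j] < o.[14 + 2 * j]) != inverted o j).
  move=> hb' e ev; have [ej eb heq] := pair_fun ho ho' hj hj' hb hb' e.
  subst j' b'; rewrite (eqoE heq (pair_gs hj (leq_subr _ _ : 1 - b <= 1))) ev; split=> //.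
  rewrite (eqo_inverted _ heq).
  have := eqoE heq (pair_gs hj (leqnn 1)); rewrite -[14 + 1]/15 => ->.
  by have := eqoE heq (pair_gs hj (leq0n 1)); rewrite -[14 + 0]/14 => ->.
by case: huv => -[e1 e2]; [apply: (K 0)|apply: (K 1)].
Qed.

Lemma swaps_sym u v : swaps u v -> swaps v u.
Proof.
move=> [o [j [h1 h2 h3 h4]]]; exists o, j; split=> //.
by case: h3 => -[-> ->]; [right|left].
Qed.

Lemma swaps_fun u v v' : swaps u v -> swaps u v' -> v = v'.
Proof.
move=> h; case: (h) => o [j [h1 h2 h3 h4]]; case: h3 => -[e1 e2] h'; subst u v.
  by have [-> _] := @swaps_pair o j 0 v' h1 h2 isT h'.
by have [-> _] := @swaps_pair o j 1 v' h1 h2 isT h'.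
Qed.

Lemma swaps_lt u v : swaps u v -> v < n.
Proof.
move=> [o [j [h1 h2 h3 h4]]]; have := pair_gs h2 (leqnn 1); have := pair_gs h2 (leq0n 1).
by case: h3 => -[_ ->] k1 k2; apply: (occ_lt h1); lia.
Qed.

Definition swapf u := epsilon (inhabits 0) (fun v => swaps u v \/ (~ (exists w, swaps u w) /\ v = u)).

Lemma swapfP u : swaps u (swapf u) \/ (~ (exists w, swaps u w) /\ swapf u = u).
Proof.
apply: (epsilon_spec (inhabits 0) (fun v => swaps u v \/ (~ (exists w, swaps u w) /\ v = u))).
by case: (excluded_middle_informative (exists w, swaps u w)) => [[w h]|h]; [exists w; left|exists u; right].
Qed.

Lemma swapfE u v : swaps u v -> swapf u = v.
Proof.
by move=> h; case: (swapfP u) => [h'|[h' _]]; [apply: swaps_fun h' h|case: h'; exists v].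
Qed.

Lemma swapfK : involutive swapf.
Proof.
move=> u; case: (swapfP u) => [h|[h e]]; first exact: swapfE (swaps_sym h).
by rewrite e.
Qed.

Lemma swapf_lt u : u < n -> swapf u < n.
Proof. by move=> hu; case: (swapfP u) => [/swaps_lt|[_ ->]]. Qed.

Lemma swapf_inj : injective (fun i : 'I_n => Ordinal (swapf_lt (ltn_ord i))).
Proof. by move=> i j [/(inv_inj swapfK)] e; apply: val_inj. Qed.

Definition swap_perm : {perm 'I_n} := perm swapf_inj.

Lemma posn_swap u : u < n -> posn swap_perm u = swapf u.
Proof. by move=> hu; rewrite -[u]/(val (Ordinal hu)) posnE permE. Qed.

Lemma st_swap o : occ o -> st rootW (posn swap_perm) o = wa o.[10].
Proof.
move=> ho; rewrite /st; set w := wa _.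
have hw : index w (enum W) < nW by rewrite /nW cardT index_mem mem_enum.
rewrite (_ : find _ _ = index w (enum W)) ?nth_index ?mem_enum //.
apply: etrans (eq_in_find (a2 := pred1 (index w (enum W))) _) _.
  move=> j; rewrite mem_iota add0n => /andP[_ hj] /=.
  have k0 := pair_gs hj (leq0n 1); have k1 := pair_gs hj (leqnn 1).
  rewrite -[14 + 0]/14 in k0; rewrite -[14 + 1]/15 in k1.
  rewrite !posn_swap; [|by apply: (occ_lt ho); lia..].
  have hd : o.[14 + 2 * j] != o.[15 + 2 * j].
    by apply/eqP => e; have := occ_inj ho _ _ e; lia.
  rewrite -/(inverted o j).
  case E : ((o.[15 + 2 * j] < o.[14 + 2 * j]) != inverted o j).
    have hs : swaps o.[14 + 2 * j] o.[15 + 2 * j] by exists o, j; split=> //; left.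
    rewrite (swapfE hs) (swapfE (swaps_sym hs)).
    by move: E hd; case: (ltngtP o.[14 + 2 * j] o.[15 + 2 * j]); case: (inverted o j).
  have n0 b : b <= 1 -> swapf o.[14 + b + 2 * j] = o.[14 + b + 2 * j].
    move=> hb; case: (swapfP o.[14 + b + 2 * j]) => [h|[_ ->]] //.
    by have [_] := swaps_pair ho hj hb h; rewrite E.
  rewrite (n0 0 isT) (n0 1 isT); move/negbFE/eqP: E => <-; by [].
move: (index _ _) hw => i hi.
rewrite -[find _ _]/(index i (iota 0 nW)) -{1}[i](nth_iota 0 0 hi) index_uniq ?size_iota ?iota_uniq //.
Qed.

End Realize.

(** * Orderability in terms of grids *)

Section Characterization.
Variables (L V : lang) (cL kL cV kV cD kD : nat) (VM DM : TM).
Hypothesis hL : forall x, L x <->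
  exists y, size y <= pbound cL kL (size x) /\ V (enc_pair x y).
Hypothesis hVM : forall x, let cf := run (pbound cV kV (size x)) (init VM x) in
  @tm_halt VM (cfg_state cf) /\ (@tm_acc VM (cfg_state cf) <-> V x).
Hypothesis hDM : forall x, let cf := run (pbound cD kD (size x)) (init DM x) in
  @tm_halt DM (cfg_state cf) /\ cfg_output cf = hD cL kL cV kV x.

Definition WT : finType := W VM DM.
Definition rootW : WT := Some (rootD DM, wall VM).
Definition FFs := @ffs WT rootW (@topOK VM DM) (@leftW VM DM) (@innW VM DM) (@rej VM DM).
Notation gs := (gs WT).

Variables (n : nat) (bs : seq bool).
Hypothesis hw : wf_graph n bs.
Notation adj := (adjn n bs).
Notation occ := (occ WT n adj).
Notation grid := (grid WT n adj).
Notation violG := (viol rootW (@topOK VM DM) (@leftW VM DM) (@innW VM DM) (@rej VM DM) n adj).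

Definition labs (s : seq (nat * nat)) := map fst s.

(** Structural clauses do not mention the ordering, so a single ordering without violations excludes
    them for good. *)
Lemma struct_of_noviol pos : ~ violG pos -> struct_ok WT n adj.
Proof.
move=> h o1 o2 o3 o4 o5 ho; apply/negP => hs; apply: h.
by exists o1, o2, o3, o4, o5; rewrite ho hs.
Qed.

Hypothesis ok : struct_ok WT n adj.

Let asym u v : u < n -> v < n -> adj u v = adj v u.
Proof. exact: adjn_sym. Qed.

Lemma oviol_of pos d c e : occ d -> occ c -> occ e -> touch adj d c -> touch adj c e ->
  ~ violG pos -> ~~ oviol rootW (@topOK VM DM) (@leftW VM DM) (@innW VM DM) (@rej VM DM) adj pos d c e.
Proof.
move=> hd hc he t1 t2 h; apply/negP => ho; apply: h; exists d, c, e, e, e.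
by rewrite /occs hd hc he t1 t2 !(touch_refl he) ho orbT.
Qed.

Lemma st_eqo pos o o' : eqo WT o o' -> st rootW pos o = st rootW pos o'.
Proof.
move=> h; rewrite /st; congr nth; apply: eq_in_find => j; rewrite mem_iota add0n => /andP[_ hj].
by rewrite (eqoE h (p := 15 + _)) ?(eqoE h (p := 14 + _)) // /gs; lia.
Qed.

Section Sound.
Variable pos : nat -> nat.
Hypothesis noviol : ~ violG pos.
Notation stp := (st rootW pos).

Definition symof (w : WT) : 'I_(tm_k VM).+3 :=
  if w is Some (_, c) then odflt (blank VM) (presym c) else blank VM.

(** [grid] remembers top cells by their anchors only; all occurrences with a given anchor have the
    same state, so any choice will do. *)
Definition cellat (a : nat) : obj := epsilon (inhabits (0, [::])) (fun o => occ o /\ o.[10] = a).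

Lemma st_cellat o : occ o -> stp (cellat o.[10]) = stp o.
Proof.
move=> ho; have [h1 h2] : occ (cellat o.[10]) /\ (cellat o.[10]).[10] = o.[10].
  by apply: (epsilon_spec (inhabits (0, [::])) (fun o' => occ o' /\ o'.[10] = o.[10])); exists o.
by apply: st_eqo; apply: (anchor_eqo ok) => //.
Qed.

Definition vs (s : seq (nat * nat)) := [seq symof (stp (cellat x.2)) | x <- s].

Lemma final_rej o t s : grid o t s -> o.1 = 7 -> ~~ rej (stp o).
Proof.
case=> {o t s} [o _ -> //|o d s _ hl _ _ e7|o e t _ -> //|o d e t x s ho h6 hd he hld hu e7].
  by move: hl; rewrite e7.
have hd' := grid_occ hd; have he' := grid_occ he.
have tt := touch_sym asym ho hd' (touch_lft ho hd' hld).
have := oviol_of hd' ho he' tt (touch_up ho he' hu) noviol.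
by rewrite /oviol e7 hld hu /= negb_or => /andP[_].
Qed.

(** Without violations the states are forced along the derivation of the grid, up to the guessed
    symbols [vs s]. For a word that does not parse, the state is the joker and carries no symbol,
    hence the premise on [pst]. *)
Lemma grid_st o t s : grid o t s ->
  stp o = WV DM t (labs s) (vs s) /\ (pst (labs s) -> okvs (labs s) (vs s)).
Proof.
elim=> {o t s} [o ho e0|o d s ho hl hd [IH1 IH2] hld|o e t ho h5 he [IH1 IH2] hu
  |o d e t x s ho h6 hd [IH1 IH2] he [IH3 IH4] hld hu].
- have := oviol_of ho ho ho (touch_refl ho) (touch_refl ho) noviol.
  by rewrite /oviol e0 negbK => /eqP ->.
- have hd' := grid_occ hd; have tt := touch_sym asym ho hd' (touch_lft ho hd' hld).
  have := oviol_of hd' ho ho tt (touch_refl ho) noviol.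
  have -> : oviol rootW (@topOK VM DM) (@leftW VM DM) (@innW VM DM) (@rej VM DM) adj pos d o o =
    lft adj o d && ~~ topOK o.1 (stp d) (stp o).
    by move: hl; rewrite /oviol; case: (o.1) => [|[|[|[|[|]]]]].
  rewrite hld negbK IH1 => /WV_top [|a [h1 h2]]; first by rewrite !size_map.
  rewrite /vs /= st_cellat //.
  have E : WV DM 0 (o.1 :: labs s) (symof (stp o) :: vs s) = stp o /\
      (pst (o.1 :: labs s) -> symof (stp o) = a).
    rewrite h1 /WV /DV; case Ep : (pst (o.1 :: labs s)) => [p|] //=.
  split; first by rewrite /labs /= -/(labs s) E.1.
  move=> hp; rewrite -[map _ s]/(vs s) [pst _]/= in hp *.
  have hp' : pst (o.1 :: labs s) by [].
  rewrite /= (E.2 hp') h2 /=; last by rewrite /WV /DV; case: (pst _) hp'.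
  by apply: IH2; move: hp'; rewrite /=; case: (pst (labs s)).
- have he' := grid_occ he; have := oviol_of ho ho he' (touch_refl ho) (touch_up ho he' hu) noviol.
  by rewrite /oviol h5 hu /= negbK IH1 => /eqP ->; rewrite WV_left.
- have hd' := grid_occ hd; have he' := grid_occ he.
  have tt := touch_sym asym ho hd' (touch_lft ho hd' hld).
  have := oviol_of hd' ho he' tt (touch_up ho he' hu) noviol.
  have -> : oviol rootW (@topOK VM DM) (@leftW VM DM) (@innW VM DM) (@rej VM DM) adj pos d o e =
    [&& lft adj o d, up adj o e & (stp o != innW (stp d) (stp e)) || ((o.1 == 7) && rej (stp o))].
    by move: h6; rewrite /oviol; case: (o.1) => [|[|[|[|[|[|]]]]]].
  rewrite hld hu /= negb_or => /andP[/negPn/eqP -> _]; split=> //.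
  by rewrite IH1 IH3 /labs /= -[WV DM t _ _]/(WV DM t (x.1 :: labs s) (symof (stp (cellat x.2)) :: vs s)) -WV_inn.
Qed.

Lemma final_sound o t s d x : grid o t s -> o.1 = 7 ->
  DV DM t (labs s) = Some d -> okF d -> zof (labs s) = zx x -> L x.
Proof.
move=> hg h7 hd hF hz; have [h1 h2] := grid_st hg.
have hr := final_rej hg h7; rewrite h1 /WV hd /= hF /= negbK in hr.
move: hd hF; rewrite /DV; case Ep : (pst (labs s)) => [p|] //= [<-] /andP[/= h3 h4].
rewrite Ep in h2; have hsz : size (vs s) = size (labs s) by rewrite !size_map.
have [x' hx' hLx] := sem_sound hL hVM hDM Ep h3 hsz (h2 isT) h4 hr.
by have -> : x = x' by apply: zx_inj; rewrite -hz.
Qed.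

End Sound.

(** The side of the characterization that mentions no ordering: [DV] and [okF] depend on the labels
    alone, which is what the decoder exploits. *)
Definition final_cond := forall o t s d x, grid o t s -> o.1 = 7 ->
  DV DM t (labs s) = Some d -> okF d -> zof (labs s) = zx x -> L x.

Section Complete.
Hypothesis cond : final_cond.

Notation WC t s := (WV DM t s (vcan V cL kL VM s) : WT).

Definition at_ a t s := exists2 o, grid o t s & o.[10] = a.

(** Canonical states for an anchor: the forced value with the canonical guess inside a grid, the
    joker outside. By [at_fun] an anchor has only one place. *)
Definition wa (a : nat) : WT := epsilon (inhabits None) (fun w =>
  (exists t s, at_ a t s /\ w = WC t (labs s)) \/ (~ (exists t s, at_ a t s) /\ w = None)).

Lemma waP a : (exists t s, at_ a t s /\ wa a = WC t (labs s)) \/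
  (~ (exists t s, at_ a t s) /\ wa a = None).
Proof.
apply: (epsilon_spec (inhabits None) (fun w =>
  (exists t s, at_ a t s /\ w = WC t (labs s)) \/ (~ (exists t s, at_ a t s) /\ w = None))).
case: (excluded_middle_informative (exists t s, at_ a t s)) => [[t [s h]]|h].
  by exists (WC t (labs s)); left; exists t, s.
by exists None; right.
Qed.

Lemma at_fun a t s t' s' : at_ a t s -> at_ a t' s' -> t = t' /\ s = s'.
Proof. by move=> [o h1 h2] [o' h3 h4]; apply: (grid_fun ok asym h1 h3); rewrite h2. Qed.

Lemma wa_at a t s : at_ a t s -> wa a = WC t (labs s).
Proof.
move=> h; case: (waP a) => [[t' [s' [h1 ->]]]|[h' _]]; last by case: h'; exists t, s.
by have [-> ->] := at_fun h1 h.
Qed.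

Lemma wa_none a : (forall t s, ~ at_ a t s) -> wa a = None.
Proof. by move=> h; case: (waP a) => [[t [s [h1 _]]]|[_ //]]; case: (h t s h1). Qed.

Let g20 : 20 <= gs := gs_ge WT.
Let g11 : 10 <= 11 < gs. Proof. by apply/andP; split=> //; apply: leq_trans g20. Qed.
Let g13 : 10 <= 13 < gs. Proof. by apply/andP; split=> //; apply: leq_trans g20. Qed.

Lemma at_lft c d t s : occ d -> at_ d.[10] t s -> lft adj c d -> exists2 o, grid o t s & lft adj c o.
Proof.
move=> hd [o h1 h2] hl; exists o => //; rewrite /lft.
by rewrite (eqoE (anchor_eqo ok (grid_occ h1) hd h2) g11).
Qed.

Lemma at_up c d t s : occ d -> at_ d.[10] t s -> up adj c d -> exists2 o, grid o t s & up adj c o.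
Proof.
move=> hd [o h1 h2] hl; exists o => //; rewrite /up.
by rewrite (eqoE (anchor_eqo ok (grid_occ h1) hd h2) g13).
Qed.

Lemma at_inv_lft c d t x s : occ c -> occ d -> lft adj c d -> at_ c.[10] t (x :: s) -> at_ d.[10] t s.
Proof.
move=> hc hd hl [o h1 h2]; have [d' h3 h4] := grid_lft h1; exists d' => //.
have he := anchor_eqo ok (grid_occ h1) hc h2; rewrite (eqo_lft _ _ he) in h3.
by have := lft_fun ok asym hc (grid_occ h4) hd h3 hl.
Qed.

Lemma at_inv_up c d t s : occ c -> occ d -> up adj c d -> at_ c.[10] t.+1 s -> at_ d.[10] t s.
Proof.
move=> hc hd hl [o h1 h2]; have [d' h3 h4] := grid_up h1; exists d' => //.
have he := anchor_eqo ok (grid_occ h1) hc h2; rewrite (eqo_up _ _ he) in h3.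
by have := up_fun ok asym hc (grid_occ h4) hd h3 hl.
Qed.

Lemma at_label c t s : occ c -> at_ c.[10] t s -> exists2 o, grid o t s & o.1 = c.1.
Proof.
move=> hc [o h1 h2]; exists o => //.
by case/andP: (anchor_eqo ok (grid_occ h1) hc h2) => /eqP.
Qed.

(** The delicate case is a neighbour that lies in a grid at the wrong place, here below the top row.
    Then [c] lies in no grid and has the joker, and the flag [atT] makes [topD] demand exactly that.
    The flags serve the border and inner cells in the same way. *)
Lemma wa_top c d : occ c -> 1 <= c.1 <= 4 -> occ d -> lft adj c d ->
  topOK c.1 (wa d.[10]) (wa c.[10]).
Proof.
move=> hc hl hd hld.
have inv t s : at_ c.[10] t s -> exists s', at_ d.[10] 0 s'.
  move=> h; have [o h1 h2] := at_label hc h; have [_ k _ _] := grid_inv h1.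
  rewrite h2 in k; have [e1 [s' e2]] := k hl; subst t s; exists s'.
  exact: at_inv_lft hc hd hld h.
case: (waP d.[10]) => [[t [s [h ->]]]|[h ->]]; last first.
  by rewrite /= wa_none // => t s /inv [s' h']; apply: h; exists 0, s'.
case: t h => [|t] h.
  have [o h1 h2] := at_lft hd h hld.
  have hg : grid c 0 ((c.1, c.[10]) :: s) by apply: GTop h2.
  rewrite (@wa_at _ 0 ((c.1, c.[10]) :: s)); last by exists c.
  apply: WV_top_ok; first by rewrite size_vcan.
  exact: vcan_ok.
rewrite (@wa_none c.[10]); last first.
  by move=> t' s' /inv [s'' h'']; have [] := at_fun h h''.
rewrite /topOK /WV; case E : (DV DM t.+1 (labs s)) => [dd|] //=.
by have [_ hT] := DV_fields E; rewrite /topD hT.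
Qed.

Lemma wa_left c e : occ c -> c.1 = 5 -> occ e -> up adj c e -> wa c.[10] = leftW (wa e.[10]).
Proof.
move=> hc hl he hu.
have inv t s : at_ c.[10] t s -> exists t', at_ e.[10] t' [::].
  move=> h; have [o h1 h2] := at_label hc h; have [_ _ k _] := grid_inv h1.
  rewrite h2 in k; have [e1 [t' e2]] := k hl; subst t s; exists t'.
  exact: at_inv_up hc he hu h.
case: (waP e.[10]) => [[t [s [h ->]]]|[h ->]]; last first.
  by rewrite /= wa_none // => t s /inv [t' h']; apply: h; exists t', [::].
case: s h => [|x s] h.
  have [o h1 h2] := at_up he h hu.
  rewrite (@wa_at _ t.+1 [::]) ?WV_left //; by exists c => //; apply: GLeft h2.
rewrite (@wa_none c.[10]); last first.
  by move=> t' s' /inv [t'' h'']; have [] := at_fun h h''.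
rewrite /leftW /WV; case E : (DV DM t (labs (x :: s))) => [dd|] //=.
by have [hT _] := DV_fields E; rewrite /leftD hT.
Qed.

Lemma wa_inn c d e : occ c -> 6 <= c.1 -> occ d -> occ e -> lft adj c d -> up adj c e ->
  wa c.[10] = innW (wa d.[10]) (wa e.[10]).
Proof.
move=> hc hl hd he hld hu.
have inv t s : at_ c.[10] t s -> exists t' x s', at_ d.[10] t'.+1 s' /\ at_ e.[10] t' (x :: s').
  move=> h; have [o h1 h2] := at_label hc h; have [_ _ _ k] := grid_inv h1.
  rewrite h2 in k; have [t' [x [s' [e1 e2]]]] := k hl; subst t s; exists t', x, s'; split.
    exact: at_inv_lft hc hd hld h.
  exact: at_inv_up hc he hu h.
case: (waP d.[10]) => [[t1 [s1 [h1 ->]]]|[h1 ->]]; last first.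
  by rewrite /= wa_none // => t s /inv [t' [x [s' [h' _]]]]; apply: h1; exists t'.+1, s'.
case: (waP e.[10]) => [[t2 [s2 [h2 ->]]]|[h2 ->]]; last first.
  rewrite /= wa_none; first by case: (WV _ _ _ _) => // -[].
  by move=> t s /inv [t' [x [s' [_ h']]]]; apply: h2; exists t', (x :: s').
case: t1 h1 => [|t1] h1.
  rewrite (@wa_none c.[10]); last first.
    by move=> t s /inv [t' [x [s' [h' _]]]]; have [] := at_fun h1 h'.
  rewrite /innW /WV; case E : (DV DM 0 (labs s1)) => [dd|] //=.
  have [_ hT] := DV_fields E; case: (DV DM t2 _) => //= d'; by rewrite /innD hT.
case: s2 h2 => [|x s2] h2.
  rewrite (@wa_none c.[10]); last first.
    by move=> t s /inv [t' [x [s' [_ h']]]]; have [] := at_fun h2 h'.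
  rewrite /innW /WV; case: (DV DM t1.+1 (labs s1)) => [dd|] //=.
  by rewrite /innD /= andbF.
have [o1 k1 k2] := at_lft hd h1 hld; have [o2 k3 k4] := at_up he h2 hu.
(* Both neighbours lie in grids; the square condition makes these fit together under [c]. *)
have [|et [x' es]] := grid_square ok asym hc k2 k4 k1 k3 => //.
case: es => ex es; subst x' s2 t2.
rewrite (@wa_at _ t1.+1 (x :: s1)); last by exists c => //; apply: GInn k2 k4.
by rewrite /labs /= WV_inn.
Qed.

Lemma wa_final c : occ c -> c.1 = 7 -> ~~ rej (wa c.[10]).
Proof.
move=> hc h7; case: (waP c.[10]) => [[t [s [h ->]]]|[_ -> //]].
have [o hg h1] := at_label hc h; rewrite h7 in h1.
rewrite /WV; case E : (DV DM t (labs s)) => [d|] //=; rewrite negb_and negbK.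
case hF : (okF d) => //=.
move: (E); rewrite /DV; case Ep : (pst (labs s)) => [p|] //= [ed].
move: (hF); rewrite -ed => /andP[/= h3 h4].
have [x [g [hh Es]]] := pst_tword Ep h3.
have hz : zof (labs s) = zx x by rewrite Es zof_tword.
exact: (sem_complete hL hVM hDM Ep h3 h4 hz (cond hg h1 E hF hz)).
Qed.

Lemma complete : exists pos : {perm 'I_n}, ~ violG (posn pos).
Proof.
exists (swap_perm wa ok) => -[o1 [o2 [o3 [o4 [o5]]]]] /andP[hoc].
case/andP: (hoc) => /and5P[w1 w2 w3 w4 w5] _.
have /negbTE -> := ok hoc; rewrite orFb /oviol !st_swap //.
have top : 1 <= o2.1 <= 4 ->
    lft adj o2 o1 && ~~ topOK o2.1 (wa o1.[10]) (wa o2.[10]) -> False.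
  by move=> hl /andP[h /negP]; apply; apply: wa_top.
case E : (o2.1) top => [|[|[|[|[|[|m]]]]]] top; try exact: top.
- rewrite (@wa_at _ 0 [::]) ?eqxx //; by exists o2 => //; apply: GRoot.
- by move=> /andP[hu]; rewrite (wa_left w2 E w3 hu) eqxx.
- move=> /and3P[hl hu]; rewrite -(wa_inn w2 _ w1 w3 hl hu); last by rewrite E.
  by rewrite eqxx /= => /andP[/eqP e7]; apply/negP; apply: wa_final; rewrite // E.
Qed.

End Complete.

Theorem FFO_grid x : graph_code x n bs -> (FFO FFs x <-> final_cond).
Proof.
move=> hx; split.
  move=> /(FFO_viol _ _ _ _ _ hx) [pos hpos] o t s d x' hg h7 hd hF hz.
  exact: final_sound hpos _ _ _ _ _ hg h7 hd hF hz.
by move=> cond; apply/(FFO_viol _ _ _ _ _ hx); apply: complete.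
Qed.

End Characterization.

(** * The graph produced by the reduction *)

Section GridGraph.
Variables (s k m : nat) (tl : nat -> nat).

Definition glab t j := if t == 0 then tl j else if j == 0 then 5
  else if (t == m.-1) && (j == k.-1) then 7 else 6.

Definition link4 tu ju au tv jv av : bool :=
  [|| [&& tu == tv, ju == jv.+1, au == 10 & av == 11]
    | [&& tu == tv.+1, ju == jv, au == 12 & av == 13]].

Definition adj6 tu ju au tv jv av : bool :=
  [|| [&& tu == tv, ju == jv & K (glab tu ju) au av], link4 tu ju au tv jv av
    | link4 tv jv av tu ju au].

Definition adjx u v : bool :=
  adj6 (u %/ s %/ k) (u %/ s %% k) (u %% s) (v %/ s %/ k) (v %/ s %% k) (v %% s).

Definition Nx := m * k * s.
Definition bsx := mkseq (fun i => adjx (i %/ Nx) (i %% Nx)) (Nx * Nx).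

Lemma K_sym tau a b : K tau a b = K tau b a.
Proof.
rewrite /K /NK eq_sym; congr (_ && ~~ _).
by case: (a.+1 == b); case: (b.+1 == a); rewrite //= orbC.
Qed.

Lemma adj6_sym tu ju au tv jv av : adj6 tu ju au tv jv av = adj6 tv jv av tu ju au.
Proof.
rewrite /adj6 [tv == tu]eq_sym [jv == ju]eq_sym.
case: (tu =P tv) => [->|_] /=; last by rewrite orbC.
case: (ju =P jv) => [->|_] /=; last by rewrite orbC.
by rewrite K_sym; congr orb; rewrite orbC.
Qed.

Lemma adjx_sym u v : adjx u v = adjx v u.
Proof. exact: adj6_sym. Qed.

Lemma adjx_irr u : adjx u u = false.
Proof.
rewrite /adjx; move: (u %/ s %/ k) (u %/ s %% k) (u %% s) => t j a.
by rewrite /adj6 /K /link4 !eqxx /=; lia.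
Qed.

Lemma wf_bsx : wf_graph Nx bsx.
Proof.
have E (i j : 'I_Nx) : gadj bsx i j = adjx i j.
  rewrite /gadj /bsx nth_mkseq2 // divn_pair // modn_pair //.
split; first by rewrite size_mkseq.
by split=> [i j|i]; rewrite !E ?adjx_irr // adjx_sym.
Qed.

Lemma adjn_bsx u v : u < Nx -> v < Nx -> adjn Nx bsx u v = adjx u v.
Proof. by move=> hu hv; rewrite /adjn /bsx nth_mkseq2 // divn_pair // modn_pair. Qed.

Hypothesis s20 : 20 <= s.
Hypothesis k0 : 0 < k.
Hypothesis tl8 : forall j, tl j <= 4.

Lemma glab8 t j : glab t j < 8.
Proof.
rewrite /glab; case: ifP => _; first exact: leq_ltn_trans (tl8 j) _.
by case: ifP => // _; case: ifP.
Qed.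

Definition vx t j a := (t * k + j) * s + a.

Lemma vxK t j a : j < k -> a < s ->
  [/\ vx t j a %/ s %/ k = t, vx t j a %/ s %% k = j & vx t j a %% s = a].
Proof. by move=> hj ha; rewrite /vx divn_pair // divn_pair // !modn_pair. Qed.

Lemma vxE u : u = vx (u %/ s %/ k) (u %/ s %% k) (u %% s).
Proof. by rewrite /vx -divn_eq -divn_eq. Qed.

Lemma vx_lt t j a : t < m -> j < k -> a < s -> vx t j a < Nx.
Proof.
move=> ht hj ha; rewrite /vx /Nx; apply: (@leq_trans ((t * k + j).+1 * s)).
  by rewrite mulSn addnC ltn_add2r.
rewrite leq_mul2r; apply/orP; right; apply: (@leq_trans (t.+1 * k)); first by rewrite mulSn; lia.
by rewrite leq_mul2r ht orbT.
Qed.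

Lemma coords u : u < Nx -> u %/ s %/ k < m /\ u %/ s %% k < k.
Proof.
move=> hu; rewrite ltn_mod k0; split=> //; rewrite ltn_divLR // ltn_divLR //; lia.
Qed.

Definition samecell u v := (u %/ s %/ k == v %/ s %/ k) && (u %/ s %% k == v %/ s %% k).

(** Each of the four link positions serves one direction only, so a vertex has at most one neighbour
    outside its cell. *)
Lemma out_unique u v w : adjx u v -> ~~ samecell u v -> adjx u w -> ~~ samecell u w -> v = w.
Proof.
rewrite [v in _ -> _ -> _ -> _ -> v = _]vxE [w in _ -> _ -> _ -> _ -> _ = w]vxE /adjx /samecell.
move: (u %/ s %/ k) (u %/ s %% k) (u %% s) (v %/ s %/ k) (v %/ s %% k) (v %% s)
  (w %/ s %/ k) (w %/ s %% k) (w %% s) => tu ju au tv jv av tw jw aw.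
rewrite /adj6 => h1 n1 h2 n2.
have {}h1 : link4 tu ju au tv jv av || link4 tv jv av tu ju au.
  by move: h1; rewrite andbA (negbTE n1).
have {}h2 : link4 tu ju au tw jw aw || link4 tw jw aw tu ju au.
  by move: h2; rewrite andbA (negbTE n2).
have [-> -> ->] : [/\ tv = tw, jv = jw & av = aw] by move: h1 h2; rewrite /link4; split; lia.
by [].
Qed.

(** A triangle that leaves a cell would give one of its vertices two neighbours outside its own
    cell. *)
Lemma triangle u v w : adjx u v -> adjx v w -> adjx u w -> samecell u v.
Proof.
move=> h1 h2 h3; apply/negPn/negP => n1.
case E : (samecell u w); last first.
  by have e := out_unique h1 n1 h3 (negbT E); move: h2; rewrite e adjx_irr.
have n2 : ~~ samecell v w.
  apply: contra n1 => /andP[/eqP e1 /eqP e2]; case/andP: E => e3 e4.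
  by rewrite /samecell e1 e2 e3 e4.
have n3 : ~~ samecell v u by move: n1; rewrite /samecell ![u %/ s %/ k == _]eq_sym ![u %/ s %% k == _]eq_sym.
by have e := out_unique (etrans (adjx_sym v u) h1) n3 h2 n2; move: h3; rewrite e adjx_irr.
Qed.

Section Occ.
Variable W : finType.
Hypothesis sW : s = gs W.
Notation adj := (adjn Nx bsx).
Notation occ := (occ W Nx adj).

(** By [K_common] every edge of an occurrence lies in a triangle, and its vertices are joined by
    such edges, so the occurrence stays in one cell. The offsets modulo [s] then satisfy the
    premises of [K_rigid]. *)
Lemma occ_cell o : occ o -> exists t j, [/\ t < m, j < k, o.1 = glab t j,
  forall a, a < s -> o.[a] %/ s %/ k = t /\ o.[a] %/ s %% k = j &
  forall p, 10 <= p < s -> o.[p] = vx t j p].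
Proof.
move=> ho.
have olt a : a < s -> o.[a] < Nx by rewrite sW; apply: occ_lt ho.
have t8 : o.1 < 8 by case/and5P: ho.
have oK a b : a < s -> b < s -> K o.1 a b -> adjx o.[a] o.[b].
  by move=> ha hb hK; rewrite -adjn_bsx ?olt //; apply: (occ_K ho); rewrite -?sW.
have scK a b : a < s -> b < s -> K o.1 a b -> samecell o.[a] o.[b].
  move=> ha hb hK; have [c [hc h1 h2]] := K_common a b t8 s20.
  exact: triangle (oK _ _ ha hb hK) (oK _ _ hb hc h2) (oK _ _ ha hc h1).
have sc a b : a < s -> b < s -> samecell o.[a] o.[b].
  move=> ha hb; have [c [hc h1 h2]] := K_common a b t8 s20.
  have /andP[/eqP e1 /eqP e2] := scK _ _ ha hc h1; have /andP[/eqP e3 /eqP e4] := scK _ _ hb hc h2.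
  by rewrite /samecell e1 e2 e3 e4 !eqxx.
have s0 : 0 < s by apply: leq_trans s20.
set t := o.[0] %/ s %/ k; set j := o.[0] %/ s %% k.
have hc a : a < s -> o.[a] %/ s %/ k = t /\ o.[a] %/ s %% k = j.
  by move=> ha; have /andP[/eqP -> /eqP ->] := sc a 0 ha s0.
have [ht hj] := coords (olt 0 s0).
have [|||e1 e2] := @K_rigid o.1 (glab t j) s (fun a => o.[a] %% s) t8 (glab8 _ _) s20.
- by move=> a ha; rewrite ltn_mod.
- move=> a b ha hb e; apply: (occ_inj ho); rewrite -?sW //.
  rewrite (vxE o.[a]) (vxE o.[b]).
  by have [-> ->] := hc a ha; have [-> ->] := hc b hb; rewrite e.
- move=> a b ha hb /(oK _ _ ha hb); rewrite /adjx.
  have [-> ->] := hc a ha; have [-> ->] := hc b hb.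
  rewrite /adj6 !eqxx /= => /or3P[//||]; rewrite /link4; lia.
exists t, j; split=> // p hp; rewrite [LHS]vxE; have [-> ->] := hc p ltac:(by case/andP: hp).
by rewrite e2.
Qed.

Definition cobj t j : obj := (glab t j, [seq vx t j a | a <- iota 0 s]).

Lemma cobjE t j a : a < s -> (cobj t j).[a] = vx t j a.
Proof. by move=> ha; rewrite (nth_map 0) ?size_iota // nth_iota. Qed.

Lemma cobj_occ t j : t < m -> j < k -> occ (cobj t j).
Proof.
move=> ht hj; apply/and5P; split.
- exact: glab8.
- by rewrite size_map size_iota sW.
- by apply/allP => v /mapP[a]; rewrite mem_iota => /andP[_ ha] ->; apply: vx_lt.
- rewrite map_inj_in_uniq ?iota_uniq // => a b _ _ /addnI //.
- apply/allP => a; rewrite -sW mem_iota => /andP[_ ha]; apply/allP => b; rewrite mem_iota => /andP[_ hb].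
  apply/implyP => hK; rewrite !cobjE // adjn_bsx ?vx_lt //.
  rewrite /adjx; have [-> -> ->] := vxK t hj ha; have [-> -> ->] := vxK t hj hb.
  by rewrite /adj6 !eqxx hK.
Qed.

Lemma occ_lft o o' t j t' j' : occ o -> occ o' -> j < k -> j' < k ->
  (forall p, 10 <= p < s -> o.[p] = vx t j p) -> (forall p, 10 <= p < s -> o'.[p] = vx t' j' p) ->
  lft adj o o' = (t == t') && (j == j'.+1).
Proof.
move=> ho ho' hj hj' h h'.
have g10 : 10 < s by apply: leq_trans s20. have g11 : 11 < s by apply: leq_trans s20.
rewrite /lft adjn_bsx; [|by apply: (occ_lt ho); rewrite -sW|by apply: (occ_lt ho'); rewrite -sW].
rewrite h // h' // /adjx; have [-> -> ->] := vxK t hj g10; have [-> -> ->] := vxK t' hj' g11.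
by rewrite /adj6 /link4 /K /NK /=; lia.
Qed.

Lemma occ_up o o' t j t' j' : occ o -> occ o' -> j < k -> j' < k ->
  (forall p, 10 <= p < s -> o.[p] = vx t j p) -> (forall p, 10 <= p < s -> o'.[p] = vx t' j' p) ->
  up adj o o' = (t == t'.+1) && (j == j').
Proof.
move=> ho ho' hj hj' h h'.
have g10 : 12 < s by apply: leq_trans s20. have g11 : 13 < s by apply: leq_trans s20.
rewrite /up adjn_bsx; [|by apply: (occ_lt ho); rewrite -sW|by apply: (occ_lt ho'); rewrite -sW].
rewrite h // h' // /adjx; have [-> -> ->] := vxK t hj g10; have [-> -> ->] := vxK t' hj' g11.
by rewrite /adj6 /link4 /K /NK /=; lia.
Qed.

Lemma struct_bsx : struct_ok W Nx adj.
Proof.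
move=> o1 o2 o3 o4 o5 /andP[/and5P[w1 w2 w3 w4 w5] _].
have [t1 [j1 [_ J1 L1 C1 P1]]] := occ_cell w1; have [t2 [j2 [_ J2 L2 C2 P2]]] := occ_cell w2.
have [t3 [j3 [_ J3 _ _ P3]]] := occ_cell w3; have [t4 [j4 [_ J4 _ _ P4]]] := occ_cell w4.
have [t5 [j5 [_ J5 _ _ P5]]] := occ_cell w5.
have g10 : 10 <= 10 < s by apply/andP; split=> //; apply: leq_trans s20.
rewrite /sviol (occ_lft w2 w1 J2 J1 P2 P1) (occ_lft w2 w3 J2 J3 P2 P3) (occ_up w2 w1 J2 J1 P2 P1).
rewrite (occ_up w2 w3 J2 J3 P2 P3) (occ_lft w3 w2 J3 J2 P3 P2) (occ_up w3 w4 J3 J4 P3 P4).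
rewrite (occ_lft w4 w5 J4 J5 P4 P5) P1 // P3 // P5 // !negb_or.
have D t j t' j' (b : bool) : (b -> t = t' /\ j = j') -> ~~ (b && (vx t j 10 != vx t' j' 10)).
  by case: b => // /(_ isT) [-> ->]; rewrite eqxx.
apply/and4P; split.
- apply/negP => /andP[/hasP[v hv hv'] /negP]; apply.
  have [a ha ea] := occ_index w1 hv; have [b hb eb] := occ_index w2 hv'.
  have [e1 e2] := C1 a ltac:(by rewrite sW); have [e3 e4] := C2 b ltac:(by rewrite sW).
  rewrite ea in e1 e2; rewrite eb in e3 e4.
  have et : t1 = t2 by rewrite -e1 e3. have ej : j1 = j2 by rewrite -e2 e4.
  apply/andP; split; first by rewrite L1 L2 et ej.
  apply/allP => p; rewrite -sW mem_iota subnKC; last by apply: leq_trans s20.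
  by move=> hp; rewrite P1 // P2 // et ej.
- by rewrite andbA; apply: D; move: J1 J3 => *; split; lia.
- by rewrite andbA; apply: D; move: J1 J3 => *; split; lia.
- by rewrite !andbA; apply: D; move: J1 J3 => *; split; lia.
Qed.

Fixpoint sx j : seq (nat * nat) :=
  if j is j'.+1 then (tl j, vx 0 j 10) :: sx j' else [::].

Hypothesis tl0 : tl 0 = 0.
Hypothesis tl1 : forall j, 0 < j -> 1 <= tl j.

Lemma grid_bsx t j : t < m -> j < k -> grid W Nx adj (cobj t j) t (sx j).
Proof.
have hp t' j' p : 10 <= p < s -> (cobj t' j').[p] = vx t' j' p.
  by case/andP=> _ hp; rewrite cobjE.
have g10 : 10 < s by apply: leq_trans s20.
elim: t j => [|t IHt] j ht.
  elim: j => [|j IHj] hj; first by apply: GRoot; [apply: cobj_occ|rewrite /= /glab tl0].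
  have hj' := ltnW hj.
  have := @GTop W Nx adj (cobj 0 j.+1) (cobj 0 j) (sx j) (cobj_occ ht hj) _ (IHj hj').
  rewrite cobjE // /= {2}/glab /=; apply; first by rewrite /glab /= tl8 tl1.
  by rewrite (occ_lft (cobj_occ ht hj) (cobj_occ ht hj') hj hj' (hp _ _) (hp _ _)) !eqxx.
have ht' := ltnW ht.
elim: j => [|j IHj] hj.
  apply: GLeft (IHt 0 ht' hj) _ => //; first exact: cobj_occ.
  by rewrite (occ_up (cobj_occ ht hj) (cobj_occ ht' hj) hj hj (hp _ _) (hp _ _)) !eqxx.
have hj' := ltnW hj.
apply: (@GInn W Nx adj (cobj t.+1 j.+1) (cobj t.+1 j) (cobj t j.+1)) => //.
- exact: cobj_occ.
- by rewrite /= /glab /=; case: ifP.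
- exact: IHj.
- exact: IHt.
- by rewrite (occ_lft (cobj_occ ht hj) (cobj_occ ht hj') hj hj' (hp _ _) (hp _ _)) !eqxx.
- by rewrite (occ_up (cobj_occ ht hj) (cobj_occ ht' hj) hj hj (hp _ _) (hp _ _)) !eqxx.
Qed.

Lemma final_bsx o t s' : 1 < m -> 1 < k -> grid W Nx adj o t s' -> o.1 = 7 -> t = m.-1 /\ s' = sx k.-1.
Proof.
move=> hm hk hg h7; have ho := grid_occ hg.
have [t1 [j1 [T1 J1 L1 _ P1]]] := occ_cell ho.
have [et ej] : t1 = m.-1 /\ j1 = k.-1.
  move: L1; rewrite h7 /glab; case: ifP => _; first by have := tl8 j1; lia.
  by case: ifP => // _; case: ifP => // /andP[/eqP -> /eqP ->].
have hm' : m.-1 < m by rewrite ltn_predL; apply: leq_trans hm.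
have hk' : k.-1 < k by rewrite ltn_predL.
have g10 : 10 < s by apply: leq_trans s20.
apply: (grid_fun struct_bsx _ hg (grid_bsx hm' hk')).
  by move=> u v hu hv; rewrite !adjn_bsx // adjx_sym.
by rewrite P1 ?g10 // et ej cobjE.
Qed.

End Occ.
End GridGraph.

(** * The reduction *)

Lemma PN_bool P : PB P -> PN (fun e => nat_of_bool (P e)).
Proof. by []. Qed.

Lemma PN_pred h : PN h -> PN (fun e => (h e).-1).
Proof. by move=> H; apply: PN_ext (PN_sub H (PN_const 1)) _ => e; rewrite subn1. Qed.

Lemma PN_half h : PN h -> PN (fun e => (h e)./2).
Proof. by move=> H; apply: PN_ext (PN_div H (PN_const 2)) _ => e; rewrite divn2. Qed.

Lemma PN_exp h k : PN h -> PN (fun e => h e ^ k).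
Proof.
move=> H; elim: k => [|k IH]; first exact: PN_const.
by apply: PN_ext (PN_mul H IH) _ => e; rewrite expnS.
Qed.

Lemma PN_pbound c k h : PN h -> PN (fun e => pbound c k (h e)).
Proof.
by move=> H; apply: PN_add (PN_const c); apply: PN_mul (PN_const c) _; apply: PN_exp.
Qed.

Ltac pn := repeat match goal with
  | H : ?P |- ?P => exact H
  | |- PN (fun _ => ?c) => exact (PN_const c)
  | |- PB (fun _ => ?c) => exact (PB_const c)
  | |- PN (fun e => pbound ?c ?k (@?h e)) => apply: (@PN_pbound c k h)
  | |- PN (fun e => S (@?h e)) => apply: (@PN_S h)
  | |- PN (fun e => (@?h e).-1) => apply: (@PN_pred h)
  | |- PN (fun e => (@?h e)./2) => apply: (@PN_half h)
  | |- PN (fun e => @?h e + @?k e) => apply: (@PN_add h k)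
  | |- PN (fun e => @?h e - @?k e) => apply: (@PN_sub h k)
  | |- PN (fun e => @?h e * @?k e) => apply: (@PN_mul h k)
  | |- PN (fun e => @?h e %/ @?k e) => apply: (@PN_div h k)
  | |- PN (fun e => @?h e %% @?k e) => apply: (@PN_mod h k)
  | |- PN (fun e => match @?P e with true => @?h e | false => @?k e end) => apply: (@PN_if P h k)
  | |- PN (fun e => nat_of_bool (@?P e)) => apply: (@PN_bool P)
  | |- PN (fun e => size (@?E e)) => apply: (@PN_size E)
  | |- PB (fun e => @?P e && @?Q e) => apply: (@PB_and P Q)
  | |- PB (fun e => @?P e || @?Q e) => apply: (@PB_or P Q)
  | |- PB (fun e => ~~ @?P e) => apply: (@PB_neg P)
  | |- PB (fun e => match @?P e with true => @?Q e | false => @?R e end) => apply: (@PB_if P Q R)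
  | |- PB (fun e => @?h e <= @?k e) => apply: (@PB_leq h k)
  | |- PB (fun e => @eq_op _ (@?h e) (@?k e)) => apply: (@PB_eqn h k)
  | |- PB (fun e => nth false (@?E e) (@?h e)) => apply: (@PB_nth h E)
  | |- ptime (fun e => nth [::] e ?i) => exact: (ptime_var i)
  end.

Lemma PN_find_negb E : ptime E -> PN (fun e => find negb (E e)).
Proof.
move=> H.
apply: PN_ext (@PN_find (fun e => size (E e)) (fun i e => ~~ nth false (E e) i) _ _) _ => [||e].
- exact: PN_size.
- apply: PB_neg; apply: PB_nth; last exact: ptime_shift H.
  exact: PN_size (ptime_var 0).
elim: (E e) => //= b s IH; case: b => //=; congr S; rewrite -IH.
by rewrite -[1]addn0 iotaDl find_map.
Qed.

Lemma ptime_hD cL kL cV kV : poly_computable (hD cL kL cV kV).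
Proof.
apply: (@ptime_computable (fun e => hD cL kL cV kV (nth [::] e 0))).
have H0 : ptime (fun e => nth [::] e 0) by apply: ptime_var.
have HF := PN_find_negb H0.
have Hq : PN (fun e => qf cL kL (find negb (nth [::] e 0))) by rewrite /qf; pn.
have HB : PN (fun e => Bf cL kL cV kV (find negb (nth [::] e 0))) by rewrite /Bf /Tf; pn.
rewrite /hD; cbv zeta; apply: ptime_if; [pn|exact: HB|exact: ptime_nil].
Qed.

Definition tlx (z : seq bool) (g j : nat) : nat :=
  if j == 0 then 0 else if j.-1 < size z then (nth false z j.-1 : nat).+1
  else if j.-1 < size z + g then 3 else 4.

Lemma PB_adjx s kf mf Zf Gf U V : PN kf -> PN mf -> ptime Zf -> PN Gf -> PN U -> PN V ->
  PB (fun e => adjx s (kf e) (mf e) (tlx (Zf e) (Gf e)) (U e) (V e)).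
Proof.
move=> Hk Hm HZ HG HU HV.
have Ht : PN (fun e => U e %/ s %/ kf e) by pn.
have Hj : PN (fun e => U e %/ s %% kf e) by pn.
have Ha : PN (fun e => U e %% s) by pn.
have Ht' : PN (fun e => V e %/ s %/ kf e) by pn.
have Hj' : PN (fun e => V e %/ s %% kf e) by pn.
have Ha' : PN (fun e => V e %% s) by pn.
have Hl : PN (fun e => glab (kf e) (mf e) (tlx (Zf e) (Gf e)) (U e %/ s %/ kf e) (U e %/ s %% kf e)).
  rewrite /glab /tlx; pn.
rewrite /adjx /adj6 /link4 /K /NK.
pn.
Qed.

Section Reduction.
Variables (L V : lang) (cL kL cV kV cD kD : nat) (VM DM : TM).
Hypothesis hL : forall x, L x <->
  exists y, size y <= pbound cL kL (size x) /\ V (enc_pair x y).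
Hypothesis hVM : forall x, let cf := run (pbound cV kV (size x)) (init VM x) in
  @tm_halt VM (cfg_state cf) /\ (@tm_acc VM (cfg_state cf) <-> V x).
Hypothesis hDM : forall x, let cf := run (pbound cD kD (size x)) (init DM x) in
  @tm_halt DM (cfg_state cf) /\ cfg_output cf = hD cL kL cV kV x.

Notation s := (gs (WT VM DM)).

Definition clk a := pbound cD kD (a + qf cL kL a).
(** The last row has number [clk a + 1], late enough for the clock to halt. The width consists of
    the border column, the code, the guessed region and [2 * clk a + 2] blank columns that absorb
    the slant, as [clock_ok] requires. *)
Definition rows a := clk a + 2.
Definition cols a := 2 * clk a + a + qf cL kL a + 3.

Definition redf (x : seq bool) : seq bool :=
  let z := zx x in let a := size z in
  let tl := tlx z (qf cL kL a) in
  nseq (Nx s (cols a) (rows a)) true ++ false :: bsx s (cols a) (rows a) tl.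

Lemma redf_computable : poly_computable redf.
Proof.
apply: (@ptime_computable (fun e => redf (nth [::] e 0))).
have H0 : ptime (fun e => nth [::] e 0) by apply: ptime_var.
have Hz : ptime (fun e => zx (nth [::] e 0)).
  apply: ptime_cat (ptime_const _).
  pose F b (e : env) : seq bool := b :: b :: nth [::] e 0.
  have HF b : ptime (F b) by do 2 apply: ptime_cons; apply: ptime_var.
  have E e u : brec (fun _ => [::]) (F false) (F true) e u = dbl u.
    by elim: u => //= b u ->; case: b.
  apply: ptime_ext (ptime_rec H0 ptime_nil (HF false) (HF true) _) _ => [|e]; last exact: E.
  exists (fun n => 2 * n); first by pol.
  by move=> e u; rewrite E size_dbl; lia.
have Ha := PN_size Hz.
have Hq : PN (fun e => qf cL kL (size (zx (nth [::] e 0)))) by rewrite /qf; pn.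
have Hm : PN (fun e => rows (size (zx (nth [::] e 0)))) by rewrite /rows /clk; pn.
have Hk : PN (fun e => cols (size (zx (nth [::] e 0)))) by rewrite /cols /clk; pn.
have HN : PN (fun e => Nx s (cols (size (zx (nth [::] e 0)))) (rows (size (zx (nth [::] e 0))))).
  by rewrite /Nx; pn.
rewrite /redf; apply: ptime_cat => //; apply: ptime_cons; rewrite /bsx.
apply: (@ptime_mkseq _ (fun i e => adjx s (cols (size (zx (nth [::] e 0))))
  (rows (size (zx (nth [::] e 0)))) (tlx (zx (nth [::] e 0)) (qf cL kL (size (zx (nth [::] e 0)))))
  (i %/ Nx s (cols (size (zx (nth [::] e 0)))) (rows (size (zx (nth [::] e 0)))))
  (i %% Nx s (cols (size (zx (nth [::] e 0)))) (rows (size (zx (nth [::] e 0))))))).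
  by pn.
have Hi : PN (fun e => size (nth [::] e 0)) by apply: PN_size.
apply: (@PB_adjx s (fun e => cols (size (zx (nth [::] (behead e) 0))))
  (fun e => rows (size (zx (nth [::] (behead e) 0))))
  (fun e => zx (nth [::] (behead e) 0)) (fun e => qf cL kL (size (zx (nth [::] (behead e) 0))))
  (fun e => size (nth [::] e 0) %/ Nx s (cols (size (zx (nth [::] (behead e) 0)))) (rows (size (zx (nth [::] (behead e) 0)))))
  (fun e => size (nth [::] e 0) %% Nx s (cols (size (zx (nth [::] (behead e) 0)))) (rows (size (zx (nth [::] (behead e) 0)))))).
- exact: ptime_shift Hk.
- exact: ptime_shift Hm.
- exact: ptime_shift Hz.
- exact: ptime_shift Hq.
- by apply: PN_div => //; exact: ptime_shift HN.
- by apply: PN_mod => //; exact: ptime_shift HN.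
Qed.

Lemma labs_sx k tl j : labs (sx s k tl j) = rev [seq tl i | i <- iota 1 j].
Proof.
elim: j => // j IH.
have -> : iota 1 j.+1 = rcons (iota 1 j) j.+1.
  by have := iotaD 1 j 1; rewrite addn1 => ->; rewrite cats1 add1n.
by rewrite map_rcons rev_rcons -IH.
Qed.

Lemma tlx_word x g h k :
  labs (sx s k (tlx (zx x) g) (size (zx x) + g + h)) = tword x g h.
Proof.
rewrite labs_sx /tword -[RHS]revK; congr rev; rewrite !rev_cat !rev_nseq revK /lb.
move: (zx x) => z.
apply: (@eq_from_nth _ 0); first by rewrite size_map size_iota !size_cat !size_nseq size_map.
move=> i; rewrite size_map size_iota => hi.
rewrite (nth_map 0) ?size_iota // nth_iota // add1n /tlx /= !nth_cat !size_cat !size_map !size_nseq.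
case: (ltnP i (size z)) => h1.
  by rewrite (ltn_addr _ h1) (nth_map false).
case: (ltnP i (size z + g)) => h2.
  by rewrite nth_nseq ltn_subLR // h2.
by rewrite nth_nseq ltn_subLR // hi.
Qed.

Lemma tlx_le z g j : tlx z g j <= 4.
Proof.
rewrite /tlx; case: ifP => // _; case: ifP => _; first by case: nth.
by case: ifP.
Qed.

Lemma tlx_ge z g j : 0 < j -> 1 <= tlx z g j.
Proof. by case: j => // j _; rewrite /tlx /=; case: ifP => // _; case: ifP. Qed.

(** The only final cell of the graph is its corner, over a word [tword x g h], and the clock flag is
    set there; [final_cond] thus reduces to [L x]. *)
Lemma redf_correct x : L x <-> FFO (FFs VM DM) (redf x).
Proof.
set z := zx x; set a := size z; set g := qf cL kL a; set tl := tlx z g.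
have ea : a = ax x by rewrite /a /z /zx size_cat size_dbl.
have s20 : 20 <= s by apply: gs_ge.
have k0 : 0 < cols a by rewrite /cols addnS.
have k1 : 1 < cols a by rewrite /cols !addnS.
have m1 : 1 < rows a by rewrite /rows !addnS.
have tl8 j : tl j <= 4 by apply: tlx_le.
have tl1 j : 0 < j -> 1 <= tl j by apply: tlx_ge.
have wf := wf_bsx s (cols a) (rows a) tl.
have ok := @struct_bsx s (cols a) (rows a) tl s20 k0 tl8 (WT VM DM) erefl.
have hc : graph_code (redf x) (Nx s (cols a) (rows a)) (bsx s (cols a) (rows a) tl) by [].
have [F1 F2] := FFO_grid hL hVM hDM wf ok hc.
have [h eh] : exists h, (cols a).-1 = a + g + h.
  by exists (2 * clk a + 2); rewrite /cols -/g; lia.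
have ew : labs (sx s (cols a) tl (cols a).-1) = tword x g h by rewrite eh; apply: tlx_word.
have hF o t s' : grid (WT VM DM) (Nx s (cols a) (rows a)) (adjn (Nx s (cols a) (rows a)) (bsx s (cols a) (rows a) tl)) o t s' ->
    o.1 = 7 -> t = (rows a).-1 /\ s' = sx s (cols a) tl (cols a).-1.
  exact: (@final_bsx s (cols a) (rows a) tl s20 k0 tl8 (WT VM DM) erefl erefl tl1 o t s' m1 k1).
split.
  move=> hx; apply: F2 => o t s' d x' hg h7 hd hok hz.
  have [et es] := hF _ _ _ hg h7; subst t s'.
  by move: hz; rewrite ew zof_tword => /zx_inj <-.
move=> /F1 cond.
have hm : (rows a).-1 < rows a by rewrite ltn_predL; apply: ltnW.
have hk : (cols a).-1 < cols a by rewrite ltn_predL.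
have hg := @grid_bsx s (cols a) (rows a) tl s20 k0 tl8 (WT VM DM) erefl erefl tl1 _ _ hm hk.
have [p hp h3] := tword_pst x g h.
have hfl : fl (cwv (@halD DM) (rows a).-1 (map (dsym DM) (tword x g h))).
  rewrite /g ea; apply: (clock_ok hDM); first by rewrite -ea -/(clk a) /rows addnS /= addn1 leqnSn.
  by rewrite -ea -/(clk a) size_tword -/(ax x) -ea -/g -[_ + a]addnC -[h + _]addnC -eh /cols; lia.
have hDV : DV DM (rows a).-1 (tword x g h) =
  Some (p, nilp (tword x g h), (rows a).-1 == 0, cwv (@halD DM) (rows a).-1 (map (dsym DM) (tword x g h))).
  by rewrite /DV hp.
apply: (cond _ _ _ _ x hg); rewrite ?ew.
- rewrite /= /glab !eqxx.
  have -> : ((rows a).-1 == 0) = false by rewrite /rows addn2.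
  by have -> : ((cols a).-1 == 0) = false by rewrite /cols !addnS.
- exact: hDV.
- by rewrite /okF /= h3 hfl.
- exact: zof_tword.
Qed.

End Reduction.

(** * The decoder *)

(** The length [s] of the lists is a constant of the decoder, so this exhaustive search is
    polynomial in [n]. *)
Fixpoint exl (s n : nat) (P : seq nat -> bool) : bool :=
  if s is s'.+1 then has (fun i => exl s' n (fun l => P (rcons l i))) (iota 0 n) else P [::].

Lemma exlP s n (P : seq nat -> bool) : reflect (exists l, [/\ size l = s, all (fun v => v < n) l & P l]) (exl s n P).
Proof.
elim: s P => [|s IH] P /=.
  apply: (iffP idP) => [h|[l [/size0nil -> _ //]]]; by exists [::].
apply: (iffP hasP) => [[i hi /IH [l [h1 h2 h3]]]|[l]].
  exists (rcons l i); rewrite size_rcons h1 all_rcons h2 h3 andbT; split=> //.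
  by move: hi; rewrite mem_iota.
case/lastP: l => [[]//|l i]; rewrite size_rcons all_rcons => -[[h1] /andP[hi h2] h3].
by exists i; [rewrite mem_iota|apply/IH; exists l].
Qed.

Definition evars s (e : env) : seq nat := mkseq (fun i => size (nth [::] e i)) s.

Lemma PB_exl s h (P : seq nat -> env -> bool) : PN h ->
  PB (fun e => P (evars s e) (drop s e)) -> PB (fun e => exl s (h e) (fun l => P l e)).
Proof.
elim: s h P => [|s IH] h P H HP /=.
  by apply: PB_ext HP _ => e; rewrite drop0.
apply: (@PB_ex h (fun i e => exl s (h e) (fun l => P (rcons l i) e)) H).
apply: (IH (fun e => h (behead e)) (fun l e => P (rcons l (size (nth [::] e 0))) (behead e))).
  exact: ptime_shift H.
apply: PB_ext HP _ => e; rewrite /evars mkseqS nth_drop addn0.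
by rewrite -drop1 drop_drop add1n.
Qed.

Lemma PN_evars s j : PN (fun e => nth 0 (evars s e) j).
Proof.
case: (ltnP j s) => hj; last first.
  by apply: PN_ext (PN_const 0) _ => e; rewrite nth_default ?size_mkseq.
by apply: PN_ext (PN_size (ptime_var j)) _ => e; rewrite nth_mkseq.
Qed.

Lemma ptime_dropenv k F : ptime F -> ptime (fun e => F (drop k e)).
Proof. exact: (@ptime_sel [::] k). Qed.

Definition gn (x : seq bool) := find negb x.
Definition gb (x : seq bool) := drop (gn x).+1 x.
Definition adjs (x : seq bool) := adjn (gn x) (gb x).

Lemma graph_codeE x n bs : graph_code x n bs -> gn x = n /\ gb x = bs.
Proof.
move=> [_ ->]; have E : gn (nseq n true ++ false :: bs) = n.
  by rewrite /gn find_cat has_nseq andbF size_nseq /= addn0.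
by rewrite /gb E drop_cat size_nseq ltnNge leqnSn /= subSnn drop_cons drop0.
Qed.

Lemma PN_gn X : ptime X -> PN (fun e => gn (X e)).
Proof. exact: PN_find_negb. Qed.

Lemma PB_adjs X u v : ptime X -> PN u -> PN v -> PB (fun e => adjs (X e) (u e) (v e)).
Proof.
move=> HX Hu Hv; have Hn := PN_gn HX; rewrite /adjs /adjn /gb.
have HD := ptime_drop (PN_S Hn) HX.
apply: (@PB_nth (fun e => u e * gn (X e) + v e) (fun e => drop (gn (X e)).+1 (X e))) => //.
by pn.
Qed.

(** * Recognizing cells and structural violations by exhaustive search *)

Section Objects.
Variable W : finType.
Notation gs := (gs W).

Definition seg (l : seq nat) i := mkseq (fun a => nth 0 l (i * gs + a)) gs.

(** Labels range over a constant list, apart from the vertex variables, so that the gadget [K t] is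
    a constant of each program. *)
Fixpoint LB r : seq (seq nat) :=
  if r is r'.+1 then flatten [seq [seq t :: ts | ts <- LB r'] | t <- iota 0 8] else [:: [::]].

Definition mkobjs r ts l : seq obj := [seq (nth 0 ts i, seg l i) | i <- iota 0 r].

Definition exo r n (P : seq obj -> bool) :=
  exl (r * gs) n (fun l => has (fun ts => P (mkobjs r ts l)) (LB r)).

Lemma mem_LB ts : all (fun t => t < 8) ts -> ts \in LB (size ts).
Proof.
elim: ts => // t ts IH /andP[ht /IH h].
change (t :: ts \in flatten [seq [seq t0 :: ts0 | ts0 <- LB (size ts)] | t0 <- iota 0 8]).
apply/flattenP.
exists [seq t :: ts0 | ts0 <- LB (size ts)]; last exact: map_f.
by apply: (map_f (fun t0 => [seq t0 :: ts0 | ts0 <- LB (size ts)])); rewrite mem_iota.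
Qed.

Lemma seg_flatten (ls : seq (seq nat)) i : all (fun l => size l == gs) ls -> i < size ls ->
  seg (flatten ls) i = nth [::] ls i.
Proof.
elim: ls i => //= l ls IH i /andP[/eqP hl hls]; case: i => [|i] hi.
  apply: (@eq_from_nth _ 0); rewrite ?size_mkseq // => a ha.
  by rewrite nth_mkseq // mul0n add0n nth_cat hl ha.
rewrite [nth _ _ _]/= -(IH i hls hi) /seg; apply/eq_in_map => a _.
rewrite nth_cat hl mulSn -addnA; rewrite ltnNge leq_addr /=.
by rewrite addKn.
Qed.

Lemma exoP r n adj (P : seq obj -> bool) :
  (forall os, size os = r -> P os -> all (occ W n adj) os) ->
  reflect (exists2 os, size os = r & P os) (exo r n P).
Proof.
move=> hP; apply: (iffP (exlP _ _ _)) => [[l [h1 h2 /hasP[ts _ h3]]]|[os h1 h2]].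
  by exists (mkobjs r ts l); rewrite ?size_map ?size_iota.
have /allP ho := hP _ h1 h2.
have hsz : all (fun l => size l == gs) [seq o.2 | o <- os].
  by apply/allP => l /mapP[o /ho /and5P[_ hs _ _ _] ->].
exists (flatten [seq o.2 | o <- os]); split.
- rewrite size_flatten /shape -h1; elim: os hsz {h1 h2 ho} => //= o os IH /andP[/eqP -> /IH ->].
  by rewrite mulSn.
- apply/allP => v /flattenP[l /mapP[o /ho /and5P[_ _ /allP hv _ _] ->]]; exact: hv.
apply/hasP; exists [seq o.1 | o <- os].
  rewrite -h1 -(size_map fst); apply: mem_LB; apply/allP => t /mapP[o /ho /and5P[ht _ _ _ _] ->].
  exact: ht.
suff -> : mkobjs r [seq o.1 | o <- os] (flatten [seq o.2 | o <- os]) = os by [].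
apply: (@eq_from_nth _ (0, [::])); rewrite size_map size_iota ?h1 // => i hi.
rewrite (nth_map 0) ?size_iota // nth_iota // add0n seg_flatten ?size_map ?h1 //.
by rewrite !(nth_map (0, [::])) ?h1 //; case: (nth _ os i).
Qed.

Lemma PB_exo r h (P : seq obj -> env -> bool) : PN h ->
  (forall ts, PB (fun e => P (mkobjs r ts (evars (r * gs) e)) (drop (r * gs) e))) ->
  PB (fun e => exo r (h e) (fun os => P os e)).
Proof.
move=> H HP; apply: (@PB_exl _ h (fun l e => has (fun ts => P (mkobjs r ts l) e) (LB r))) => //.
exact: (@PB_has_const _ (LB r) (fun ts e => P (mkobjs r ts (evars (r * gs) e)) (drop (r * gs) e))).
Qed.

Lemma PN_seg r i a : PN (fun e => nth 0 (seg (evars r e) i) a).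
Proof.
case: (ltnP a gs) => ha.
  by apply: PN_ext (PN_evars r (i * gs + a)) _ => e; rewrite [RHS]nth_mkseq.
by apply: PN_ext (PN_const 0) _ => e; rewrite nth_default ?size_mkseq.
Qed.

Lemma uniq_seg l i : uniq (seg l i) =
  all (fun a => all (fun b => (a == b) || (nth 0 (seg l i) a != nth 0 (seg l i) b)) (iota 0 gs)) (iota 0 gs).
Proof.
have hs : size (seg l i) = gs by rewrite size_mkseq.
apply/(uniqP 0)/allP => [h a ha|h a b]; rewrite ?hs.
  apply/allP => b hb; case: eqP => //= hab; apply/eqP => /h; rewrite !inE ?hs.
  by move: ha hb; rewrite !mem_iota => ha hb /(_ ha hb).
rewrite !inE ?hs => ha hb e; have /h /allP h' : a \in iota 0 gs by rewrite mem_iota.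
have hb' : b \in iota 0 gs by rewrite mem_iota.
by have := h' _ hb'; rewrite e eqxx orbF => /eqP.
Qed.

Lemma all_seg (p : nat -> bool) l i : all p (seg l i) = all (fun a => p (nth 0 (seg l i) a)) (iota 0 gs).
Proof.
rewrite /seg all_map; apply: eq_in_all => a; rewrite mem_iota => /andP[_ ha] /=.
by rewrite nth_mkseq.
Qed.

Lemma has_seg (p : nat -> bool) l i : has p (seg l i) = has (fun a => p (nth 0 (seg l i) a)) (iota 0 gs).
Proof.
rewrite /seg has_map; apply: eq_in_has => a; rewrite mem_iota => /andP[_ ha] /=.
by rewrite nth_mkseq.
Qed.

Section Atoms.
Variables (r : nat) (X : env -> seq bool).
Hypothesis HX : ptime X.

Lemma PB_occ t i : PB (fun e => occ W (gn (X e)) (adjs (X e)) (t, seg (evars r e) i)).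
Proof.
have Hn := PN_gn HX.
apply: PB_and; first exact: PB_const.
apply: PB_and; first by apply: PB_ext (PB_const true) _ => e; rewrite -[RHS]/(size (seg (evars r e) i) == gs) size_mkseq eqxx.
apply: PB_and.
  apply: PB_ext (@PB_all_const _ (iota 0 gs) (fun a e => nth 0 (seg (evars r e) i) a < gn (X e)) _) _.
    by move=> a; apply: PB_ltn => //; apply: PN_seg.
  by move=> e; apply: esym (all_seg _ _ _).
apply: PB_and.
  apply: PB_ext (@PB_all_const _ (iota 0 gs) (fun a e => all (fun b =>
    (a == b) || (nth 0 (seg (evars r e) i) a != nth 0 (seg (evars r e) i) b)) (iota 0 gs)) _) _.
    move=> a; apply: (@PB_all_const _ (iota 0 gs) (fun b e =>
      (a == b) || (nth 0 (seg (evars r e) i) a != nth 0 (seg (evars r e) i) b))) => b.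
    apply: PB_or (PB_const _) _; apply: PB_neg; apply: PB_eqn; exact: PN_seg.
  by move=> e; apply: esym (uniq_seg _ _).
apply: (@PB_all_const _ (iota 0 gs) (fun a e => all (fun b => K t a b ==>
  adjs (X e) (nth 0 (seg (evars r e) i) a) (nth 0 (seg (evars r e) i) b)) (iota 0 gs))) => a.
apply: (@PB_all_const _ (iota 0 gs) (fun b e => K t a b ==>
  adjs (X e) (nth 0 (seg (evars r e) i) a) (nth 0 (seg (evars r e) i) b))) => b.
apply: PB_ext (PB_or (PB_const (~~ K t a b)) (PB_adjs HX (PN_seg r i a) (PN_seg r i b))) _ => e.
by rewrite implybE.
Qed.

Lemma PB_touch t i t' i' : PB (fun e => touch (adjs (X e)) (t, seg (evars r e) i) (t', seg (evars r e) i')).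
Proof.
apply: PB_ext (@PB_has_const _ (iota 0 gs) (fun a e => has (fun b =>
   (nth 0 (seg (evars r e) i) a == nth 0 (seg (evars r e) i') b)
   || adjs (X e) (nth 0 (seg (evars r e) i) a) (nth 0 (seg (evars r e) i') b)) (iota 0 gs)) _) _.
  move=> a; apply: (@PB_has_const _ (iota 0 gs) (fun b e =>
   (nth 0 (seg (evars r e) i) a == nth 0 (seg (evars r e) i') b)
   || adjs (X e) (nth 0 (seg (evars r e) i) a) (nth 0 (seg (evars r e) i') b))) => b.
  by apply: PB_or; [apply: PB_eqn|apply: PB_adjs]; rewrite ?PN_seg //; apply: PN_seg.
move=> e; apply: esym; apply: etrans (has_seg _ _ _) _; apply: eq_has => a; exact: has_seg.
Qed.

Lemma PB_lft t i t' i' : PB (fun e => lft (adjs (X e)) (t, seg (evars r e) i) (t', seg (evars r e) i')).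
Proof. exact: PB_adjs HX (PN_seg r i 10) (PN_seg r i' 11). Qed.

Lemma PB_up t i t' i' : PB (fun e => up (adjs (X e)) (t, seg (evars r e) i) (t', seg (evars r e) i')).
Proof. exact: PB_adjs HX (PN_seg r i 12) (PN_seg r i' 13). Qed.

Lemma PB_share i i' : PB (fun e => has (fun u => u \in seg (evars r e) i') (seg (evars r e) i)).
Proof.
apply: PB_ext (@PB_has_const _ (iota 0 gs) (fun a e => has (fun b =>
   nth 0 (seg (evars r e) i) a == nth 0 (seg (evars r e) i') b) (iota 0 gs)) _) _.
  move=> a; apply: (@PB_has_const _ (iota 0 gs) (fun b e =>
   nth 0 (seg (evars r e) i) a == nth 0 (seg (evars r e) i') b)) => b.
  by apply: PB_eqn; apply: PN_seg.
move=> e; apply: esym; apply: etrans (has_seg _ _ _) _; apply: eq_has => a.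
rewrite -has_pred1; apply: etrans (has_seg _ _ _) _; apply: eq_has => b; exact: eq_sym.
Qed.

Lemma PB_eqo t i t' i' : PB (fun e => eqo W (t, seg (evars r e) i) (t', seg (evars r e) i')).
Proof.
apply: PB_and; first exact: (PB_const (t == t')).
apply: (@PB_all_const _ (iota 10 (gs - 10)) (fun p e =>
   nth 0 (seg (evars r e) i) p == nth 0 (seg (evars r e) i') p)) => p.
by apply: PB_eqn; apply: PN_seg.
Qed.

End Atoms.

Notation od := (0, [::] : seq nat).

Definition sbad (x : seq bool) : bool :=
  exo 5 (gn x) (fun os =>
    let: (o1, o2, o3, o4, o5) := (nth od os 0, nth od os 1, nth od os 2, nth od os 3, nth od os 4) in
    occs W (gn x) (adjs x) o1 o2 o3 o4 o5 && sviol W (adjs x) o1 o2 o3 o4 o5).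

Lemma sbadP x : reflect (~ struct_ok W (gn x) (adjs x)) (sbad x).
Proof.
apply: (iffP (exoP (n := gn x) (adj := adjs x) _)).
- move=> os; case: os => [|o1 [|o2 [|o3 [|o4 [|o5 [|]]]]]] //= _.
  by case/andP=> /andP[/and5P[h1 h2 h3 h4 h5] _] _; rewrite h1 h2 h3 h4 h5.
- case=> os; case: os => [|o1 [|o2 [|o3 [|o4 [|o5 [|]]]]]] //= _ /andP[h1 h2] ok.
  by have := ok _ _ _ _ _ h1; rewrite h2.
- move=> h; case: (excluded_middle_informative (exists o1 o2 o3 o4 o5,
    occs W (gn x) (adjs x) o1 o2 o3 o4 o5 && sviol W (adjs x) o1 o2 o3 o4 o5)) => [|hn].
    by move=> [o1 [o2 [o3 [o4 [o5 ho]]]]]; exists [:: o1; o2; o3; o4; o5].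
  case: h => o1 o2 o3 o4 o5 h1; apply/negP => h2; apply: hn.
  by exists o1, o2, o3, o4, o5; rewrite h1 h2.
Qed.

Lemma PB_sbad X : ptime X -> PB (fun e => sbad (X e)).
Proof.
move=> HX; rewrite /sbad.
apply: (@PB_exo 5 (fun e => gn (X e)) (fun os e =>
    let: (o1, o2, o3, o4, o5) := (nth od os 0, nth od os 1, nth od os 2, nth od os 3, nth od os 4) in
    occs W (gn (X e)) (adjs (X e)) o1 o2 o3 o4 o5 && sviol W (adjs (X e)) o1 o2 o3 o4 o5) (PN_gn HX)) => ts.
have HX' := ptime_dropenv (5 * gs) HX.
have HO t i := PB_occ (5 * gs) HX' t i.
have HT t i t' i' := PB_touch (5 * gs) HX' t i t' i'.
have HL t i t' i' := PB_lft (5 * gs) HX' t i t' i'.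
have HU t i t' i' := PB_up (5 * gs) HX' t i t' i'.
have HN i i' : PB (fun e => nth 0 (seg (evars (5 * gs) e) i) 10 != nth 0 (seg (evars (5 * gs) e) i') 10).
  by apply: PB_neg; apply: PB_eqn; apply: PN_seg.
rewrite /occs /sviol; repeat match goal with
  | |- PB (fun e => @?P e && @?Q e) => apply: (@PB_and P Q)
  | |- PB (fun e => @?P e || @?Q e) => apply: (@PB_or P Q)
  | |- PB (fun e => occ _ _ _ _) => exact: HO
  | |- PB (fun e => touch _ _ _) => exact: HT
  | |- PB (fun e => lft _ _ _) => exact: HL
  | |- PB (fun e => up _ _ _) => exact: HU
  | |- PB (fun e => has _ _) => exact: PB_share
  | |- PB (fun e => ~~ eqo _ _ _) => by apply: PB_neg; apply: PB_eqo
  | |- PB (fun e => ~~ (_ == _)) => exact: HN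
  end.
Qed.

Definition cellb (x : seq bool) (tau v : nat) : bool :=
  exo 1 (gn x) (fun os => let o := nth od os 0 in
    [&& occ W (gn x) (adjs x) o, o.1 == tau & o.[10] == v]).

Definition linkb (lk : (nat -> nat -> bool) -> obj -> obj -> bool) (x : seq bool) (v u : nat) : bool :=
  exo 2 (gn x) (fun os => let o := nth od os 0 in let o' := nth od os 1 in
    [&& occ W (gn x) (adjs x) o, occ W (gn x) (adjs x) o', lk (adjs x) o o', o.[10] == v & o'.[10] == u]).

Definition lftb := linkb lft.
Definition upb := linkb up.

Lemma cellbP x tau v : reflect (exists o, [/\ occ W (gn x) (adjs x) o, o.1 = tau & o.[10] = v]) (cellb x tau v).
Proof.
apply: (iffP (exoP (n := gn x) (adj := adjs x) _)).
- by case=> [|o [|]] //= _ /and3P[->].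
- by case=> -[|o [|]] //= _ /and3P[h1 /eqP h2 /eqP h3]; exists o.
- by case=> o [h1 h2 h3]; exists [:: o] => //=; rewrite h1 h2 h3 !eqxx.
Qed.

Lemma linkbP (lk : (nat -> nat -> bool) -> obj -> obj -> bool) x v u : reflect (exists o o', [/\ occ W (gn x) (adjs x) o, occ W (gn x) (adjs x) o',
   lk (adjs x) o o', o.[10] = v & o'.[10] = u]) (linkb lk x v u).
Proof.
apply: (iffP (exoP (n := gn x) (adj := adjs x) _)).
- by case=> [|o [|o' [|]]] //= _ /and5P[-> ->].
- by case=> -[|o [|o' [|]]] //= _ /and5P[h1 h2 h3 /eqP h4 /eqP h5]; exists o, o'.
- by case=> o [o' [h1 h2 h3 h4 h5]]; exists [:: o; o'] => //=; rewrite h1 h2 h3 h4 h5 !eqxx.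
Qed.

Lemma PB_cellb X tau v : ptime X -> PN v -> PB (fun e => cellb (X e) tau (v e)).
Proof.
move=> HX Hv; rewrite /cellb.
apply: (@PB_exo 1 (fun e => gn (X e)) (fun os e => let o := nth od os 0 in
    [&& occ W (gn (X e)) (adjs (X e)) o, o.1 == tau & o.[10] == v e]) (PN_gn HX)) => ts.
apply: PB_and; first exact: (PB_occ (1 * gs) (ptime_dropenv (1 * gs) HX)).
apply: PB_and; first exact: PB_const.
by apply: PB_eqn; [exact: (PN_seg (1 * gs) 0 10)|exact: (ptime_dropenv (1 * gs) Hv)].
Qed.

Lemma PB_linkb lk X v u : ptime X -> PN v -> PN u ->
  (forall r X' t i t' i', ptime X' ->
    PB (fun e => lk (adjs (X' e)) (t, seg (evars r e) i) (t', seg (evars r e) i'))) ->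
  PB (fun e => linkb lk (X e) (v e) (u e)).
Proof.
move=> HX Hv Hu Hlk; rewrite /linkb.
apply: (@PB_exo 2 (fun e => gn (X e)) (fun os e => let o := nth od os 0 in let o' := nth od os 1 in
    [&& occ W (gn (X e)) (adjs (X e)) o, occ W (gn (X e)) (adjs (X e)) o', lk (adjs (X e)) o o',
        o.[10] == v e & o'.[10] == u e]) (PN_gn HX)) => ts.
have HX' := ptime_dropenv (2 * gs) HX.
apply: PB_and; first exact: (PB_occ (2 * gs) HX' _ 0).
apply: PB_and; first exact: (PB_occ (2 * gs) HX' _ 1).
apply: PB_and; first exact: (Hlk (2 * gs) _ _ 0 _ 1 HX').
apply: PB_and; apply: PB_eqn.
- exact: (PN_seg (2 * gs) 0 10).
- exact: (ptime_dropenv (2 * gs) Hv).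
- exact: (PN_seg (2 * gs) 1 10).
- exact: (ptime_dropenv (2 * gs) Hu).
Qed.

Lemma PB_lftb X v u : ptime X -> PN v -> PN u -> PB (fun e => lftb (X e) (v e) (u e)).
Proof. by move=> HX Hv Hu; apply: PB_linkb => // r X' t i t' i' H; apply: PB_lft. Qed.

Lemma PB_upb X v u : ptime X -> PN v -> PN u -> PB (fun e => upb (X e) (v e) (u e)).
Proof. by move=> HX Hv Hu; apply: PB_linkb => // r X' t i t' i' H; apply: PB_up. Qed.

End Objects.

(** * Computing the forced values and reading off the words *)

Section Decoder.
Variables VM DM : TM.
Notation cellb := (cellb (WT VM DM)).
Notation lftb := (lftb (WT VM DM)).
Notation upb := (upb (WT VM DM)).

Definition DTy : finType := Dt DM.
Definition en : seq DTy := enum DTy.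
Definition nd := #|DTy|.

Definition tabget (tab : seq bool) (v : nat) (w : DTy) := nth false tab (v * nd + index w en).

Definition rule_top x tab tau v (w : DTy) : bool :=
  cellb x tau v && has (fun u => lftb x v u &&
    has (fun w1 => tabget tab u w1 && (topD tau w1 == Some w)) en) (iota 0 (gn x)).
Definition rule_left x tab v (w : DTy) : bool :=
  cellb x 5 v && has (fun u => upb x v u &&
    has (fun w1 => tabget tab u w1 && (leftD w1 == Some w)) en) (iota 0 (gn x)).
Definition rule_inn x tab v (w : DTy) : bool :=
  (cellb x 6 v || cellb x 7 v) &&
  has (fun u => lftb x v u && has (fun u' => upb x v u' &&
    has (fun w1 => has (fun w2 => [&& tabget tab u w1, tabget tab u' w2
       & innD w1 w2 == Some w]) en) en) (iota 0 (gn x))) (iota 0 (gn x)).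

Definition rule x tab v (w : DTy) : bool :=
  [|| (w == rootD DM :> DTy) && cellb x 0 v, has (fun tau => rule_top x tab tau v w) [:: 1; 2; 3; 4],
      rule_left x tab v w | rule_inn x tab v w].

(* Each round extends the set of known pairs (anchor, deterministic value) along the links. *)
Definition dpstep x tab : seq bool :=
  mkseq (fun i => has (fun w => (i %% nd == index w en) && rule x tab (i %/ nd) w) en) (gn x * nd).

(** The value of the cell in row [t] and column [size s] is known after [t + size s + 1] rounds, and
    both coordinates are below [gn x]. *)
Definition tabf x := iter (2 * gn x + 1) (dpstep x) [::].

Definition finalb x v := cellb x 7 v && has (fun w => okF w && tabget (tabf x) v w) en.

(** Cells of the top row are fixed points, so [gn x] iterations reach the top row from any row of a
    grid; [nextl] likewise stops at the root. *)
Definition nextu x v := if has (fun tau => cellb x tau v) [:: 0; 1; 2; 3; 4] then v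
  else find (fun u => upb x v u) (iota 0 (gn x)).
Definition nextl x v := if cellb x 0 v then v else find (fun u => lftb x v u) (iota 0 (gn x)).
Definition bitw x v : seq bool :=
  if cellb x 1 v then [:: false] else if cellb x 2 v then [:: true] else [::].
Definition topw x v := iter (gn x) (nextu x) v.
(** The columns are visited with the leftmost one at index 0; surplus indices stay at the root,
    whose bit word is empty. *)
Definition word x v :=
  flatten (mkseq (fun i => bitw x (iter (gn x - i.+1) (nextl x) (topw x v))) (gn x)).

Definition gdec (n0 x : seq bool) : seq bool :=
  if sbad (WT VM DM) x then zx n0 else
  flatten (mkseq (fun v => if finalb x v then word x v else [::]) (gn x)).

Lemma PB_tabget T v w : ptime T -> PN v -> PB (fun e => tabget (T e) (v e) w).
Proof.
by move=> HT Hv; apply: (@PB_nth (fun e => v e * nd + index w en) T) => //; pn.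
Qed.

Let PV : PN (fun e => size (nth [::] e 0)) := PN_size (ptime_var 0).

Lemma PB_rule X T v w : ptime X -> ptime T -> PN v -> PB (fun e => rule (X e) (T e) (v e) w).
Proof.
move=> HX HT Hv; have Hn := PN_gn HX.
have HX1 := ptime_shift HX; have HT1 := ptime_shift HT; have Hv1 : PN (fun e => v (behead e)) := ptime_shift Hv.
have Hn1 : PN (fun e => gn (X (behead e))) := ptime_shift Hn.
apply: PB_or; first by apply: PB_and (PB_const _) _; apply: PB_cellb.
apply: PB_or.
  apply: (@PB_has_const _ [:: 1; 2; 3; 4] (fun tau e => rule_top (X e) (T e) tau (v e) w)) => tau.
  apply: PB_and; first exact: PB_cellb.
  apply: (@PB_ex _ (fun u e => lftb (X e) (v e) u &&
    has (fun w1 => tabget (T e) u w1 && (topD tau w1 == Some w)) en) Hn).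
  apply: PB_and; first exact: PB_lftb.
  apply: (@PB_has_const _ en (fun w1 e => tabget (T (behead e)) (size (nth [::] e 0)) w1 && (topD tau w1 == Some w))) => w1.
  by apply: PB_and (PB_const _); apply: PB_tabget.
apply: PB_or.
  apply: PB_and; first exact: PB_cellb.
  apply: (@PB_ex _ (fun u e => upb (X e) (v e) u &&
    has (fun w1 => tabget (T e) u w1 && (leftD w1 == Some w)) en) Hn).
  apply: PB_and; first exact: PB_upb.
  apply: (@PB_has_const _ en (fun w1 e => tabget (T (behead e)) (size (nth [::] e 0)) w1 && (leftD w1 == Some w))) => w1.
  by apply: PB_and (PB_const _); apply: PB_tabget.
apply: PB_and; first by apply: PB_or; apply: PB_cellb.
apply: (@PB_ex _ (fun u e => lftb (X e) (v e) u && has (fun u' => upb (X e) (v e) u' &&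
    has (fun w1 => has (fun w2 => [&& tabget (T e) u w1, tabget (T e) u' w2
       & innD w1 w2 == Some w]) en) en) (iota 0 (gn (X e)))) Hn).
apply: PB_and; first exact: PB_lftb.
apply: (@PB_ex _ (fun u' e => upb (X (behead e)) (v (behead e)) u' &&
    has (fun w1 => has (fun w2 => [&& tabget (T (behead e)) (size (nth [::] e 0)) w1, tabget (T (behead e)) u' w2
       & innD w1 w2 == Some w]) en) en) Hn1).
have HX2 := ptime_shift HX1; have HT2 := ptime_shift HT1.
have Hv2 : PN (fun e => v (behead (behead e))) := ptime_shift Hv1.
apply: PB_and; first exact: PB_upb.
apply: (@PB_has_const _ en (fun w1 e => has (fun w2 =>
  [&& tabget (T (behead (behead e))) (size (nth [::] (behead e) 0)) w1,
      tabget (T (behead (behead e))) (size (nth [::] e 0)) w2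
       & innD w1 w2 == Some w]) en)) => w1.
apply: (@PB_has_const _ en (fun w2 e =>
  [&& tabget (T (behead (behead e))) (size (nth [::] (behead e) 0)) w1,
      tabget (T (behead (behead e))) (size (nth [::] e 0)) w2
       & innD w1 w2 == Some w])) => w2.
apply: PB_and; first by apply: PB_tabget => //; exact: (PN_varb 1 0).
by apply: PB_and (PB_const _); apply: PB_tabget.
Qed.

Lemma ptime_dpstep X T : ptime X -> ptime T -> ptime (fun e => dpstep (X e) (T e)).
Proof.
move=> HX HT; have Hn := PN_gn HX.
apply: (@ptime_mkseq (fun e => gn (X e) * nd) (fun i e =>
  has (fun w => (i %% nd == index w en) && rule (X e) (T e) (i %/ nd) w) en)); first by pn.
apply: (@PB_has_const _ en (fun w e => (size (nth [::] e 0) %% nd == index w en) &&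
  rule (X (behead e)) (T (behead e)) (size (nth [::] e 0) %/ nd) w)) => w.
apply: PB_and; first by pn.
by apply: PB_rule; [exact: ptime_shift HX|exact: ptime_shift HT|pn].
Qed.

Lemma iteri_const (A : Type) (f : A -> A) n a : iteri n (fun _ => f) a = iter n f a.
Proof. by elim: n => //= n ->. Qed.

Lemma ptime_tabf X : ptime X -> ptime (fun e => tabf (X e)).
Proof.
move=> HX; have Hn := PN_gn HX.
pose S (acc : seq bool) (i : nat) (e : env) := dpstep (X e) acc.
have HK : PN (fun e => 2 * gn (X e) + 1) by pn.
have E e n : nrec (fun _ => [::]) S e n = iter n (dpstep (X e)) [::] by exact: iteri_const.
have HnN : PN (fun e => gn (X e) * nd) by pn.
have [B hB hB'] := PN_le HnN.
apply: ptime_ext (@ptime_nrec _ (fun _ => [::]) S HK ptime_nil _ _) _ => [||e]; last exact: E.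
  by apply: ptime_dpstep (ptime_var 0); exact: ptime_shift (ptime_shift HX).
exists B => // e n; rewrite E; case: n => [|n] //=.
rewrite size_mkseq; apply: leq_trans (hB' e) _; apply: hB.1; exact: leq_addr.
Qed.

Lemma PB_finalb X v : ptime X -> PN v -> PB (fun e => finalb (X e) (v e)).
Proof.
move=> HX Hv; apply: PB_and; first exact: PB_cellb.
apply: (@PB_has_const _ en (fun w e => okF w && tabget (tabf (X e)) (v e) w)) => w.
by apply: PB_and (PB_const _) _; apply: PB_tabget => //; apply: ptime_tabf.
Qed.

Lemma PN_nextu X v : ptime X -> PN v -> PN (fun e => nextu (X e) (v e)).
Proof.
move=> HX Hv; apply: PN_if => //.
  by apply: (@PB_has_const _ _ (fun tau e => cellb (X e) tau (v e))) => tau; apply: PB_cellb.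
apply: (@PN_find _ (fun u e => upb (X e) (v e) u) (PN_gn HX)).
by apply: PB_upb; [exact: ptime_shift HX|exact: ptime_shift Hv|].
Qed.

Lemma PN_nextl X v : ptime X -> PN v -> PN (fun e => nextl (X e) (v e)).
Proof.
move=> HX Hv; apply: PN_if => //; first exact: PB_cellb.
apply: (@PN_find _ (fun u e => lftb (X e) (v e) u) (PN_gn HX)).
by apply: PB_lftb; [exact: ptime_shift HX|exact: ptime_shift Hv|].
Qed.

Lemma iter_le (f : nat -> nat) n v i : (forall u, f u = u \/ f u <= n) -> iter i f v <= v + n.
Proof.
move=> h; elim: i => [|i IH] /=; first exact: leq_addr.
by case: (h (iter i f v)) => [->|h'] //; apply: leq_trans h' (leq_addl _ _).
Qed.

Lemma find_le (T : Type) (p : T -> bool) s n : size s = n -> find p s <= n.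
Proof. by move=> <-; apply: find_size. Qed.

Lemma PN_iter_next nx X h v : ptime X -> PN h -> PN v ->
  (forall Y u, ptime Y -> PN u -> PN (fun e => nx (Y e) (u e))) ->
  (forall x u, nx x u = u \/ nx x u <= gn x) ->
  PN (fun e => iter (h e) (nx (X e)) (v e)).
Proof.
move=> HX Hh Hv Hnx hle.
apply: (@PN_iter h v (fun u e => nx (X e) u)) => //.
  by apply: Hnx PV; exact: ptime_shift HX.
have HK : PN (fun e => v e + gn (X e)) by apply: PN_add => //; apply: PN_gn.
have [B hB hB'] := PN_le HK; exists B => // e n.
apply: leq_trans (iter_le _ _ (n := gn (X e)) _) _; first exact: hle.
by apply: leq_trans (hB' e) _; apply: hB.1; exact: leq_addr.
Qed.

Lemma nextu_le x u : nextu x u = u \/ nextu x u <= gn x.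
Proof. by rewrite /nextu; case: ifP => _; [left|right; apply: find_le; rewrite size_iota]. Qed.

Lemma nextl_le x u : nextl x u = u \/ nextl x u <= gn x.
Proof. by rewrite /nextl; case: ifP => _; [left|right; apply: find_le; rewrite size_iota]. Qed.

Lemma ptime_word X v : ptime X -> PN v -> ptime (fun e => word (X e) (v e)).
Proof.
move=> HX Hv; have Hn := PN_gn HX.
apply: (@ptime_flatten _ (fun i e => bitw (X e) (iter (gn (X e) - i.+1) (nextl (X e)) (topw (X e) (v e)))) Hn).
have HX1 := ptime_shift HX; have Hn1 : PN (fun e => gn (X (behead e))) := ptime_shift Hn.
have Hu : PN (fun e => iter (gn (X (behead e)) - (size (nth [::] e 0)).+1) (nextl (X (behead e)))
    (topw (X (behead e)) (v (behead e)))).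
  apply: (@PN_iter_next nextl (fun e => X (behead e))) => //; first by pn.
  - apply: (@PN_iter_next nextu (fun e => X (behead e))) => //; first exact: ptime_shift Hv.
      exact: PN_nextu.
    exact: nextu_le.
  - exact: PN_nextl.
  - exact: nextl_le.
apply: ptime_if; [exact: PB_cellb|exact: ptime_const|].
by apply: ptime_if; [exact: PB_cellb|exact: ptime_const|exact: ptime_nil].
Qed.

Lemma gdec_computable n0 : poly_computable (gdec n0).
Proof.
apply: (@ptime_computable (fun e => gdec n0 (nth [::] e 0))).
have H0 := ptime_var 0; have H1 := ptime_shift H0.
apply: ptime_if; [exact: PB_sbad|exact: ptime_const|].
apply: (@ptime_flatten _ (fun v e => if finalb (nth [::] e 0) v then word (nth [::] e 0) v else [::])).
  exact: PN_gn.
by apply: ptime_if; [exact: PB_finalb|exact: ptime_word|exact: ptime_nil].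
Qed.

End Decoder.

(** A pigeonhole argument for a relation: [a] determines [i], so distinct [i] need distinct [a]. *)
Lemma inj_bound n k (R : nat -> nat -> Prop) :
  (forall i, i < k -> exists2 a, a < n & R i a) ->
  (forall i j a, R i a -> R j a -> i = j) -> k <= n.
Proof.
move=> h1 h2; pose f i := epsilon (inhabits 0) (fun a => a < n /\ R i a).
have hf i : i < k -> f i < n /\ R i (f i).
  move=> hi; apply: (epsilon_spec (inhabits 0) (fun a => a < n /\ R i a)).
  by have [a ha hR] := h1 i hi; exists a.
have hu : uniq (map f (iota 0 k)).
  rewrite map_inj_in_uniq ?iota_uniq // => i j; rewrite !mem_iota !add0n => /andP[_ /hf[_ hi]] /andP[_ /hf[_ hj]] e.
  by apply: h2 hi _; rewrite e.
rewrite -(size_iota 0 k) -(size_map f) -(size_iota 0 n); apply: uniq_leq_size => // a /mapP[i].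
by rewrite !mem_iota add0n => /andP[_ /hf[hi _]] ->.
Qed.

Lemma flatten_mkseqS (T : Type) (f : nat -> seq T) n :
  flatten (mkseq f n.+1) = flatten (mkseq f n) ++ f n.
Proof. by rewrite mkseqS flatten_rcons. Qed.

(** * Correctness of the decoder *)

Section DecoderCorrect.
Variables (VM DM : TM) (x : seq bool).
Notation WW := (WT VM DM).
Notation n := (gn x).
Notation adj := (adjs x).
Notation occ := (occ WW n adj).
Notation grid := (grid WW n adj).
Notation at_ := (at_ VM DM n (gb x)).
Notation cellb := (cellb WW x).
Notation lftb := (lftb WW x).
Notation upb := (upb WW x).
Notation en := (en DM).
Notation nd := (nd DM).
Notation tabget := (@tabget DM).
Notation rule := (@rule VM DM x).
Notation dpstep := (@dpstep VM DM x).
Hypothesis hw : wf_graph n (gb x).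
Hypothesis ok : struct_ok WW n adj.

Let asym u v : u < n -> v < n -> adj u v = adj v u.
Proof. exact: adjn_sym. Qed.
Let g10 : 10 < gs WW := leq_trans (isT : 10 < 20) (gs_ge WW).

Lemma at_lt v t s : at_ v t s -> v < n.
Proof. by move=> [o h <-]; apply: (occ_lt (grid_occ h) g10). Qed.

Lemma at_cellb v t s : at_ v t s -> exists2 tau, cellb tau v & exists2 o, grid o t s & o.1 = tau /\ o.[10] = v.
Proof.
move=> [o h e]; exists o.1; last by exists o.
by apply/cellbP; exists o; split=> //; apply: grid_occ h.
Qed.

Lemma cellb_fun tau tau' v : cellb tau v -> cellb tau' v -> tau = tau'.
Proof.
move=> /cellbP[o [h1 <- h2]] /cellbP[o' [h1' <- h2']].
by have /andP[/eqP] := anchor_eqo ok h1 h1' (etrans h2 (esym h2')).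
Qed.

Lemma at_rows v t s : at_ v t s -> forall t', t' <= t -> exists v', at_ v' t' s.
Proof.
elim: t v => [|t IH] v h t'; first by rewrite leqn0 => /eqP ->; exists v.
rewrite leq_eqVlt => /orP[/eqP ->|ht]; first by exists v.
case: h => o ho _; have [e _ he] := grid_up ho.
by apply: (IH e.[10]) => //; exists e.
Qed.

Lemma at_cols v t s : at_ v t s -> forall j, j <= size s -> exists v' s', at_ v' t s' /\ size s' = j.
Proof.
elim: s v => [|y s IH] v h j; first by rewrite leqn0 => /eqP ->; exists v, [::].
rewrite leq_eqVlt => /orP[/eqP ->|hj]; first by exists v, (y :: s).
case: h => o ho _; have [d _ hd] := grid_lft ho.
by apply: (IH d.[10]) => //; exists d.
Qed.

(** The cells above, and likewise those to the left, have pairwise different coordinates and hence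
    pairwise different anchors among the [n] vertices. *)
Lemma at_bound v t s : at_ v t s -> t < n /\ size s < n.
Proof.
move=> h; split.
  apply: (@inj_bound n t.+1 (fun i a => at_ a i s)) => [i|i j a h1 h2].
    by rewrite ltnS => /(at_rows h) [v' h']; exists v' => //; apply: at_lt h'.
  by have [] := at_fun hw ok h1 h2.
apply: (@inj_bound n (size s).+1 (fun i a => exists s', at_ a t s' /\ size s' = i)) => [i|i j a [s1 [h1 <-]] [s2 [h2 <-]]].
  rewrite ltnS => /(at_cols h) [v' [s' [h' e]]]; exists v'; first exact: at_lt h'.
  by exists s'.
by have [_ ->] := at_fun hw ok h1 h2.
Qed.

Lemma tabget_step tab v w : v < n -> tabget (dpstep tab) v w = rule tab v w.
Proof.
move=> hv; have hi : index w en < nd by rewrite /nd cardE index_mem mem_enum.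
rewrite /tabget /dpstep nth_mkseq; last first.
  apply: (@leq_trans (v.+1 * nd)); first by rewrite mulSn addnC ltn_add2r.
  by rewrite leq_mul2r hv orbT.
rewrite divn_pair // modn_pair //; apply/hasP/idP.
  move=> [w' _ /andP[/eqP e h]]; suff -> : w = w' by [].
  by rewrite -(nth_index w (mem_enum _ w) : nth w en (index w en) = w) e nth_index // mem_enum.
by move=> h; exists w; rewrite ?mem_enum // eqxx.
Qed.

Lemma tabget_lt tab v w : tabget (dpstep tab) v w -> v < n.
Proof.
move=> h; rewrite ltnNge; apply/negP => hv; move: h; rewrite /tabget nth_default //.
by rewrite size_mkseq; apply: leq_trans (leq_addr _ _); rewrite leq_mul2r hv orbT.
Qed.

Lemma en_mem (w : DTy DM) : w \in en. Proof. exact: mem_enum. Qed.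

Lemma lftbP v u : reflect (exists o o', [/\ occ o, occ o', lft adj o o', o.[10] = v & o'.[10] = u]) (lftb v u).
Proof. exact: linkbP. Qed.
Lemma upbP v u : reflect (exists o o', [/\ occ o, occ o', up adj o o', o.[10] = v & o'.[10] = u]) (upb v u).
Proof. exact: linkbP. Qed.

(** The flags in a value tell whether it belongs to row 0 or column 0, so a rule fires only on
    neighbours of the right kind, and [grid_square] aligns the grids of the two neighbours of an
    inner cell. *)
Lemma tab_sound i v w : tabget (iter i dpstep [::]) v w ->
  exists t s, at_ v t s /\ DV DM t (labs s) = Some w.
Proof.
elim: i v w => [|i IH] v w; first by rewrite /tabget nth_nil.
rewrite iterS => h; have hv := tabget_lt h; move: h; rewrite tabget_step //.
have lab tau o : cellb tau v -> occ o -> o.[10] = v -> o.1 = tau.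
  move=> /cellbP[o' [h1 <- h2]] h3 h4.
  by have /andP[/eqP] := anchor_eqo ok h3 h1 (etrans h4 (esym h2)).
case/or4P.
- case/andP=> /eqP -> /cellbP[o [h1 h2 h3]]; exists 0, [::]; split=> //.
  by exists o => //; apply: GRoot.
- case/hasP=> tau htau /andP[hc /hasP[u _ /andP[/lftbP[o [o' [h1 h2 h3 h4 h5]]] /hasP[w1 _ /andP[/IH]]]]].
  rewrite -h5 => -[t [s [ha hd]]] /eqP ht.
  have e0 : t = 0.
    have [_ e] := DV_fields hd; move: ht; rewrite /topD e; by case: eqP.
  subst t; have [o2 h6 h7] := at_lft ok h2 ha h3; have el := lab _ _ hc h1 h4.
  exists 0, ((tau, v) :: s); split; last by rewrite /labs /= DV_top hd.
  exists o => //; rewrite -el -h4; apply: GTop h7 => //; rewrite el.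
  by move: htau; rewrite !inE => /or4P[] /eqP ->.
- case/andP=> hc /hasP[u _ /andP[/upbP[o [o' [h1 h2 h3 h4 h5]]] /hasP[w1 _ /andP[/IH]]]].
  rewrite -h5 => -[t [s [ha hd]]] /eqP ht.
  have e0 : s = [::].
    have [e _] := DV_fields hd; move: ht; rewrite /leftD e; by case: (s).
  subst s; have [o2 h6 h7] := at_up ok h2 ha h3; have el := lab _ _ hc h1 h4.
  exists t.+1, [::]; split; last by rewrite /labs /= DV_left hd.
  by exists o => //; apply: GLeft h7.
case/andP=> hc /hasP[u _ /andP[/lftbP[o [o' [h1 h2 h3 h4 h5]]]]].
case/hasP=> u' _ /andP[/upbP[p [p' [k1 k2 k3 k4 k5]]]] /hasP[w1 _ /hasP[w2 _ /and3P[/IH + /IH]]].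
rewrite -h5 -k5 => -[t1 [s1 [ha hd]]] [t2 [s2 [ha' hd']]] /eqP ht.
have [hT hLs] : t1 <> 0 /\ s2 <> [::].
  have [_ e] := DV_fields hd; have [e' _] := DV_fields hd'; move: ht; rewrite /innD e e'.
  by split=> e0; move: ht; rewrite e0 ?andbF.
have heq := anchor_eqo ok h1 k1 (etrans h4 (esym k4)); rewrite -(eqo_up _ _ heq) in k3.
have [o2 h6 h7] := at_lft ok h2 ha h3; have [o3 h8 h9] := at_up ok k2 ha' k3.
case: t1 hT ha hd h6 => // t1 _ ha hd h6.
have [et [y es]] := grid_square ok asym h1 h7 h9 h6 h8 hLs; subst t2 s2.
exists t1.+1, (y :: s1); split; last by rewrite /labs /= DV_inn [X in obind _ X]hd /= [X in obind _ X]hd'.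
exists o => //; apply: GInn h7 h9 => //.
by case/orP: hc => hc; rewrite (lab _ _ hc h1 h4).
Qed.

Lemma tab_complete o t s : grid o t s -> forall w i, DV DM t (labs s) = Some w ->
  t + size s < i -> tabget (iter i dpstep [::]) o.[10] w.
Proof.
have hn o' t' s' : grid o' t' s' -> o'.[10] \in iota 0 n.
  by move=> h; rewrite mem_iota; apply: (occ_lt (grid_occ h) g10).
have hcl o' : occ o' -> cellb o'.1 o'.[10] by move=> h; apply/cellbP; exists o'.
elim=> {o t s} [o ho e0|o d s ho hl hd IH hld|o e t ho h5 he IH hu|o d e t y s ho h6 hd IHd he IHe hld hu]
  w [//|i] hw' hi; rewrite iterS tabget_step ?(occ_lt ho g10) //; apply/or4P.
- by apply: Or41; case: hw' => <-; have := hcl _ ho; rewrite e0 => ->; rewrite andbT; apply/eqP.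
- apply: Or42; apply/hasP; exists o.1.
    by move: hl; case: (o.1) => [|[|[|[|[|]]]]].
  apply/andP; split; first exact: hcl.
  apply/hasP; exists d.[10]; first exact: hn hd.
  apply/andP; split; first by apply/lftbP; exists o, d; rewrite (grid_occ hd).
  move: hw'; rewrite /labs /= DV_top; case E : (DV DM 0 (map fst s)) => [w1|] //= hw'.
  by apply/hasP; exists w1; rewrite ?en_mem // hw' eqxx andbT; apply: IH.
- have hc := hcl _ ho; rewrite h5 in hc; apply: Or43; apply/andP; split; first exact: hc.
  apply/hasP; exists e.[10]; first exact: hn he.
  apply/andP; split; first by apply/upbP; exists o, e; rewrite (grid_occ he).
  move: hw'; rewrite /labs [map _ _]/= DV_left; case E : (DV DM t [::]) => [w1|] //= hw'.
  by apply/hasP; exists w1; rewrite ?en_mem // hw' eqxx andbT; apply: IH.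
apply: Or44; apply/andP; split.
  have : o.1 < 8 by case/and5P: ho.
  have := hcl _ ho; move: h6; case: (o.1) => [|[|[|[|[|[|[|[|]]]]]]]] // _ ->; by rewrite ?orbT.
apply/hasP; exists d.[10]; first exact: hn hd.
apply/andP; split; first by apply/lftbP; exists o, d; rewrite (grid_occ hd).
apply/hasP; exists e.[10]; first exact: hn he.
apply/andP; split; first by apply/upbP; exists o, e; rewrite (grid_occ he).
move: hw'; rewrite /labs /= DV_inn.
case E : (DV DM t.+1 (map fst s)) => [w1|] //=; case E' : (DV DM t _) => [w2|] //= hw'.
apply/hasP; exists w1; rewrite ?en_mem //; apply/hasP; exists w2; rewrite ?en_mem //.
have hi' : t.+1 + size s < i by move: hi; rewrite /= addnS addSn.
rewrite hw' eqxx andbT; apply/andP; split; first exact: IHd.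
by apply: IHe => //; rewrite /= addnS.
Qed.

Lemma at_nextu v t s : at_ v t.+1 s -> at_ (nextu VM DM x v) t s.
Proof.
move=> h; have [tau hc [o ho [e1 e2]]] := at_cellb h.
have h5 : 5 <= tau.
  have [k1 k2 _ _] := grid_inv ho; rewrite e1 in k1 k2.
  case: (tau) k1 k2 => [|[|[|[|[|]]]]] // k1 k2; first by case: (k1 erefl).
  1-4: by case: (k2 isT).
rewrite /nextu ifF; last first.
  apply/negbTE/hasPn => tau'; apply: contraL => /(cellb_fun hc) <-; rewrite !inE !negb_or.
  by case: (tau) h5 => [|[|[|[|[|]]]]].
have [e hu he] := grid_up ho; have hoo := grid_occ ho; have heo := grid_occ he.
have hub : upb v e.[10] by apply/upbP; exists o, e.
have hh : has (fun u => upb v u) (iota 0 n).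
  by apply/hasP; exists e.[10] => //; rewrite mem_iota; apply: (occ_lt heo g10).
have := nth_find 0 hh; have hlt := hh; rewrite has_find size_iota in hlt.
rewrite nth_iota // add0n => /upbP[p [p' [k1 k2 k3 k4 <-]]].
rewrite -k4 in h; exact: (at_inv_up hw ok k1 k2 k3 h).
Qed.

Lemma nextu_top v s : at_ v 0 s -> nextu VM DM x v = v.
Proof.
move=> h; have [tau hc [o ho [e1 e2]]] := at_cellb h.
rewrite /nextu ifT //; apply/hasP; exists tau => //.
have [_ _ k1 k2] := grid_inv ho; rewrite e1 in k1 k2.
have h8 : tau < 8 by rewrite -e1; case/and5P: (grid_occ ho).
case: (tau) h8 k1 k2 => [|[|[|[|[|[|tau']]]]]] // _ k1 k2; first by case: (k1 erefl) => _ [].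
by have [t' [? [? []]]] := k2 isT.
Qed.

Lemma at_topw v t s : at_ v t s -> at_ (topw VM DM x v) 0 s.
Proof.
move=> h; have [ht _] := at_bound h; rewrite /topw.
have E i : t <= i -> at_ (iter i (nextu VM DM x) v) 0 s; last by apply: E; apply: ltnW.
elim: t v h i {ht} => [|t IH] v h i hi.
  suff -> : iter i (nextu VM DM x) v = v by [].
  by elim: i {hi} => //= i ->; apply: nextu_top h.
by case: i hi => // i hi; rewrite iterSr; apply: IH => //; apply: at_nextu.
Qed.

Lemma at_nextl v p s : at_ v 0 (p :: s) -> at_ (nextl VM DM x v) 0 s.
Proof.
move=> h; have [tau hc [o ho [e1 e2]]] := at_cellb h.
rewrite /nextl ifF; last first.
  apply/negP => /(cellb_fun hc) e0; have [k1 _ _ _] := grid_inv ho.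
  by rewrite e1 in k1; case: (k1 e0).
have [d hl hd] := grid_lft ho; have hoo := grid_occ ho; have hdo := grid_occ hd.
have hub : lftb v d.[10] by apply/lftbP; exists o, d.
have hh : has (fun u => lftb v u) (iota 0 n).
  by apply/hasP; exists d.[10] => //; rewrite mem_iota; apply: (occ_lt hdo g10).
have := nth_find 0 hh; have hlt := hh; rewrite has_find size_iota in hlt.
rewrite nth_iota // add0n => /lftbP[q [q' [k1 k2 k3 k4 <-]]].
rewrite -k4 in h; exact: (at_inv_lft hw ok k1 k2 k3 h).
Qed.

Lemma nextl_root v : at_ v 0 [::] -> nextl VM DM x v = v /\ bitw VM DM x v = [::].
Proof.
move=> h; have [tau hc [o ho [e1 e2]]] := at_cellb h.
have e0 : tau = 0.
  have h8 : tau < 8 by rewrite -e1; case/and5P: (grid_occ ho).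
  have [_ k1 k2 k3] := grid_inv ho; rewrite e1 in k1 k2 k3.
  case: (tau) h8 k1 k2 k3 => [|[|[|[|[|[|t']]]]]] // _ k1 k2 k3.
  1-4: by have [_ []] := k1 isT.
    by have [_ []] := k2 erefl.
  by have [? [? [? []]]] := k3 isT.
subst tau; rewrite /nextl e0 in hc *; rewrite hc; split=> //; rewrite /bitw.
by case: ifP => [/(cellb_fun hc)//|_]; case: ifP => [/(cellb_fun hc)|].
Qed.

Lemma bitw_top v p s : at_ v 0 (p :: s) -> zof (labs (p :: s)) = zof (labs s) ++ bitw VM DM x v.
Proof.
move=> h; have [tau hc [o ho [e1 e2]]] := at_cellb h.
have ep : p.1 = tau.
  have h8 : tau < 8 by rewrite -e1; case/and5P: (grid_occ ho).
  have [k0 k1 k2 k3] := grid_inv ho; rewrite e1 in k0 k1 k2 k3.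
  case: (tau) h8 k0 k1 k2 k3 => [|[|[|[|[|[|t']]]]]] // _ k0 k1 k2 k3.
  - by case: (k0 erefl).
  1-4: by have [_ [s' [-> _]]] := k1 isT.
  - by case: (k2 erefl).
  - by have [? [? [? []]]] := k3 isT.
rewrite /zof /labs [map fst _]/= ep rev_cons filter_rcons /bitw.
case: ifP => [|hn].
  case/orP=> /eqP et; rewrite et in hc *; rewrite map_rcons -cats1.
    by rewrite hc.
  by rewrite ifF ?hc //; apply/negP => /(cellb_fun hc).
rewrite !ifF ?cats0 //; apply/negP => /(cellb_fun hc) et; by rewrite et in hn.
Qed.

Lemma word_top m s a : size s <= m -> at_ a 0 s ->
  flatten (mkseq (fun i => bitw VM DM x (iter (m - i.+1) (nextl VM DM x) a)) m) = zof (labs s).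
Proof.
elim: m s a => [|m IH] s a hs h; first by case: s hs h.
have E : flatten (mkseq (fun i => bitw VM DM x (iter (m.+1 - i.+1) (nextl VM DM x) a)) m.+1) =
  flatten (mkseq (fun i => bitw VM DM x (iter (m - i.+1) (nextl VM DM x) (nextl VM DM x a))) m)
   ++ bitw VM DM x a.
  apply: etrans (flatten_mkseqS _ _) _; rewrite subnn.
  apply: (congr1 (fun z => flatten z ++ bitw VM DM x a)); rewrite /mkseq.
  apply: (proj1 (eq_in_map _ _ _)) => i.
  rewrite mem_iota add0n => /andP[_ hi].
  have -> : m.+1 - i.+1 = (m - i.+1).+1 by rewrite subSS -subSn.
  by rewrite iterSr.
rewrite E; case: s hs h => [|p s] hs h.
  have [-> ->] := nextl_root h; rewrite cats0; exact: IH h.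
by rewrite (bitw_top h) (IH s) //; apply: at_nextl h.
Qed.

Lemma word_zof v t s : at_ v t s -> word VM DM x v = zof (labs s).
Proof.
move=> h; have [_ hs] := at_bound h; exact: word_top (ltnW hs) (at_topw h).
Qed.

Lemma finalb_at v : finalb VM DM x v -> exists o t s w,
  [/\ grid o t s, o.[10] = v, o.1 = 7, DV DM t (labs s) = Some w & okF w].
Proof.
case/andP=> hc /hasP[w _ /andP[hF /tab_sound[t [s [h hd]]]]].
have [tau hc' [o ho [e1 e2]]] := at_cellb h.
by exists o, t, s, w; split=> //; rewrite e1 (cellb_fun hc' hc).
Qed.

Lemma at_finalb o t s w : grid o t s -> o.1 = 7 -> DV DM t (labs s) = Some w -> okF w ->
  finalb VM DM x o.[10].
Proof.
move=> h h7 hd hF; apply/andP; split.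
  by apply/cellbP; exists o; split=> //; apply: grid_occ h.
have [ht hs] : t < n /\ size s < n by apply: (@at_bound o.[10] t s); exists o.
apply/hasP; exists w; rewrite ?en_mem // hF; apply: tab_complete h _ _ hd _.
move: ht hs; clear; lia.
Qed.

(** Final cells are enumerated by their anchors [v < n], which determine the word over them; by the
    parser this word is [zx I] for some [I], so the concatenation is the code of a list. *)
Lemma gdec_list L : exists ls,
  flatten (mkseq (fun v => if finalb VM DM x v then word VM DM x v else [::]) n) = enc_list ls /\
  (final_cond L VM DM n (gb x) <-> forall I, I \in ls -> L I).
Proof.
have hword v : finalb VM DM x v -> exists I, word VM DM x v = zx I.
  move=> /finalb_at[o [t [s [w [h1 h2 h3 h4 h5]]]]].
  rewrite (word_zof (v := v) (t := t) (s := s)); last by exists o.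
  move: h4 h5; rewrite /DV; case Ep : (pst (labs s)) => [p|] //= [<-] /andP[/= hp _].
  by have [I [g [h ->]]] := pst_tword Ep hp; exists I; rewrite zof_tword.
have [ls [hls1 hls2]] : exists ls,
    flatten (mkseq (fun v => if finalb VM DM x v then word VM DM x v else [::]) n) = enc_list ls /\
    forall I, I \in ls <-> exists v, [/\ v < n, finalb VM DM x v & word VM DM x v = zx I].
  elim: {1 2}n => [|m [ls [h1 h2]]]; first by exists [::]; split=> // I; split=> // -[v []].
  rewrite mkseqS flatten_rcons h1; case hf : (finalb VM DM x m); last first.
    exists ls; rewrite cats0; split=> // I; split=> [/h2[v [hv k1 k2]]|[v [hv k1 k2]]].
      by exists v; split=> //; apply: leqW.
    apply/h2; exists v; split=> //; move: hv; rewrite ltnS leq_eqVlt => /orP[/eqP e|//].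
    by move: k1; rewrite e hf.
  have [J hJ] := hword _ hf; exists (rcons ls J); rewrite hJ; split.
    by rewrite /enc_list map_rcons flatten_rcons.
  move=> I; rewrite mem_rcons inE; split.
    case/orP=> [/eqP ->|/h2[v [hv k1 k2]]]; first by exists m.
    by exists v; split=> //; apply: leqW.
  move=> [v [hv k1 k2]]; move: hv; rewrite ltnS leq_eqVlt => /orP[/eqP e|hv].
    by subst v; move: k2; rewrite hJ => /zx_inj ->; rewrite eqxx.
  by apply/orP; right; apply/h2; exists v.
exists ls; split=> //; split.
  move=> hc I /hls2[v [hv /finalb_at[o [t [s [w [h1 h2 h3 h4 h5]]]]] hz]].
  apply: (hc o t s w I) => //; rewrite -hz; apply: esym; apply: (@word_zof v t); by exists o.
move=> hI o t s w I h1 h2 h3 h4 hz; apply: hI; apply/hls2; exists o.[10]; split.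
- exact: (occ_lt (grid_occ h1) g10).
- exact: at_finalb h1 h2 h3 h4.
- by rewrite -hz; apply: (@word_zof _ t); exists o.
Qed.

End DecoderCorrect.

Lemma FFO_nil x n bs : graph_code x n bs -> FFO [::] x.
Proof. by move=> h; exists n, bs; split=> //; exists 1%g. Qed.

Lemma FFO_struct VM DM x n bs : graph_code x n bs -> FFO (FFs VM DM) x ->
  struct_ok (WT VM DM) n (adjn n bs).
Proof. by move=> hx /(FFO_viol _ _ _ _ _ hx) [pos /struct_of_noviol]. Qed.

Theorem theorem4p4 (L : lang) :
  in_NP L ->
  exists Fs : seq ograph,
    (forall F, F \in Fs -> wf_ograph F /\ connected_ograph F) /\
    poly_reduces L (FFO Fs) /\
    (exists g : seq bool -> seq bool, poly_computable g /\
       forall (x : seq bool) (n : nat) (bs : seq bool), graph_code x n bs ->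
         exists ls : seq (seq bool),
           g x = enc_list ls /\ (FFO Fs x <-> forall I, I \in ls -> L I)).
Proof.
move=> [V [cL [kL [[VM [cV [kV hVM]]] hL]]]].
have [DM [cD [kD hDM]]] := ptime_hD cL kL cV kV.
case: (excluded_middle_informative (exists n0, ~ L n0)) => [[n0 hn0]|hall]; last first.
  have hLx x : L x by apply: NNPP => hx; apply: hall; exists x.
  have h0 : graph_code [:: false] 0 [::] by split=> //; split=> //; split; case.
  exists [::]; split=> //; split.
    exists (fun _ => [:: false]); split; first exact: ptime_computable (ptime_const _).
    by move=> x; split=> // _; apply: FFO_nil h0.
  exists (fun _ => [::]); split; first exact: ptime_computable (ptime_const _).
  by move=> x n bs hx; exists [::]; split=> //; split=> // _; apply: FFO_nil hx.
exists (FFs VM DM); split; first by move=> F; apply: ffs_wf.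
split.
  exists (redf cL kL cD kD VM DM); split; first exact: redf_computable.
  exact: redf_correct hL hVM hDM.
exists (gdec VM DM n0); split=> [|x n bs hx]; first exact: gdec_computable.
have [en eb] := graph_codeE hx; rewrite -en -eb in hx; have [hw _] := hx.
rewrite /gdec; case: sbadP => [hbad|/NNPP ok].
  exists [:: n0]; split; first by rewrite /enc_list /= cats0.
  split=> [/(FFO_struct hx)//|/(_ n0)]; by rewrite mem_head => /(_ isT).
have [ls [-> hls]] := gdec_list hw ok L; exists ls; split=> //.
exact: iff_trans (FFO_grid hL hVM hDM hw ok hx) hls.
Qed.
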